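(* There is a universal constant $c$ such that the following holds. Let $A$ be an $n\times n$ Hermitian matrix and let $W$ be an $n\times n$ GUE matrix with entries of variance $1/n$. Let $\lambda_{1,t}\le\dots\le\lambda_{n,t}$ be the eigenvalues of $A+\sqrt t\,W$, and let $u_{j,t}$ be a corresponding orthonormal basis of eigenvectors. Write $u_{k,t}$ in the basis $(u_{j,0})_j$ to obtain a vector $v_{k,t}$. Let $m(z)=\frac1n\operatorname{Tr}(A-zI)^{-1}$. Let $E_\ell<E_u$ and $K_2=\{k:\lambda_{k,t}\in[E_\ell,E_u]\}$. Let $K$ be some set of indices $j$ for which $$\lambda_{j,0}\in[E_\ell+1/n,\,E_u-1/n],\qquad |m(\lambda_{j,0}+i/n)|\le(nt)^{-1/2}.$$ Let $b$ be the number of $\lambda_{k,0}$ in $[E_\ell-3\sqrt t,\,E_u+3\sqrt t]$. Then for $t\ge e^{-\sqrt n}$ we have $$\mathbb E\,\frac1{|K_2|}\sum_{k\in K_2}\ \sum_{\substack{j\in K\\ |\lambda_{k,t}-\lambda_{j,0}|<1/n}}|v_{k,t}(j)|^2\ \ge\ \frac{|K|}{b}\left(1-c\sqrt{nt}\right).$$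
   Context: A GUE matrix with entries of variance $1/n$ is $W=G+G^*$ with $G$ an $n\times n$ matrix of independent centered complex Gaussian entries of variance $1/(2n)$. The matrix $A$ and the set $K$ are deterministic; $v_{k,t}(j)=\langle u_{k,t},u_{j,0}\rangle$. The quantity inside the expectation is read as $0$ when $K_2=\emptyset$, and $|K|/b$ is read as $0$ when $K=\emptyset$. *)

(* Defs.v *)
(* MathComp / MathComp-Analysis, with R[i] from mathcomp-real-closed. *)
From mathcomp Require Export all_boot all_order all_algebra.
From mathcomp Require Export complex.
From mathcomp Require Export all_classical all_reals all_analysis.

Set Implicit Arguments.
Unset Strict Implicit.
Unset Printing Implicit Defensive.

Export Order.TTheory GRing.Theory Num.Theory.
Export numFieldNormedType.Exports.

Local Open Scope classical_set_scope.
Local Open Scope ring_scope.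
Local Open Scope complex_scope.
Local Open Scope sesquilinear_scope.

Definition mutually_independent (R : realType) (d : measure_display)
    (T : measurableType d) (P : probability T R) (d' : measure_display)
    (T' : measurableType d') (I : finType) (X : I -> T -> T') : Prop :=
  forall (J : {set I}) (B : I -> set T'), (forall i, measurable (B i)) ->
    P (\bigcap_(i in [set` J]) (X i @^-1` B i)) =
    (\prod_(i in J) fine (P (X i @^-1` B i)))%:E.

Definition re_im {R : realType} (z : R[i]) : R * R := (complex.Re z, complex.Im z).

(* Variance [v] means E|Z|^2 = v: the real and imaginary parts are independent
   and each has law N(0, v/2).  [normal_prob] takes a standard deviation. *)
Definition centered_complex_gaussian (R : realType) (d : measure_display)
    (T : measurableType d) (P : probability T R) (v : R) (Z : T -> R[i]) : Prop :=
  measurable_fun setT (re_im \o Z) /\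
  forall B1 B2 : set R, measurable B1 -> measurable B2 ->
    P ((re_im \o Z) @^-1` (B1 `*` B2)) =
    (normal_prob 0 (Num.sqrt (v / 2)) B1 * normal_prob 0 (Num.sqrt (v / 2)) B2)%E.

(* Entries of variance 1/n: an off-diagonal entry G i j + (G j i)^* has variance
   2 * 1/(2n), and a diagonal one 2 Re (G i i) has variance 4 * 1/(4n). *)
Definition gue (R : realType) (d : measure_display) (T : measurableType d)
    (P : probability T R) (n : nat) (W : T -> 'M[R[i]]_n) : Prop :=
  exists G : T -> 'M[R[i]]_n,
    [/\ forall i j, centered_complex_gaussian P (2 * n%:R)^-1 (fun w => G w i j),
        mutually_independent P
          (fun (ij : 'I_n * 'I_n) w => re_im (G w ij.1 ij.2))
      & forall w, W w = G w + (G w)^t* ].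

Definition inner (R : realType) (n : nat) (x y : 'cV[R[i]]_n) : R[i] :=
  (y^t* *m x) 0 0.

Definition eigensystem (R : realType) (n : nat) (M : 'M[R[i]]_n)
    (lam : 'I_n -> R) (u : 'I_n -> 'cV[R[i]]_n) : Prop :=
  [/\ forall i j : 'I_n, (i <= j)%N -> lam i <= lam j,
      forall i j, inner (u i) (u j) = (i == j)%:R
    & forall i, M *m u i = (lam i)%:C *: u i ].

Definition stieltjes (R : realType) (n : nat) (A : 'M[R[i]]_n) (z : R[i]) : R[i] :=
  n%:R^-1 * \tr (invmx (A - z%:M)).

(* Main.v *)
(* The idea is to compare the resolvent G = (A + sqrt t W - z)^-1 at
   z = lambda_j + i/n with R = (A - w)^-1, where w = z + t m and m = tr G / n.
   With s = sqrt (n t), Gaussian integration by parts shows that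
   eps = m - tr R / n has E |eps|^2 <= 3, because the error terms carry powers of
   t that absorb the trivial bound |G| <= n, and likewise that
   E (Im G_jj - Im R_jj) / n is O(s^4).  As u_j is an eigenvector of A, R_jj is
   explicit and 1 - Im R_jj / n <= min (1, s^2 |m|); the hypothesis on
   m(lambda_j + i/n) propagates to s^2 |m| <= 2 s + 2 s^2 |eps|.  Hence
   1 - E Im G_jj / n <= 3 s, while the mass of u_j on eigenvectors with
   |lambda_{k,t} - lambda_j| < 1/n is at least 2 Im G_jj / n - 1.

   The normalization is handled by |K_2| <= b, which holds when |W| <= 3 by a
   dimension count.  The failure of |W| <= 3 is dominated by tr W^p / 3^p for p of
   order sqrt n, whose expectation is controlled by a recursion for the mixed
   moments E prod tr W^(k_i), majorized by a product of perturbed Catalan numbers;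
   this is where t >= e^(-sqrt n) enters. *)

From mathcomp Require Import zify ring lra measurable_realfun perm.
Require Import Defs.

Set Implicit Arguments.
Unset Strict Implicit.
Unset Printing Implicit Defensive.

Local Open Scope classical_set_scope.
Local Open Scope ring_scope.
Local Open Scope complex_scope.
Local Open Scope sesquilinear_scope.

(** * Gaussian integration by parts *)

(** The eigenvectors of the perturbed matrix are an arbitrary choice for each outcome, so the
    averaged overlap need not be measurable. It is compared pointwise with a lower bound that
    depends on the matrix alone, built from resolvent entries and the trace of one power. The
    exceptional situations (large norm, no eigenvalue in the interval) are absorbed in that
    pointwise inequality, without conditioning.

    The shift t m in w is dictated by integration by parts: the derivative that falls on G
    reproduces t m, so the leading terms cancel, and the derivative of R remains, which sees the
    matrix only through the scalar m. At height 1/n both the resolvents and Im m may a priori be as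
    large as n. The estimates close because the imaginary part of w grows with Im m, so that |R| <=
    n / (1 + s^2 Im m), while by the Ward identity the squared Hilbert-Schmidt norm of G is n^2 Im
    m.

    The growth rate 5/2 of the moment majorant lies strictly between the spectral edge 2 of the GUE
    and the threshold 3: there is room for the perturbation of the Catalan recursion, and the tail
    still decays exponentially in p. *)

Section gauss1.
Variable R : realType.
Implicit Types (x y s v : R).

(** The linear bound 1 + y <= (1 + 1/b) e^(b y) is raised to the power m. Dividing [a] by m + 1
    keeps m b <= a and covers m = 0. *)
Lemma poly_le_exp (a : R) m : 0 < a ->
  exists2 C, 0 < C & forall y, 0 <= y -> (1 + y) ^+ m <= C * expR (a * y).
Proof.
move=> a0; set b := a / m.+1%:R.
have b0 : 0 < b by rewrite divr_gt0.
have bi0 : 0 < b^-1 by rewrite invr_gt0.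
exists ((1 + b^-1) ^+ m); first by rewrite exprn_gt0// addr_gt0.
move=> y y0.
have h : 1 + y <= (1 + b^-1) * expR (b * y).
  apply: le_trans (_ : (1 + b^-1) * (1 + b * y) <= _).
    have -> : (1 + b^-1) * (1 + b * y) = 1 + y + (b^-1 + b * y + (b^-1 * b - 1) * y) by ring.
    rewrite mulVf ?gt_eqF// subrr mul0r addr0 lerDl addr_ge0 ?mulr_ge0// ltW//.
  by rewrite ler_wpM2l ?expR_ge1Dx// addr_ge0// ltW.
apply: le_trans (_ : ((1 + b^-1) * expR (b * y)) ^+ m <= _).
  by rewrite lerXn2r// nnegrE ?addr_ge0 ?mulr_ge0 ?expR_ge0 ?addr_ge0// ltW.
rewrite exprMn ler_wpM2l ?exprn_ge0 ?addr_ge0 ?(ltW bi0)//.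
rewrite -expRM_natl ler_expR /b.
have -> : m%:R * (a / m.+1%:R * y) = (a * y) * (m%:R / m.+1%:R) by ring.
by rewrite ler_piMr ?mulr_ge0 ?(ltW a0)// ler_pdivrMr// mul1r ler_nat.
Qed.

Definition poly_bounded (f : R -> R) := exists C m, forall x, `|f x| <= C * (1 + x ^+ 2) ^+ m.

(** The density [normal_pdf] and the Radon-Nikodym derivative of [normal_prob] have the same
    integral over every measurable set, so they agree almost everywhere. *)
Lemma integral_normal_ge0 s (f : R -> \bar R) :
  measurable_fun setT f -> (forall x, (0 <= f x)%E) ->
  (\int[normal_prob 0 s]_x f x = \int[lebesgue_measure]_x (f x * (normal_pdf 0 s x)%:E))%E.
Proof.
move=> mf f0.
have dom := normal_prob_dominates (0 : R) s.
rewrite -(@Radon_Nikodym_SigmaFinite.change_of_variables _ _ _ _ _ dom f setT)//.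
have mpdf : measurable_fun setT (fun x => (normal_pdf 0 s x)%:E).
  by apply/measurable_EFinP; exact: measurable_normal_pdf.
have iRN := Radon_Nikodym_SigmaFinite.f_integrable dom.
have mRN := measurable_int _ iRN.
apply: ae_eq_integral => //.
- exact: emeasurable_funM.
- exact: emeasurable_funM.
apply: ae_eqe_mul2l.
apply: integral_ae_eq => //.
by move=> E _ mE; rewrite -(Radon_Nikodym_SigmaFinite.f_integral dom).
Qed.

Lemma normal_pdf0E s x : s != 0 ->
  normal_pdf 0 s x = normal_peak s * expR (- x ^+ 2 / (s ^+ 2 *+ 2)).
Proof. by move=> s0; rewrite normal_pdfE// /normal_fun subr0. Qed.

(** Doubling the standard deviation leaves a surplus 3 x^2 / (8 s^2) in the exponent, which absorbs
    any polynomial. This domination serves both integrability and the decay at infinity. *)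
Lemma poly_bounded_pdf s (f : R -> R) : 0 < s -> poly_bounded f ->
  exists2 C, 0 <= C & forall x, `|f x| * normal_pdf 0 s x <= C * normal_pdf 0 (2 * s) x.
Proof.
move=> s0 [C [m fC]].
have a0 : 0 < 3 / (8 * s ^+ 2) by rewrite divr_gt0// mulr_gt0// exprn_gt0.
have [D D0 hD] := poly_le_exp m a0.
have s2 : 0 < 2 * s by rewrite mulr_gt0.
have p1 : 0 < normal_peak s by rewrite normal_peak_gt0// gt_eqF.
have p2 : 0 < normal_peak (2 * s) by rewrite normal_peak_gt0// gt_eqF.
have C0 : 0 <= C.
  by have := fC 0; rewrite expr0n/= addr0 expr1n mulr1; apply: le_trans.
exists (C * D * normal_peak s / normal_peak (2 * s)).
  by rewrite !mulr_ge0 ?invr_ge0 ?(ltW D0) ?(ltW p1) ?(ltW p2).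
move=> x; rewrite !normal_pdf0E ?gt_eqF//.
have -> : C * D * normal_peak s / normal_peak (2 * s) *
  (normal_peak (2 * s) * expR (- x ^+ 2 / ((2 * s) ^+ 2 *+ 2))) =
  C * D * normal_peak s * expR (- x ^+ 2 / ((2 * s) ^+ 2 *+ 2)).
  by rewrite -!mulrA; congr (_ * (_ * (_ * _))); rewrite mulKf// gt_eqF.
have -> : - x ^+ 2 / ((2 * s) ^+ 2 *+ 2) = 3 / (8 * s ^+ 2) * x ^+ 2 + - x ^+ 2 / (s ^+ 2 *+ 2).
  by field; rewrite gt_eqF.
rewrite expRD mulrCA.
rewrite [leRHS](_ : _ = normal_peak s * (C * (D * expR (3 / (8 * s ^+ 2) * x ^+ 2)) *
   expR (- x ^+ 2 / (s ^+ 2 *+ 2)))); last by ring.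
rewrite ler_pM2l// ler_pM2r ?expR_gt0// (le_trans (fC x))// ler_wpM2l// hD// sqr_ge0//.
Qed.

Lemma poly_bounded_integrable s (f : R -> R) : 0 < s -> poly_bounded f ->
  measurable_fun setT f ->
  (@lebesgue_measure R).-integrable setT (fun x => (f x * normal_pdf 0 s x)%:E).
Proof.
move=> s0 pf mf; have [C C0 fC] := poly_bounded_pdf s0 pf.
apply: (@le_integrable _ _ _ lebesgue_measure _ measurableT (fun x => (f x * normal_pdf 0 s x)%:E) (fun x => (C%:E * (normal_pdf 0 (2 * s) x)%:E)%E)).
- apply/measurable_EFinP; apply: measurable_funM => //; exact: measurable_normal_pdf.
- move=> x _; rewrite abse_EFin abseM !abse_EFin (ger0_norm (normal_pdf_ge0 _ _ _)) -EFinM lee_fin.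
  rewrite normrM (ger0_norm (normal_pdf_ge0 _ _ _)).
  by rewrite (le_trans (fC x))// ler_wpM2r ?normal_pdf_ge0// ler_norm.
- apply: integrableZl => //; exact: integrable_normal_pdf.
Qed.

Lemma integral_normal s (f : R -> R) : 0 < s -> poly_bounded f ->
  measurable_fun setT f ->
  (normal_prob 0 s).-integrable setT (EFin \o f) /\
  (\int[normal_prob 0 s]_x (f x)%:E = \int[lebesgue_measure]_x (f x * normal_pdf 0 s x)%:E)%E.
Proof.
move=> s0 pf mf.
have mfE : measurable_fun setT (EFin \o f) by exact/measurable_EFinP.
have If := poly_bounded_integrable s0 pf mf.
split.
  apply/integrableP; split => //.
  rewrite integral_normal_ge0//; last exact: measurableT_comp.
  move/integrableP : If => [_]; apply: le_lt_trans.
  rewrite le_eqVlt; apply/orP; left; apply/eqP; apply: eq_integral => x _.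
  by rewrite EFinM abseM [X in (_ = _ * X)%E]gee0_abs ?lee_fin ?normal_pdf_ge0.
rewrite integralE integral_normal_ge0//; last exact: measurable_funepos.
rewrite integral_normal_ge0//; last exact: measurable_funeneg.
rewrite [RHS]integralE; congr (_ - _)%E; apply: eq_integral => x _.
  by rewrite !funeposE muleC maxe_pMr ?lee_fin ?normal_pdf_ge0// mule0 -EFinM mulrC.
rewrite !funenegE muleC maxe_pMr ?lee_fin ?normal_pdf_ge0// mule0 muleN -EFinM.
by rewrite mulrC.
Qed.

Lemma is_derive_normal_pdf s x : s != 0 ->
  is_derive x 1 (normal_pdf 0 s) (- (x / s ^+ 2) * normal_pdf 0 s x).
Proof.
move=> s0.
have -> : normal_pdf 0 s = (fun x => normal_peak s * expR (- x ^+ 2 / (s ^+ 2 *+ 2))).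
  by apply/funext => y; rewrite normal_pdf0E.
apply: is_derive_eq.
rewrite /GRing.scale/=; field.
by rewrite s0.
Qed.

Lemma poly_bounded_pdf_cvg0 s (f : R -> R) : 0 < s -> poly_bounded f ->
  (fun n : nat => f n%:R * normal_pdf 0 s n%:R) @ \oo --> 0 /\
  (fun n : nat => f (- n%:R) * normal_pdf 0 s (- n%:R)) @ \oo --> 0.
Proof.
move=> s0 pf; have [C C0 fC] := poly_bounded_pdf s0 pf.
have s2 : 0 < 2 * s by rewrite mulr_gt0.
have key (D : R) : 0 <= D -> forall g : R -> R, (forall x, `|g x| <= D * expR (- x ^+ 2 / ((2 * s) ^+ 2 *+ 2))) ->
   forall e : nat -> R, (forall n, (e n) ^+ 2 = n%:R ^+ 2) -> g (e n) @[n --> \oo] --> 0.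
  move=> D0 g gD e he; apply/cvgr0Pnorm_lt => eps eps0.
  have sq0 : 0 < (2 * s) ^+ 2 *+ 2 by rewrite mulrn_wgt0// exprn_gt0.
  have : \forall n \near \oo, ((2 * s) ^+ 2 *+ 2) * (D / eps) < n%:R.
    exact: nbhs_infty_gtr.
  have : \forall n \near \oo, (0 < n)%N by exact: nbhs_infty_gt.
  apply: filterS2 => n n0 hn.
  rewrite (le_lt_trans (gD _))// he mulNr expRN ltr_pdivrMr ?expR_gt0//.
  rewrite mulrC -ltr_pdivrMr//.
  have h : D / eps < n%:R ^+ 2 / ((2 * s) ^+ 2 *+ 2).
    rewrite ltr_pdivlMr// mulrC (lt_le_trans hn)// ler_eXnr// ler1n//.
  by rewrite (lt_le_trans h)// (le_trans _ (expR_ge1Dx _))// lerDr.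
have C1 : 0 <= C * normal_peak (2 * s) by rewrite mulr_ge0 ?normal_peak_ge0.
have h x : `|f x * normal_pdf 0 s x| <= C * normal_peak (2 * s) * expR (- x ^+ 2 / ((2 * s) ^+ 2 *+ 2)).
  rewrite normrM (ger0_norm (normal_pdf_ge0 _ _ _)) (le_trans (fC x))//.
  by rewrite normal_pdf0E ?gt_eqF// mulrA.
split.
- by apply: (key _ C1 (fun x => f x * normal_pdf 0 s x) h (fun n => n%:R)).
- by apply: (key _ C1 (fun x => f x * normal_pdf 0 s x) h (fun n => - n%:R)) => n; rewrite sqrrN.
Qed.

(** The fundamental theorem of calculus on [-n, n], followed by dominated convergence with |g'| as
    the dominating function. The boundary values are needed along the integers only. *)
Lemma integral_derive0 (g g' : R -> R) :
  (forall x : R, is_derive x 1 g (g' x)) -> continuous g' ->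
  (@lebesgue_measure R).-integrable setT (EFin \o g') ->
  (fun n : nat => g n%:R) @ \oo --> 0 -> (fun n : nat => g (- n%:R)) @ \oo --> 0 ->
  (\int[lebesgue_measure]_x (g' x)%:E = 0)%E.
Proof.
move=> dg cg' ig' g1 g2.
have dgv x : derivable g x 1 by [].
have cg : continuous g by move=> x; apply: differentiable_continuous; apply/derivable1_diffP.
pose F (n : nat) (x : R) : \bar R := (\1_(`[- n%:R, n%:R] : set R) x * g' x)%:E.
have mg' : measurable_fun setT (EFin \o g') := measurable_int _ ig'.
have mF n : measurable_fun setT (F n).
  apply/measurable_EFinP; apply: measurable_funM; last exact/measurable_EFinP.
  exact: measurable_indic.
have IF n : (0 < n)%N -> (\int[lebesgue_measure]_x F n x = (g n%:R - g (- n%:R))%:E)%E.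
  move=> n0; rewrite EFinB -(@continuous_FTC2 _ g' g)//.
  - rewrite [RHS]integral_mkcond; apply: eq_integral => x _.
    by rewrite patchE /F indicE; case: ifP => _; rewrite ?mul1r ?mul0r.
  - by rewrite (lt_trans (y := 0))// ?oppr_lt0 ltr0n.
  - exact: continuous_subspaceT.
  - split => //; first by apply: cvg_at_right_filter; exact: cg.
    by apply: cvg_at_left_filter; exact: cg.
  - by move=> x _; rewrite derive1E; apply: derive_val.
have [] := @dominated_convergence _ _ _ lebesgue_measure setT measurableT F (EFin \o g') (fun x => `|(g' x)%:E|%E) mF mg'.
- apply: nearW => x _; apply: cvg_near_cst.
  have : \forall n \near \oo, `|x| < n%:R by exact: nbhs_infty_gtr.
  apply: filterS => n hn; rewrite /F indicE mem_set ?mul1r//=.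
  by rewrite in_itv/= -ler_norml ltW.
- exact: integrable_abse.
- apply: nearW => x n _; rewrite /F /= lee_fin normrM ler_piMl//.
  by rewrite indicE; case: (_ \in _); rewrite ?normr1 ?normr0.
move=> _ _ h.
have h2 : (\int[lebesgue_measure]_x F n x)%E @[n --> \oo] --> 0%E.
  have h3 : (fun n : nat => (g n%:R - g (- n%:R))%:E) @ \oo --> 0%E.
    apply/fine_cvgP; split; first exact: nearW.
    rewrite -(subr0 (0 : R)); apply: cvgB => //.
  apply: cvg_trans h3; apply: near_eq_cvg.
  have : \forall n \near \oo, (0 < n)%N by exact: nbhs_infty_gt.
  by apply: filterS => n n0; rewrite IF.
by apply/esym; apply: (cvg_unique _ h2 h).
Qed.

(** Stein's identity: f times the density has derivative (f' - x f / s^2) times the density, and the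
    integral of this derivative over the line vanishes. *)
Lemma gauss_ibp s (f f' : R -> R) : 0 < s ->
  (forall x : R, is_derive x 1 f (f' x)) -> continuous f' -> poly_bounded f -> poly_bounded f' ->
  (\int[normal_prob 0 s]_x (x * f x)%:E =
   (s ^+ 2)%:E * \int[normal_prob 0 s]_x (f' x)%:E)%E.
Proof.
move=> s0 df cf' pf pf'.
have sn0 : s != 0 by rewrite gt_eqF.
have cf : continuous f.
  by move=> x; apply: differentiable_continuous; apply/derivable1_diffP.
have mf : measurable_fun setT f by exact: continuous_measurable_fun.
have mf' : measurable_fun setT f' by exact: continuous_measurable_fun.
have mxf : measurable_fun setT (fun x => x * f x) by exact: measurable_funM.
have pxf : poly_bounded (fun x => x * f x).
  have [C [m fC]] := pf; exists C, m.+1 => x.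
  rewrite normrM exprS mulrCA; apply: ler_pM => //.
  by rewrite -ler_sqr ?nnegrE ?addr_ge0 ?sqr_ge0// real_normK ?num_real//; nra.
have [ixf ->] := integral_normal s0 pxf mxf.
have [if' ->] := integral_normal s0 pf' mf'.
have jxf := poly_bounded_integrable s0 pxf mxf.
have jf' := poly_bounded_integrable s0 pf' mf'.
pose g x := f x * normal_pdf 0 s x.
pose g' x := f' x * normal_pdf 0 s x - (s ^+ 2)^-1 * (x * f x * normal_pdf 0 s x).
have dg (x : R) : is_derive x 1 g (g' x).
  have := is_derive_normal_pdf x sn0 => h.
  apply: is_derive_eq; rewrite /GRing.scale/= /g'; field.
  by rewrite sn0.
have cpdf : continuous (normal_pdf 0 s) by exact: continuous_normal_pdf.
have cg' : continuous g'.
  move=> x; apply: cvgB; first by apply: cvgM; [exact: cf'|exact: cpdf].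
  apply: cvgM; first exact: cvg_cst.
  by apply: cvgM; [apply: cvgM; [exact: cvg_id|exact: cf]|exact: cpdf].
have E : (EFin \o g') = (fun x => (f' x * normal_pdf 0 s x)%:E - ((s ^+ 2)^-1)%:E * (x * f x * normal_pdf 0 s x)%:E)%E.
  by apply/funext => x; rewrite /g' /= EFinB EFinM.
have jxf2 : (@lebesgue_measure R).-integrable setT (fun x => ((s ^+ 2)^-1)%:E * (x * f x * normal_pdf 0 s x)%:E)%E.
  exact: integrableZl.
have ig' : (@lebesgue_measure R).-integrable setT (EFin \o g').
  by rewrite E; apply: integrableB.
have [c1 c2] := poly_bounded_pdf_cvg0 s0 pf.
have : (\int[lebesgue_measure]_x ((f' x * normal_pdf 0 s x)%:E - ((s ^+ 2)^-1)%:E * (x * f x * normal_pdf 0 s x)%:E) = 0)%E.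
  rewrite -(integral_derive0 dg cg' ig' c1 c2); apply: eq_integral => x _.
  by rewrite /g' /= EFinB EFinM.
rewrite integralB// integralZl//.
have [u uE] : exists u, (\int[lebesgue_measure]_x (f' x * normal_pdf 0 s x)%:E)%E = u%:E.
  by exists (fine (\int[lebesgue_measure]_x (f' x * normal_pdf 0 s x)%:E)%E); rewrite fineK// integrable_fin_num.
have [w wE] : exists u, (\int[lebesgue_measure]_x (x * f x * normal_pdf 0 s x)%:E)%E = u%:E.
  by exists (fine (\int[lebesgue_measure]_x (x * f x * normal_pdf 0 s x)%:E)%E); rewrite fineK// integrable_fin_num.
rewrite uE wE -!EFinM -EFinB => -[/eqP]; rewrite subr_eq0 => /eqP ->.
by rewrite mulVKf// expf_neq0.
Qed.

End gauss1.

(** * Integration by parts in finitely many independent Gaussian coordinates *)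

(** Measurability is expressed by composition with arbitrary measurable families, so that the same
    [F] can be used on the probability space and on the product space where one coordinate is
    freed. *)
Definition coord_measurable (R : realType) (I : finType) (F : (I -> R) -> R) :=
  forall d (T : measurableType d) (Y : T -> I -> R),
    (forall i, measurable_fun setT (Y ^~ i)) -> measurable_fun setT (F \o Y).

Definition coord_poly (R : realType) (I : finType) (F : (I -> R) -> R) :=
  exists C m, forall xi, `|F xi| <= C * (1 + \sum_i xi i ^+ 2) ^+ m.

Definition upd (R : realType) (I : finType) (xi : I -> R) (k : I) (x : R) : I -> R :=
  fun i => if i == k then x else xi i.

Lemma coord_polyM (R : realType) (I : finType) (k : I) (F : (I -> R) -> R) :
  coord_poly F -> coord_poly (fun xi => xi k * F xi).
Proof.
move=> [C [m FC]]; exists C, m.+1 => xi.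
have S0 : 0 <= \sum_(i | i != k) xi i ^+ 2 by apply: sumr_ge0 => i _; rewrite sqr_ge0.
rewrite normrM exprS mulrCA; apply: ler_pM => //.
rewrite -ler_sqr ?nnegrE ?addr_ge0 ?sumr_ge0 ?sqr_ge0//; last by move=> i _; rewrite sqr_ge0.
rewrite real_normK ?num_real// (bigD1 k)//=.
by have := sqr_ge0 (xi k); nra.
Qed.

Lemma coord_measurableM (R : realType) (I : finType) (k : I) (F : (I -> R) -> R) :
  coord_measurable F -> coord_measurable (fun xi => xi k * F xi).
Proof.
by move=> mF d' T' Y' mY'; apply: measurable_funM; [exact: mY'|exact: mF].
Qed.

Section multi.
Variables (R : realType) (d : measure_display) (T : measurableType d).
Variables (P : probability T R) (I : finType) (s : R) (X : T -> I -> R).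
Hypothesis s0 : 0 < s.
Hypothesis mX : forall i, measurable_fun setT (X ^~ i).
Hypothesis jointX : forall B : I -> set R, (forall i, measurable (B i)) ->
  P (\bigcap_(i in [set: I]) ((X ^~ i) @^-1` B i)) =
  (\prod_i fine (normal_prob 0 s (B i)))%:E.

Lemma normal_probT : normal_prob 0 s [set: R] = 1%E.
Proof. exact: probability_setT. Qed.

Lemma lawX k (A : set R) : measurable A -> P ((X ^~ k) @^-1` A) = normal_prob 0 s A.
Proof.
move=> mA; pose B i := if i == k then A else setT.
have -> : (X ^~ k) @^-1` A = \bigcap_(i in [set: I]) ((X ^~ i) @^-1` B i).
  apply/seteqP; split=> w /=.
    by move=> Aw i _; rewrite /B /=; case: eqP => // ->.
  by move/(_ k Logic.I); rewrite /B eqxx.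
rewrite jointX; last by move=> i; rewrite /B; case: ifP.
rewrite (bigD1 k)//= big1 ?mulr1 ?/B ?eqxx; last first.
  by move=> i /negbTE ik; rewrite ik normal_probT.
rewrite fineK// fin_num_measure//.
Qed.

(* These generate the sigma-algebra of the coordinates other than [k]; that
   sigma-algebra makes [T] a measurable type [Tk k], and independence says that
   [w |-> (w, X w k)] has a product law on [Tk k * R]. *)
Let cylinder k : set (set T) := [set A | exists B : I -> set R,
  [/\ forall i, measurable (B i), B k = setT &
      A = \bigcap_(i in [set: I]) ((X ^~ i) @^-1` B i)]].

Lemma cylinder_measurable k : cylinder k `<=` measurable.
Proof.
move=> _ [B [mB _ ->]]; apply: fin_bigcap_measurable; first exact: finite_finset.
by move=> i _; rewrite -[_ @^-1` _]setTI; exact: mX.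
Qed.

Lemma cylinderI k : setI_closed (cylinder k).
Proof.
move=> _ _ [B [mB Bk ->]] [C [mC Ck ->]].
exists (fun i => B i `&` C i); split.
- by move=> i; apply: measurableI.
- by rewrite Bk Ck setTI.
- by rewrite bigcapI.
Qed.

Lemma cylinderT k : cylinder k setT.
Proof.
exists (fun=> setT); split => //.
by apply/seteqP; split => // w _ i _.
Qed.

(** Both sides are finite measures in [B]. They agree on the cylinders, which are stable under
    intersection, hence on the sigma-algebra that these generate. *)
Lemma cylinder_indep k (A : set R) (B : set T) : measurable A ->
  <<s cylinder k >> B ->
  P ((X ^~ k) @^-1` A `&` B) = (normal_prob 0 s A * P B)%E.
Proof.
move=> mA.
have mXA : measurable ((X ^~ k) @^-1` A).
  by rewrite -[_ @^-1` _]setTI; exact: mX.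
have gA0 : 0 <= fine (normal_prob 0 s A) by rewrite fine_ge0.
pose m1 := mrestr P mXA.
pose m2 := mscale (NngNum gA0) P.
have E : forall E, <<s cylinder k >> E -> m1 E = m2 E.
  apply: (@g_sigma_algebra_measure_unique _ _ _ (cylinder k) _ (fun=> setT)) => //.
  - exact: cylinder_measurable.
  - by move=> _; exact: cylinderT.
  - by apply/seteqP; split => // x _; exists 0%N.
  - exact: cylinderI.
  - move=> _ [C [mC Ck ->]].
    change (P (\bigcap_(i in [set: I]) ((X ^~ i) @^-1` C i) `&` (X ^~ k) @^-1` A) =
      ((fine (normal_prob 0 s A))%:E * P (\bigcap_(i in [set: I]) ((X ^~ i) @^-1` C i)))%E).
    pose D i := if i == k then A else C i.
    have -> : \bigcap_(i in [set: I]) ((X ^~ i) @^-1` C i) `&` (X ^~ k) @^-1` A =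
       \bigcap_(i in [set: I]) ((X ^~ i) @^-1` D i).
      apply/seteqP; split=> w /=.
        by move=> [h Aw] i _; rewrite /D /=; case: eqP => [->//|_]; exact: h.
      move=> h; split; last by have := h k Logic.I; rewrite /D eqxx.
      move=> i _ /=; have := h i Logic.I; rewrite /D /=; case: eqP => [->|//].
      by rewrite Ck.
    rewrite jointX; last by move=> i; rewrite /D; case: ifP.
    rewrite jointX// (bigD1 k)//= [in RHS](bigD1 k)//= /D eqxx Ck normal_probT/= mul1r.
    rewrite -EFinM; congr (_ * _)%:E.
    by apply: eq_bigr => i /negbTE ->.
  - move=> _; change (P (setT `&` (X ^~ k) @^-1` A) < +oo)%E; rewrite setTI; apply: le_lt_trans (probability_le1 P mXA) _.
    by rewrite ltry.
move=> sB; have : P (B `&` (X ^~ k) @^-1` A) = ((fine (normal_prob 0 s A))%:E * P B)%E := E B sB.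
rewrite setIC => ->.
by rewrite fineK// fin_num_measure.
Qed.

Let Tk k := g_sigma_algebraType (cylinder k).

Let idk k : T -> Tk k := id.

Lemma measurable_idk k : measurable_fun setT (@idk k).
Proof.
move=> _ B mB; rewrite setTI; move: B mB.
by apply: smallest_sub; [exact: sigma_algebra_measurable|exact: cylinder_measurable].
Qed.

Lemma measurable_Xk k i : i != k -> measurable_fun setT ((fun w : Tk k => X w i) : Tk k -> R).
Proof.
move=> ik _ B mB; rewrite setTI; apply: sub_sigma_algebra.
exists (fun j => if j == i then B else setT); split.
- by move=> j; case: ifP.
- by rewrite eq_sym (negbTE ik).
- apply/seteqP; split=> w /=.
    by move=> Bw j _; rewrite /=; case: eqP => // ->.
  by move/(_ i Logic.I); rewrite eqxx.
Qed.

Let Z k (w : T) : (Tk k * measurableTypeR R)%type := (idk k w, X w k).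

Lemma measurable_Z k : measurable_fun setT (@Z k).
Proof. by apply/measurable_fun_pairP; split; [exact: measurable_idk|exact: mX]. Qed.

(** Uniqueness of product measures, checked on rectangles by [cylinder_indep], identifies the law of
    [Z] with a product. The outer integral is then carried back from [Tk k] to [T]. *)
Lemma fubini_indep k (h : Tk k * measurableTypeR R -> R) :
  measurable_fun setT h ->
  P.-integrable setT (fun w => (h (w, X w k))%:E) ->
  (\int[P]_w (h (w, X w k))%:E =
   \int[P]_w \int[normal_prob 0 s]_x (h (w, x))%:E)%E.
Proof.
move=> mh ih.
pose idm : {RV P >-> Tk k} := MeasurableFun.Pack (MeasurableFun.Class (isMeasurableFun.Build _ _ _ _ _ (@measurable_idk k))).
pose Zm : {RV P >-> (Tk k * measurableTypeR R)%type} := MeasurableFun.Pack (MeasurableFun.Class (isMeasurableFun.Build _ _ _ _ _ (@measurable_Z k))).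
have mhE : measurable_fun setT (EFin \o h) by exact/measurable_EFinP.
have prodE (A : set (Tk k * measurableTypeR R)) : measurable A ->
   (distribution P idm \x normal_prob 0 s)%E A = distribution P Zm A.
  move=> mA; refine (@product_measure_unique _ _ _ _ R (distribution P idm) (normal_prob 0 s) (distribution P Zm) _ A mA) => A1 A2 mA1 mA2.
  change (P (A1 `&` (X ^~ k) @^-1` A2) = (P A1 * normal_prob 0 s A2)%E).
  by rewrite setIC cylinder_indep// muleC.
have e1 : (\int[P]_w (h (w, X w k))%:E = \int[distribution P Zm]_z (h z)%:E)%E.
  by rewrite (@integral_distribution _ _ _ _ _ P Zm (EFin \o h)).
have ihZ : (distribution P Zm).-integrable setT (EFin \o h).
  exact: (integrable_pushforward (@measurable_Z k) mhE ih).
have e2 : (\int[distribution P Zm]_z (h z)%:E = \int[distribution P idm \x normal_prob 0 s]_z (h z)%:E)%E.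
  by apply: eq_measure_integral => A mA _; exact/esym/prodE.
have ihp : (distribution P idm \x normal_prob 0 s)%E.-integrable setT (EFin \o h).
  apply/integrableP; split => //; have /integrableP[_] := ihZ.
  rewrite (@eq_measure_integral _ _ _ _ (distribution P idm \x normal_prob 0 s)%E)//.
  by move=> A mA _; exact/esym/prodE.
rewrite e1 e2 -(@integral12_prod_meas1 _ _ _ _ _ _ _ _ ihp).
rewrite /fubini_F.
rewrite (@integral_distribution _ _ _ _ _ P idm)//.
  by apply: (measurable_fubini_F ihp).
have iG := integrable_fubini_F ihp.
have mG : measurable_fun setT (fubini_F (normal_prob 0 s) (EFin \o h)) := measurable_int _ iG.
apply/integrableP; split; first exact: measurableT_comp mG (@measurable_idk k).
have /integrableP[_] := iG.
rewrite (@ge0_integral_distribution _ _ _ _ _ P idm)//.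
exact: measurableT_comp.
Qed.

Lemma lawX_integrable k (g : R -> R) : poly_bounded g -> measurable_fun setT g ->
  P.-integrable setT (fun w => (g (X w k))%:E).
Proof.
move=> pg mg; have [ig _] := integral_normal s0 pg mg.
have mXk : measurable_fun setT ((X ^~ k) : T -> measurableTypeR R) by exact: mX.
pose Xm : {mfun T >-> measurableTypeR R} := MeasurableFun.Pack (MeasurableFun.Class (isMeasurableFun.Build _ _ _ _ _ mXk)).
have mgE : measurable_fun setT (EFin \o g) by exact/measurable_EFinP.
apply/integrableP; split; first exact: (measurableT_comp mgE (@mX k)).
have /integrableP[_] := ig.
rewrite (@eq_measure_integral _ _ _ _ (distribution P Xm)); last first.
  by move=> A mA _; exact: esym (lawX k mA).
rewrite (@ge0_integral_distribution _ _ _ _ _ P Xm)//.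
exact: measurableT_comp.
Qed.

Lemma sum_pow_bound (r : seq I) (a : I -> R) m : (forall i, 0 <= a i) ->
  (1 + \sum_(i <- r) a i) ^+ m <= (size r).+1%:R ^+ m * (1 + \sum_(i <- r) a i ^+ m).
Proof.
move=> a0.
(* [M] is the maximum of 1 and the terms [a i]: it bounds each of them, and its m-th power is one of
   the summands on the right. *)
have [M [M1 M2 M3]] : exists M : R, [/\ 1 <= M, \sum_(i <- r) a i <= (size r)%:R * M &
    M ^+ m <= 1 + \sum_(i <- r) a i ^+ m].
  elim: r => [|j r [M [M1 M2 M3]]].
    by exists 1; rewrite !big_nil mul0r expr1n addr0.
  have S0 : 0 <= \sum_(i <- r) a i ^+ m by apply: sumr_ge0 => i _; rewrite exprn_ge0.
  have aj0 : 0 <= a j ^+ m by rewrite exprn_ge0.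
  rewrite !big_cons; case: (leP (a j) M) => h.
    exists M; split => //; last by rewrite addrCA (le_trans M3)// lerDr.
    by rewrite /= -natr1 mulrDl mul1r addrC lerD.
  exists (a j); split => //; first by rewrite (le_trans M1)// ltW.
    by rewrite /= -natr1 mulrDl mul1r addrC lerD2r (le_trans M2)// ler_wpM2l// ltW.
  by rewrite addrCA lerDl addr_ge0.
apply: le_trans (_ : ((size r).+1%:R * M) ^+ m <= _).
  rewrite lerXn2r ?nnegrE ?addr_ge0 ?sumr_ge0 ?mulr_ge0//; first by rewrite (le_trans ler01).
  by rewrite -natr1 mulrDl mul1r addrC lerD.
by rewrite exprMn ler_wpM2l// exprn_ge0.
Qed.

Lemma coord_poly_integrable (F : (I -> R) -> R) : coord_measurable F -> coord_poly F ->
  P.-integrable setT (fun w => (F (X w))%:E).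
Proof.
move=> mF [C [m FC]].
have C0 : 0 <= C.
  have := FC (fun=> 0); rewrite big1 ?addr0 ?expr1n ?mulr1; last by move=> i _; rewrite expr0n.
  exact: le_trans.
have mFX : measurable_fun setT (fun w => (F (X w))%:E).
  by apply/measurable_EFinP; exact: mF.
pose N := (size (index_enum I)).+1%:R ^+ m : R.
have iP i : P.-integrable setT (fun w => (((X w i) ^+ 2) ^+ m)%:E).
  apply: (@lawX_integrable i (fun x => (x ^+ 2) ^+ m)).
    exists 1, m => x; rewrite mul1r.
    have x2 : 0 <= x ^+ 2 by exact: sqr_ge0.
    rewrite (ger0_norm (exprn_ge0 m x2)).
    apply: lerXn2r.
    - by rewrite nnegrE.
    - by rewrite nnegrE addr_ge0.
    - by rewrite lerDr.
  by apply: measurable_funX; exact: measurable_funX.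
apply: (@le_integrable _ _ _ P _ measurableT _ (fun w => ((C * N)%:E * (1 + \sum_i (((X w i) ^+ 2) ^+ m)%:E))%E)) => //.
  move=> w _; rewrite sumEFin -EFinD -EFinM !abse_EFin lee_fin.
  apply: le_trans (ler_norm _); apply: le_trans (FC _) _.
  by rewrite -mulrA ler_wpM2l// sum_pow_bound// => i; rewrite sqr_ge0.
apply: integrableZl => //; apply: integrableD => //.
  by apply: finite_measure_integrable_cst.
exact: integrable_sum.
Qed.

(** By independence coordinate [k] may be integrated first with the others frozen, and there the
    one-variable identity applies. *)
Lemma coord_ibp k (F F' : (I -> R) -> R) : coord_measurable F -> coord_measurable F' -> coord_poly F -> coord_poly F' ->
  (forall xi (x : R), is_derive x 1 (fun x => F (upd xi k x)) (F' (upd xi k x))) ->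
  (forall xi, continuous (fun x => F' (upd xi k x))) ->
  (\int[P]_w (X w k * F (X w))%:E = (s ^+ 2)%:E * \int[P]_w (F' (X w))%:E)%E.
Proof.
move=> mF mF' pF pF' dF cF'.
have updX w : upd (X w) k (X w k) = X w.
  by apply/funext => i; rewrite /upd; case: eqP => // ->.
(* [Y] puts the free second component in the place of coordinate [k], the only one that is not
   measurable on [Tk k]. *)
pose Y (z : Tk k * measurableTypeR R) : I -> R := upd (X z.1) k z.2.
have mY i : measurable_fun setT (Y ^~ i).
  rewrite /Y /upd; have [ik|ik] := eqVneq i k; first exact: measurable_snd.
  exact: measurableT_comp (measurable_Xk ik) measurable_fst.
have polyupd (G : (I -> R) -> R) : coord_poly G -> forall xi, poly_bounded (fun x => G (upd xi k x)).
  move=> [C [m GC]] xi.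
  have C0 : 0 <= C.
    have := GC (fun=> 0); rewrite big1 ?addr0 ?expr1n ?mulr1; last by move=> i _; rewrite expr0n.
    exact: le_trans.
  exists (C * (1 + \sum_i xi i ^+ 2) ^+ m), m => x.
  apply: le_trans (GC _) _; rewrite -mulrA ler_wpM2l// -exprMn.
  have S0 : 0 <= \sum_(i | i != k) xi i ^+ 2 by apply: sumr_ge0 => i _; rewrite sqr_ge0.
  rewrite lerXn2r ?nnegrE ?mulr_ge0 ?addr_ge0 ?sumr_ge0 ?sqr_ge0//;
    try by move=> i _; rewrite sqr_ge0.
  rewrite (bigD1 k)//= [in leRHS](bigD1 k)//= /upd eqxx.
  rewrite (eq_bigr (fun i => xi i ^+ 2)); last by move=> i /negbTE ->.
  have := sqr_ge0 (xi k); have := sqr_ge0 x; nra.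
have pXF := coord_polyM k pF.
have mXF := coord_measurableM k mF.
have iXF := coord_poly_integrable mXF pXF.
have iF' := coord_poly_integrable mF' pF'.
pose h z := z.2 * F (Y z) : R.
pose h' z := s ^+ 2 * F' (Y z) : R.
have mh : measurable_fun setT h.
  by apply: measurable_funM; [exact: measurable_snd|exact: mF].
have mh' : measurable_fun setT h' by apply: measurable_funM => //; exact: mF'.
have e1 : (\int[P]_w (s ^+ 2 * F' (X w))%:E =
    \int[P]_w \int[normal_prob 0 s]_x (s ^+ 2 * F' (upd (X w) k x))%:E)%E.
  rewrite -(@fubini_indep k h' mh'); last first.
    have := integrableZl measurableT (s ^+ 2) iF'.
    by apply: eq_integrable => // w _; rewrite /h' /Y /= updX EFinM.
  by apply: eq_integral => w _; rewrite /h' /Y /= updX.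
have e2 : (\int[P]_w (X w k * F (X w))%:E =
    \int[P]_w \int[normal_prob 0 s]_x (x * F (upd (X w) k x))%:E)%E.
  rewrite -(@fubini_indep k h mh); last first.
    by apply: eq_integrable iXF => // w _; rewrite /h /Y /= updX.
  by apply: eq_integral => w _; rewrite /h /Y /= updX.
rewrite e2 -integralZl//; under [RHS]eq_integral do rewrite -EFinM.
rewrite e1; apply: eq_integral => w _.
have pw := polyupd F pF (X w).
have pw' := polyupd F' pF' (X w).
rewrite (gauss_ibp s0 (dF (X w)) (cF' (X w)) pw pw').
have mw' : measurable_fun setT (fun x => F' (upd (X w) k x)).
  by apply: continuous_measurable_fun; exact: cF'.
have [iw _] := integral_normal s0 pw' mw'.
by rewrite -integralZl//; apply: eq_integral => x _; rewrite EFinM.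
Qed.

End multi.

Notation re := complex.Re.
Notation im := complex.Im.
Notation cabs := Normc.normc.

(** * Observables of Hermitian matrices and their derivatives *)

Section cplx.
Variable R : realType.
Implicit Types x y z : R[i].

Lemma reD x y : re (x + y) = re x + re y. Proof. by case: x; case: y. Qed.
Lemma imD x y : im (x + y) = im x + im y. Proof. by case: x; case: y. Qed.
Lemma reN x : re (- x) = - re x. Proof. by case: x. Qed.
Lemma imN x : im (- x) = - im x. Proof. by case: x. Qed.
Lemma reB x y : re (x - y) = re x - re y. Proof. by rewrite reD reN. Qed.
Lemma imB x y : im (x - y) = im x - im y. Proof. by rewrite imD imN. Qed.
Lemma reM x y : re (x * y) = re x * re y - im x * im y. Proof. by case: x; case: y. Qed.
Lemma imM x y : im (x * y) = re x * im y + im x * re y. Proof. by case: x; case: y. Qed.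
Lemma reJ x : re (x^*)%R = re x. Proof. by case: x. Qed.
Lemma imJ x : im (x^*)%R = - im x. Proof. by case: x. Qed.
Lemma reZ (a : R) x : re (a%:C * x) = a * re x. Proof. by rewrite reM /= mul0r subr0. Qed.
Lemma imZ (a : R) x : im (a%:C * x) = a * im x. Proof. by rewrite imM /= mul0r addr0. Qed.
Lemma reV x : re x^-1 = re x / (re x ^+ 2 + im x ^+ 2). Proof. by case: x. Qed.
Lemma imV x : im x^-1 = - (im x / (re x ^+ 2 + im x ^+ 2)).
Proof. by case: x. Qed.
Lemma re_sum (I : Type) (r : seq I) (p : pred I) (F : I -> R[i]) :
  re (\sum_(i <- r | p i) F i) = \sum_(i <- r | p i) re (F i).
Proof. by apply: (big_morph (@complex.Re R) reD). Qed.
Lemma im_sum (I : Type) (r : seq I) (p : pred I) (F : I -> R[i]) :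
  im (\sum_(i <- r | p i) F i) = \sum_(i <- r | p i) im (F i).
Proof. by apply: (big_morph (@complex.Im R) imD). Qed.
Lemma eqc x y : re x = re y -> im x = im y -> x = y.
Proof. by case: x => a b; case: y => c d /= -> ->. Qed.
Lemma realCM (a b : R) : (a * b)%:C = a%:C * b%:C.
Proof. by apply: eqc; rewrite ?reM ?imM /= ?mulr0 ?mul0r ?subr0 ?addr0. Qed.
Lemma realCD (a b : R) : (a + b)%:C = a%:C + b%:C.
Proof. by apply: eqc; rewrite ?reD ?imD /= ?addr0. Qed.
Lemma realCN (a : R) : (- a)%:C = - a%:C.
Proof. by apply: eqc; rewrite ?reN ?imN /= ?oppr0. Qed.
Lemma realC_nat (n : nat) : (n%:R)%:C = n%:R :> R[i].
Proof. by elim: n => // n IH; rewrite -[n.+1]addn1 !natrD realCD IH. Qed.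
Lemma realCJ (a : R) : ((a%:C)^*)%R = a%:C.
Proof. by apply: eqc; rewrite ?reJ ?imJ /= ?oppr0. Qed.
Lemma realCV (a : R) : (a^-1)%:C = (a%:C)^-1.
Proof.
apply: eqc; rewrite ?reV ?imV /= ?mul0r ?oppr0// expr0n addr0.
have [->|a0] := eqVneq a 0; first by rewrite invr0 mul0r.
by field.
Qed.

Lemma cabs_def x : cabs x = Num.sqrt (re x ^+ 2 + im x ^+ 2). Proof. by case: x. Qed.
Lemma cabs_ge0 x : 0 <= cabs x. Proof. by rewrite cabs_def sqrtr_ge0. Qed.
Lemma cabs_sqr x : cabs x ^+ 2 = re x ^+ 2 + im x ^+ 2.
Proof. by rewrite cabs_def sqr_sqrtr// addr_ge0 ?sqr_ge0. Qed.
Lemma cabsM x y : cabs (x * y) = cabs x * cabs y. Proof. exact: Normc.normcM. Qed.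
Lemma cabsD x y : cabs (x + y) <= cabs x + cabs y. Proof. exact: le_normcD. Qed.
Lemma cabsN x : cabs (- x) = cabs x. Proof. exact: normcN. Qed.
Lemma cabsB x y : cabs (x - y) <= cabs x + cabs y.
Proof. by rewrite -[cabs y]cabsN cabsD. Qed.
Lemma cabs0 : cabs (0 : R[i]) = 0. Proof. exact: Normc.normc0. Qed.
Lemma cabs1 : cabs (1 : R[i]) = 1. Proof. exact: Normc.normc1. Qed.
Lemma cabsJ x : cabs (x^*)%R = cabs x. Proof. by rewrite !cabs_def reJ imJ sqrrN. Qed.
Lemma cabs_real (a : R) : cabs a%:C = `|a|.
Proof. by rewrite cabs_def /= expr0n addr0 sqrtr_sqr. Qed.
Lemma re_le_cabs x : `|re x| <= cabs x.
Proof. by rewrite -ler_sqr ?nnegrE ?cabs_ge0// cabs_sqr real_normK ?num_real// lerDl sqr_ge0. Qed.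
Lemma im_le_cabs x : `|im x| <= cabs x.
Proof. by rewrite -ler_sqr ?nnegrE ?cabs_ge0// cabs_sqr real_normK ?num_real// lerDr sqr_ge0. Qed.
Lemma cabs_sum (I : Type) (r : seq I) (p : pred I) (F : I -> R[i]) :
  cabs (\sum_(i <- r | p i) F i) <= \sum_(i <- r | p i) cabs (F i).
Proof.
elim/big_ind2: _ => [|x a y b xa yb|//]; first by rewrite cabs0.
by rewrite (le_trans (cabsD _ _))// lerD.
Qed.
Lemma cabs_eq0 x : (cabs x == 0) = (x == 0).
Proof.
apply/eqP/eqP => [|->]; last exact: cabs0.
exact: Normc.eq0_normc.
Qed.
Lemma mul_conj x : x * (x^*)%R = (cabs x ^+ 2)%:C.
Proof. by rewrite cabs_sqr; apply: eqc; rewrite ?reM ?imM /= ?reJ ?imJ; ring. Qed.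

End cplx.

Section classes.
Variable (R : realType).

Definition cmeas d (T : measurableType d) (f : T -> R[i]) :=
  measurable_fun setT (fun w => re (f w)) /\ measurable_fun setT (fun w => im (f w)).

Definition ccont (f : R -> R[i]) :=
  continuous (fun x => re (f x)) /\ continuous (fun x => im (f x)).

Definition isD (f : R -> R[i]) (x : R) (l : R[i]) :=
  is_derive x 1 (fun x => re (f x)) (re l) /\ is_derive x 1 (fun x => im (f x)) (im l).

Lemma cmeas_cst d (T : measurableType d) c : cmeas (fun _ : T => c).
Proof. by split; exact: measurable_cst. Qed.
Lemma cmeasD d (T : measurableType d) (f g : T -> R[i]) :
  cmeas f -> cmeas g -> cmeas (fun w => f w + g w).
Proof.
move=> [f1 f2] [g1 g2]; split.
  by under eq_fun do rewrite reD; apply: measurable_funD.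
by under eq_fun do rewrite imD; apply: measurable_funD.
Qed.
Lemma cmeasM d (T : measurableType d) (f g : T -> R[i]) :
  cmeas f -> cmeas g -> cmeas (fun w => f w * g w).
Proof.
move=> [f1 f2] [g1 g2]; split.
  by under eq_fun do rewrite reM; apply: measurable_funB; apply: measurable_funM.
by under eq_fun do rewrite imM; apply: measurable_funD; apply: measurable_funM.
Qed.
Lemma cmeasJ d (T : measurableType d) (f : T -> R[i]) :
  cmeas f -> cmeas (fun w => (f w)^*)%R.
Proof.
move=> [f1 f2]; split.
  by under eq_fun do rewrite reJ.
by under eq_fun do rewrite imJ; exact: measurable_funN.
Qed.

Lemma sqr_cplx_neq0 (z : R[i]) : z != 0 -> re z ^+ 2 + im z ^+ 2 != 0.
Proof. by move=> z0; rewrite -cabs_sqr expf_neq0// cabs_eq0. Qed.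

Lemma cmeasV d (T : measurableType d) (f : T -> R[i]) :
  cmeas f -> cmeas (fun w => (f w)^-1).
Proof.
move=> [f1 f2].
have h : measurable_fun setT (fun w => (re (f w) ^+ 2 + im (f w) ^+ 2)^-1).
  under eq_fun do rewrite -powR_inv1 ?addr_ge0 ?sqr_ge0//.
  by apply: (@measurableT_comp _ _ _ _ _ _ (fun y : R => y `^ (-1))); [exact: measurable_powR|apply: measurable_funD; exact: measurable_funX].
split.
  by under eq_fun do rewrite reV; apply: measurable_funM.
by under eq_fun do rewrite imV; apply: measurable_funN; apply: measurable_funM.
Qed.

Lemma ccont_cst c : ccont (fun=> c).
Proof. by split=> x; exact: cvg_cst. Qed.
Lemma ccontD (f g : R -> R[i]) : ccont f -> ccont g -> ccont (fun w => f w + g w).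
Proof.
move=> [f1 f2] [g1 g2]; split.
  under eq_fun do rewrite reD; move=> x; apply: cvgD; [exact: f1|exact: g1].
under eq_fun do rewrite imD; move=> x; apply: cvgD; [exact: f2|exact: g2].
Qed.
Lemma ccontM (f g : R -> R[i]) : ccont f -> ccont g -> ccont (fun w => f w * g w).
Proof.
move=> [f1 f2] [g1 g2]; split.
  under eq_fun do rewrite reM; move=> x; apply: cvgB; apply: cvgM;
   by [exact: f1|exact: g1|exact: f2|exact: g2].
under eq_fun do rewrite imM; move=> x; apply: cvgD; apply: cvgM;
   by [exact: f1|exact: g1|exact: f2|exact: g2].
Qed.
Lemma ccontJ (f : R -> R[i]) : ccont f -> ccont (fun w => (f w)^*)%R.
Proof.
move=> [f1 f2]; split.
  by under eq_fun do rewrite reJ.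
under eq_fun do rewrite imJ; move=> x; apply: cvgN; exact: f2.
Qed.
Lemma ccontV (f : R -> R[i]) : (forall x, f x != 0) -> ccont f -> ccont (fun w => (f w)^-1)%R.
Proof.
move=> f0 [f1 f2].
have h : continuous (fun x => (re (f x) ^+ 2 + im (f x) ^+ 2)^-1).
  move=> x; apply: cvgV; first exact: sqr_cplx_neq0.
  by under eq_fun do rewrite !expr2; apply: cvgD; apply: cvgM; by [exact: f1|exact: f2].
split.
  by under eq_fun do rewrite reV; move=> x; apply: cvgM; [exact: f1|exact: h].
by under eq_fun do rewrite imV; move=> x; apply: cvgN; apply: cvgM; [exact: f2|exact: h].
Qed.

Lemma isD_cst c x : isD (fun=> c) x 0.
Proof. by split; apply: is_derive_cst. Qed.
Lemma isDD (f g : R -> R[i]) x a b : isD f x a -> isD g x b -> isD (fun w => f w + g w) x (a + b).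
Proof.
move=> [f1 f2] [g1 g2]; split.
  by rewrite reD; under eq_fun do rewrite reD; apply: is_deriveD.
by rewrite imD; under eq_fun do rewrite imD; apply: is_deriveD.
Qed.
Lemma isDM (f g : R -> R[i]) x a b : isD f x a -> isD g x b ->
  isD (fun w => f w * g w) x (a * g x + f x * b).
Proof.
move=> [f1 f2] [g1 g2]; split.
  by under eq_fun do rewrite reM; apply: is_derive_eq; rewrite /GRing.scale/= reD !reM; ring.
by under eq_fun do rewrite imM; apply: is_derive_eq; rewrite /GRing.scale/= imD !imM; ring.
Qed.
Lemma isDJ (f : R -> R[i]) x a : isD f x a -> isD (fun w => (f w)^*)%R x (a^*)%R.
Proof.
move=> [f1 f2]; split.
  by under eq_fun do rewrite reJ; rewrite reJ.
by under eq_fun do rewrite imJ; rewrite imJ; apply: is_deriveN.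
Qed.
Lemma isDV (f : R -> R[i]) x a : f x != 0 -> isD f x a -> isD (fun w => (f w)^-1) x (- a / (f x ^+ 2)).
Proof.
move=> fx0 [f1 f2].
have n0 := sqr_cplx_neq0 fx0.
have E : - a / f x ^+ 2 = - a * ((f x)^-1) ^+ 2 by rewrite exprVn.
have h : is_derive x 1 (fun x => re (f x) ^+ 2 + im (f x) ^+ 2) (2 * (re (f x) * re a + im (f x) * im a)).
  by apply: is_derive_eq; rewrite /GRing.scale/=; ring.
have h2 := @is_deriveV R (fun x => re (f x) ^+ 2 + im (f x) ^+ 2) x _ 1 n0 h.
split; rewrite E expr2.
  under eq_fun do rewrite reV; apply: is_derive_eq.
  by rewrite /GRing.scale/= ?(reM, imM, reN, imN, reV, imV); field.
under eq_fun do rewrite imV; apply: is_derive_eq.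
by rewrite /GRing.scale/= ?(reM, imM, reN, imN, reV, imV); field.
Qed.
Lemma isD_uniq (f : R -> R[i]) x a b : isD f x a -> isD f x b -> a = b.
Proof.
move=> [f1 f2] [g1 g2]; apply: eqc.
  by rewrite -(@derive_val _ _ _ _ _ _ _ f1) -(@derive_val _ _ _ _ _ _ _ g1).
by rewrite -(@derive_val _ _ _ _ _ _ _ f2) -(@derive_val _ _ _ _ _ _ _ g2).
Qed.

Variable n : nat.
Local Notation M_ := 'M[R[i]]_n.
Implicit Types (M V : M_) (F G : M_ -> R[i]) (DF DG : M_ -> M_ -> R[i]).

Definition herm M := M^t* = M.

(** The squared Hilbert-Schmidt norm; on a column it is the squared Euclidean norm. *)
Definition hs2 p q (M : 'M[R[i]]_(p, q)) : R := \sum_i \sum_j cabs (M i j) ^+ 2.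

(** The three side conditions of integration by parts, for observables of Hermitian matrices. The
    class [good] is stable under sums, products, conjugation and inverses with bounded entries, so
    they need not be rechecked for each observable. *)
Definition good_meas F := forall d (T : measurableType d) (Y : T -> M_), (forall w, herm (Y w)) ->
  (forall i j, cmeas (fun w => Y w i j)) -> cmeas (fun w => F (Y w)).
Definition good_cont F := forall M V, herm M -> herm V -> ccont (fun x => F (M + x%:C *: V)).
Definition good_growth F := exists C m, forall M, herm M -> cabs (F M) <= C * (1 + hs2 M) ^+ m.
Definition good F := [/\ good_meas F, good_cont F & good_growth F].

Definition clin DF := forall M, herm M ->
  forall (a : R[i]) U V, DF M (a *: U + V) = a * DF M U + DF M V.
Definition deriv F DF := forall M V, herm M -> herm V -> forall x : R,
  isD (fun x => F (M + x%:C *: V)) x (DF (M + x%:C *: V) V).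
(* Derivatives are taken along Hermitian directions only, but [DF M] is complex
   linear in the direction and so makes sense on the non-Hermitian [delta_mx]. *)
Definition diff F DF := [/\ good F, forall V, good (DF ^~ V), clin DF & deriv F DF].

Lemma mxDE p q (A B : 'M[R[i]]_(p, q)) i j : (A + B) i j = A i j + B i j.
Proof. by rewrite mxE. Qed.
Lemma mxZE p q a (A : 'M[R[i]]_(p, q)) i j : (a *: A) i j = a * A i j.
Proof. by rewrite mxE. Qed.
Lemma mxNE p q (A : 'M[R[i]]_(p, q)) i j : (- A) i j = - A i j.
Proof. by rewrite mxE. Qed.

Lemma hermP M : herm M <-> forall i j, M i j = ((M j i)^*)%R.
Proof.
split; first by move=> h i j; rewrite -{1}h !mxE.
by move=> h; apply/matrixP => i j; rewrite !mxE -h.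
Qed.
Lemma hermD M V : herm M -> herm V -> herm (M + V).
Proof. by move=> /hermP hM /hermP hV; apply/hermP => i j; rewrite !mxE (hM i j) (hV i j) rmorphD. Qed.
Lemma hermZ (a : R) M : herm M -> herm (a%:C *: M).
Proof. by move=> /hermP hM; apply/hermP => i j; rewrite !mxE (hM i j) rmorphM /= realCJ. Qed.
Lemma hs2_ge0 p q (M : 'M[R[i]]_(p, q)) : 0 <= hs2 M.
Proof. by apply: sumr_ge0 => i _; apply: sumr_ge0 => j _; rewrite sqr_ge0. Qed.
Lemma cabs_entry p q (M : 'M[R[i]]_(p, q)) i j : cabs (M i j) ^+ 2 <= hs2 M.
Proof.
rewrite /hs2 (bigD1 i)//= (bigD1 j)//= -addrA lerDl addr_ge0// ?sumr_ge0//.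
  by move=> k _; rewrite sqr_ge0.
by move=> k _; apply: sumr_ge0 => l _; rewrite sqr_ge0.
Qed.

Lemma good_growthP F : good_growth F -> exists C m, 0 <= C /\ forall M, herm M -> cabs (F M) <= C * (1 + hs2 M) ^+ m.
Proof.
move=> [C [m h]]; exists `|C|, m; split => // M hM.
by rewrite (le_trans (h M hM))// ler_wpM2r ?ler_norm// exprn_ge0// addr_ge0// hs2_ge0.
Qed.

Lemma good_cst c : good (fun=> c).
Proof.
split; first by move=> *; exact: cmeas_cst.
  by move=> *; exact: ccont_cst.
by exists (cabs c), 0%N => M _; rewrite expr0 mulr1.
Qed.
Lemma good_entry i j : good (fun M => M i j).
Proof.
split; first by move=> d T Y _; exact.
  move=> M V _ _; under eq_fun do rewrite !mxE.
  apply: ccontD; first exact: ccont_cst.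
  apply: ccontM; last exact: ccont_cst.
  by split=> x /=; [exact: cvg_id|exact: cvg_cst].
exists 1, 1%N => M _; rewrite mul1r expr1.
have := cabs_entry M i j; have := cabs_ge0 (M i j); nra.
Qed.
Lemma goodD F G : good F -> good G -> good (fun M => F M + G M).
Proof.
move=> [f1 f2 /good_growthP[C [m [C0 f3]]]] [g1 g2 /good_growthP[D [k [D0 g3]]]]; split.
- by move=> *; apply: cmeasD; [exact: f1|exact: g1].
- by move=> *; apply: ccontD; [exact: f2|exact: g2].
exists (C + D), (m + k)%N => M hM; rewrite (le_trans (cabsD _ _))// mulrDl.
have h1 : 1 <= 1 + hs2 M by rewrite lerDl hs2_ge0.
apply: lerD.
  by rewrite (le_trans (f3 M hM))// ler_wpM2l// ler_weXn2l ?leq_addr.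
by rewrite (le_trans (g3 M hM))// ler_wpM2l// ler_weXn2l ?leq_addl.
Qed.
Lemma goodM F G : good F -> good G -> good (fun M => F M * G M).
Proof.
move=> [f1 f2 /good_growthP[C [m [C0 f3]]]] [g1 g2 /good_growthP[D [k [D0 g3]]]]; split.
- by move=> *; apply: cmeasM; [exact: f1|exact: g1].
- by move=> *; apply: ccontM; [exact: f2|exact: g2].
exists (C * D), (m + k)%N => M hM; rewrite cabsM exprD mulrACA.
by apply: ler_pM; rewrite ?cabs_ge0 ?f3 ?g3.
Qed.
Lemma goodJ F : good F -> good (fun M => (F M)^*)%R.
Proof.
move=> [f1 f2 [C [m f3]]]; split.
- by move=> *; apply: cmeasJ; exact: f1.
- by move=> *; apply: ccontJ; exact: f2.
by exists C, m => M hM; rewrite cabsJ f3.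
Qed.
Lemma good_ext F G : (forall M, herm M -> F M = G M) -> good F -> good G.
Proof.
move=> FG [f1 f2 [C [m f3]]]; split.
- move=> d T Y hY mY; have := f1 d T Y hY mY.
  by rewrite (_ : (fun w => F (Y w)) = (fun w => G (Y w)))//; apply/funext => w; exact: FG.
- move=> M V hM hV; have := f2 M V hM hV.
  rewrite (_ : (fun x : R => F _) = (fun x => G (M + x%:C *: V)))//; apply/funext => x.
  by apply: FG; apply: hermD => //; exact: hermZ.
by exists C, m => M hM; rewrite -FG ?f3.
Qed.
Lemma good_sum (I : Type) (r : seq I) (p : pred I) (F : I -> M_ -> R[i]) :
  (forall i, p i -> good (F i)) -> good (fun M => \sum_(i <- r | p i) F i M).
Proof.
move=> h; elim: r => [|i r IH].
  by apply: good_ext (good_cst 0) => M _; rewrite big_nil.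
have [pi|pi] := boolP (p i).
  by apply: good_ext (goodD (h i pi) IH) => M _; rewrite big_cons pi.
by apply: good_ext IH => M _; rewrite big_cons (negbTE pi).
Qed.
Lemma good_prod (I : Type) (r : seq I) (F : I -> M_ -> R[i]) :
  (forall i, good (F i)) -> good (fun M => \prod_(i <- r) F i M).
Proof.
move=> h; elim: r => [|i r IH].
  by apply: good_ext (good_cst 1) => M _; rewrite big_nil.
by apply: good_ext (goodM (h i) IH) => M _; rewrite big_cons.
Qed.

Definition mgood (Q : M_ -> M_) := forall i j, good (fun M => Q M i j).

Lemma good_det p (Q : M_ -> 'M[R[i]]_p) : (forall i j, good (fun M => Q M i j)) ->
  good (fun M => \det (Q M)).
Proof.
move=> h; rewrite /determinant; apply: good_sum => s _.
by apply: goodM; [exact: good_cst|apply: good_prod => i; exact: h].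
Qed.

Lemma isD_ext (f g : R -> R[i]) x a : f =1 g -> isD f x a -> isD g x a.
Proof. by move=> fg; rewrite (_ : f = g)//; exact/funext. Qed.

Lemma isD_sum (I : Type) (r : seq I) (f : I -> R -> R[i]) x (l : I -> R[i]) :
  (forall i, isD (f i) x (l i)) -> isD (fun x => \sum_(i <- r) f i x) x (\sum_(i <- r) l i).
Proof.
move=> h; elim: r => [|i r IH].
  by rewrite big_nil; apply: isD_ext (isD_cst 0 x) => y; rewrite big_nil.
by rewrite big_cons; apply: isD_ext (isDD (h i) IH) => y; rewrite big_cons.
Qed.

Lemma isD_prod (I : Type) (r : seq I) (f : I -> R -> R[i]) x :
  (forall i, exists l, isD (f i) x l) -> exists l, isD (fun x => \prod_(i <- r) f i x) x l.
Proof.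
move=> h; elim: r => [|i r [l IH]].
  by exists 0; apply: isD_ext (isD_cst 1 x) => y; rewrite big_nil.
have [l' hl'] := h i; eexists; apply: isD_ext (isDM hl' IH) => y; by rewrite big_cons.
Qed.

Lemma isD_det p (Q : R -> 'M[R[i]]_p) x : (forall i j, exists l, isD (fun y => Q y i j) x l) ->
  exists l, isD (fun y => \det (Q y)) x l.
Proof.
move=> h.
have h2 (s : {perm 'I_p}) : exists l, isD (fun y => (-1) ^+ s * \prod_i Q y i (s i)) x l.
  have [l hl] := @isD_prod _ (index_enum 'I_p) (fun i y => Q y i (s i)) x (fun i => h i (s i)).
  by eexists; apply: isDM hl; exact: isD_cst.
pose l s := projT1 (cid (h2 s)).
exists (\sum_s l s); apply: isD_sum => s; exact: projT2 (cid (h2 s)).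
Qed.

Lemma diff_ext F G DF DG : (forall M, herm M -> F M = G M) ->
  (forall M V, herm M -> DF M V = DG M V) -> diff F DF -> diff G DG.
Proof.
move=> FG DFG [f1 f2 f3 f4]; split.
- exact: good_ext f1.
- by move=> V; apply: good_ext (f2 V) => M hM; exact: DFG.
- by move=> M hM a U V; rewrite -!DFG// f3.
- move=> M V hM hV x; have hx : herm (M + x%:C *: V) by apply: hermD => //; exact: hermZ.
  rewrite -DFG//; apply: isD_ext (f4 M V hM hV x) => y.
  by apply: FG; apply: hermD => //; exact: hermZ.
Qed.
Lemma diff_cst c : diff (fun=> c) (fun _ _ => 0).
Proof.
split; first exact: good_cst.
- by move=> V; exact: good_cst.
- by move=> *; rewrite mulr0 addr0.
- by move=> *; exact: isD_cst.
Qed.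
Lemma isD_id x : isD (fun y : R => y%:C) x 1.
Proof. by split; [exact: is_derive_id|exact: is_derive_cst]. Qed.
Lemma diff_entry i j : diff (fun M => M i j) (fun _ V => V i j).
Proof.
split; first exact: good_entry.
- by move=> V; exact: good_cst.
- by move=> *; rewrite !mxE.
- move=> M V _ _ x.
  rewrite (_ : V i j = 0 + (1 * V i j + x%:C * 0)); last by rewrite mulr0 addr0 add0r mul1r.
  apply: isD_ext (isDD (isD_cst (M i j) x) (isDM (isD_id x) (isD_cst (V i j) x))) => y.
  by rewrite !mxE.
Qed.
Lemma diffD F G DF DG : diff F DF -> diff G DG ->
  diff (fun M => F M + G M) (fun M V => DF M V + DG M V).
Proof.
move=> [f1 f2 f3 f4] [g1 g2 g3 g4]; split.
- exact: goodD.
- by move=> V; apply: goodD.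
- by move=> M hM a U V; rewrite f3// g3//; ring.
- by move=> M V hM hV x; apply: isDD; [exact: f4|exact: g4].
Qed.
Lemma diffM F G DF DG : diff F DF -> diff G DG ->
  diff (fun M => F M * G M) (fun M V => DF M V * G M + F M * DG M V).
Proof.
move=> [f1 f2 f3 f4] [g1 g2 g3 g4]; split.
- exact: goodM.
- by move=> V; apply: goodD; apply: goodM.
- by move=> M hM a U V; rewrite f3// g3//; ring.
- by move=> M V hM hV x; apply: isDM; [exact: f4|exact: g4].
Qed.
Lemma diffZ c F DF : diff F DF -> diff (fun M => c * F M) (fun M V => c * DF M V).
Proof.
move=> h; apply: diff_ext (diffM (diff_cst c) h) => // M V _.
by rewrite mul0r add0r.
Qed.
(** Conjugating [DF] alone would give a map that is antilinear in the direction. Taking the adjoint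
    of the direction restores complex linearity and changes nothing on Hermitian directions. *)
Lemma diffJ F DF : diff F DF -> diff (fun M => (F M)^*)%R (fun M V => (DF M (V^t*))^*)%R.
Proof.
move=> [f1 f2 f3 f4]; split.
- exact: goodJ.
- by move=> V; apply: goodJ.
- move=> M hM a U V.
  have -> : (a *: U + V)^t* = (a^*)%R *: U^t* + V^t*.
    by apply/matrixP => i j; rewrite !mxE rmorphD rmorphM.
  by rewrite f3// rmorphD rmorphM; congr (_ * _ + _); exact: conjCK.
- by move=> M V hM hV x; rewrite (hV : V^t* = V); apply: isDJ; exact: f4.
Qed.
Lemma diff_sum (I : Type) (r : seq I) (F : I -> M_ -> R[i]) (DF : I -> M_ -> M_ -> R[i]) :
  (forall i, diff (F i) (DF i)) ->
  diff (fun M => \sum_(i <- r) F i M) (fun M V => \sum_(i <- r) DF i M V).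
Proof.
move=> h; elim: r => [|i r IH].
  by apply: diff_ext (diff_cst 0) => [M|M V] _; rewrite big_nil.
by apply: diff_ext (diffD (h i) IH) => [M|M V] _; rewrite big_cons.
Qed.

Definition mdiff (Q : M_ -> M_) (DQ : M_ -> M_ -> M_) :=
  forall i j, diff (fun M => Q M i j) (fun M V => DQ M V i j).

Lemma mdiff_ext Q Q' DQ DQ' : (forall M, herm M -> Q M = Q' M) ->
  (forall M V, herm M -> DQ M V = DQ' M V) -> mdiff Q DQ -> mdiff Q' DQ'.
Proof. by move=> h1 h2 h i j; apply: diff_ext (h i j) => [M|M V] hM; rewrite ?h1 ?h2. Qed.
Lemma mdiff_id : mdiff id (fun _ V => V).
Proof. by move=> i j; exact: diff_entry. Qed.
Lemma mdiff_cst C : mdiff (fun=> C) (fun _ _ => 0).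
Proof. by move=> i j; apply: diff_ext (diff_cst (C i j)) => // M V _; rewrite mxE. Qed.
Lemma mdiffD Q Q' DQ DQ' : mdiff Q DQ -> mdiff Q' DQ' ->
  mdiff (fun M => Q M + Q' M) (fun M V => DQ M V + DQ' M V).
Proof. by move=> h1 h2 i j; apply: diff_ext (diffD (h1 i j) (h2 i j)) => [M|M V] _; rewrite mxE. Qed.
Lemma mdiffM Q Q' DQ DQ' : mdiff Q DQ -> mdiff Q' DQ' ->
  mdiff (fun M => Q M *m Q' M) (fun M V => DQ M V *m Q' M + Q M *m DQ' M V).
Proof.
move=> h1 h2 i j.
apply: diff_ext (diff_sum (index_enum 'I_n) (fun k => diffM (h1 i k) (h2 k j))) => [M|M V] _; rewrite !mxE//.
by rewrite big_split.
Qed.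
Lemma mdiffZ F DF Q DQ : diff F DF -> mdiff Q DQ ->
  mdiff (fun M => F M *: Q M) (fun M V => DF M V *: Q M + F M *: DQ M V).
Proof. by move=> h1 h2 i j; apply: diff_ext (diffM h1 (h2 i j)) => [M|M V] _; rewrite !mxE. Qed.
Lemma mdiff_scalar F DF : diff F DF -> mdiff (fun M => (F M)%:M) (fun M V => (DF M V)%:M).
Proof.
move=> h i j; apply: diff_ext (diffZ (i == j)%:R h) => [M|M V] _; rewrite !mxE mulr_natl//.
Qed.
Lemma diff_trace Q DQ : mdiff Q DQ -> diff (fun M => \tr (Q M)) (fun M V => \tr (DQ M V)).
Proof. by move=> h; apply: diff_sum => i; exact: h. Qed.

(** By Cramer's rule an entry of the inverse is a cofactor over a determinant, which gives
    measurability and continuity. The rule gives no control of the growth, for which the bound [B]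
    is assumed. *)
Lemma good_inv_entry Q B : mgood Q -> (forall M, herm M -> Q M \in unitmx) ->
  (forall M i j, herm M -> cabs (invmx (Q M) i j) <= B) -> mgood (fun M => invmx (Q M)).
Proof.
move=> gQ uQ bQ i j.
have detQ := good_det gQ.
have cofQ : good (fun M => cofactor (Q M) j i).
  apply: goodM; first exact: good_cst.
  by apply: good_det => a b; apply: good_ext (gQ (lift j a) (lift i b)) => M _; rewrite !mxE.
have E M : herm M -> (\det (Q M))^-1 * cofactor (Q M) j i = invmx (Q M) i j.
  by move=> hM; rewrite /invmx uQ// !mxE.
have d0 M : herm M -> \det (Q M) != 0.
  by move=> hM; have := uQ M hM; rewrite unitmxE unitfE.
have [d1 d2 _] := detQ; have [c1 c2 _] := cofQ.
split.
- move=> d T Y hY mY.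
  rewrite (_ : (fun w => _) = (fun w => (\det (Q (Y w)))^-1 * cofactor (Q (Y w)) j i)).
    by apply: cmeasM; [apply: cmeasV; exact: d1|exact: c1].
  by apply/funext => w; rewrite E.
- move=> M V hM hV.
  have hx x : herm (M + x%:C *: V) by apply: hermD => //; exact: hermZ.
  rewrite (_ : (fun x : R => _) = (fun x : R => (\det (Q (M + x%:C *: V)))^-1 * cofactor (Q (M + x%:C *: V)) j i)).
    by apply: ccontM; [apply: ccontV; [move=> x; exact: d0|exact: d2]|exact: c2].
  by apply/funext => x; rewrite E.
- by exists B, 0%N => M hM; rewrite expr0 mulr1 bQ.
Qed.

Lemma mgoodM Q Q' : mgood Q -> mgood Q' -> mgood (fun M => Q M *m Q' M).
Proof.
move=> h1 h2 i j; apply: good_ext (_ : good (fun M => \sum_k Q M i k * Q' M k j)).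
  by move=> M _; rewrite mxE.
by apply: good_sum => k _; apply: goodM.
Qed.

(** Cramer's rule shows only that a derivative exists; its value comes from differentiating the
    constant product of [Q] and its inverse. *)
Lemma mdiff_inv Q DQ B : mdiff Q DQ -> (forall M, herm M -> Q M \in unitmx) ->
  (forall M i j, herm M -> cabs (invmx (Q M) i j) <= B) ->
  mdiff (fun M => invmx (Q M)) (fun M V => - (invmx (Q M) *m DQ M V *m invmx (Q M))).
Proof.
move=> dQ uQ bQ.
have gQ : mgood Q by move=> i j; have [] := dQ i j.
have gI := good_inv_entry gQ uQ bQ.
have d0 M : herm M -> \det (Q M) != 0.
  by move=> hM; have := uQ M hM; rewrite unitmxE unitfE.
move=> i j; split.
- exact: gI.
- move=> V; have gDQ : mgood (DQ ^~ V) by move=> a b; have [_ /(_ V)] := dQ a b.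
  have := goodM (good_cst (-1)) (mgoodM (mgoodM gI gDQ) gI i j).
  by apply: good_ext => M hM; rewrite mulN1r [in RHS]mxE.
- move=> M hM a U V.
  have -> : DQ M (a *: U + V) = a *: DQ M U + DQ M V.
    by apply/matrixP => k l; rewrite !mxE; have [_ _ ->] := dQ k l.
  by rewrite mulmxDr mulmxDl -scalemxAr -scalemxAl opprD mxDE -scalerN mxZE.
move=> M V hM hV x.
have hx y : herm (M + y%:C *: V) by apply: hermD => //; exact: hermZ.
pose q y := Q (M + y%:C *: V).
have dq a b : isD (fun y => q y a b) x (DQ (M + x%:C *: V) V a b).
  by have [_ _ _ /(_ M V hM hV x)] := dQ a b.
have exl a b : exists l, isD (fun y => invmx (q y) a b) x l.
  have [l1 h1] : exists l, isD (fun y => \det (q y)) x l.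
    by apply: isD_det => c e; eexists; exact: dq.
  have [l2 h2] : exists l, isD (fun y => \det (row' b (col' a (q y)))) x l.
    apply: isD_det => c e; eexists; apply: isD_ext (dq (lift b c) (lift a e)).
    by move=> y; rewrite !mxE.
  have dx0 : \det (q x) != 0 by apply: d0.
  eexists; apply: isD_ext (isDM (isDV dx0 h1) (isDM (isD_cst ((-1) ^+ (b + a)) x) h2)).
  by move=> y; rewrite /invmx uQ// !mxE.
pose l a b := projT1 (cid (exl a b)).
have hl a b : isD (fun y => invmx (q y) a b) x (l a b) := projT2 (cid (exl a b)).
pose L := \matrix_(a, b) l a b.
have eq0 : DQ (M + x%:C *: V) V *m invmx (q x) + q x *m L = 0.
  apply/matrixP => a b; rewrite !mxE -big_split /=.
  have H1 := isD_sum (index_enum 'I_n) (fun k => isDM (dq a k) (hl k b)).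
  have H2 : isD (fun y => \sum_k q y a k * invmx (q y) k b) x 0.
    apply: isD_ext (isD_cst ((a == b)%:R) x) => y.
    have := mulmxV (uQ _ (hx y)) => /matrixP /(_ a b).
    by rewrite !mxE => ->.
  by apply: etrans (isD_uniq H1 H2); apply: eq_bigr => k _; rewrite [L k b]mxE.
have e : q x *m L = - (DQ (M + x%:C *: V) V *m invmx (q x)).
  by apply/eqP; rewrite -addr_eq0 addrC eq0.
have -> : - (invmx (q x) *m DQ (M + x%:C *: V) V *m invmx (q x)) = L.
  by rewrite -[L](mulKmx (uQ _ (hx x))) -/(q x) e mulmxN mulmxA.
by rewrite [L i j]mxE; exact: hl.
Qed.

End classes.

(** * Integration by parts for the GUE *)

Section gueE.
Variables (R : realType) (d : measure_display) (T : measurableType d).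
Variables (P : probability T R) (n : nat) (W : T -> 'M[R[i]]_n).
Hypothesis n0 : (0 < n)%N.
Hypothesis gueW : gue P W.
Local Notation M_ := 'M[R[i]]_n.
Local Notation I := (('I_n * 'I_n) * bool)%type.

(* The GUE is [\sum_k xi k *: Vdir k] for [2 n^2] independent N(0, 1/(4n))
   coordinates: [xi (i, j, true)] is the real and [xi (i, j, false)] the
   imaginary part of the entry (i, j) of the matrix called G in [gue]. *)
Definition Vdir (k : I) : M_ :=
  if k.2 then delta_mx k.1.1 k.1.2 + delta_mx k.1.2 k.1.1
  else 'i *: (delta_mx k.1.1 k.1.2 - delta_mx k.1.2 k.1.1).

Definition Wof (xi : I -> R) : M_ := \sum_k (xi k)%:C *: Vdir k.

Lemma im_i : im ('i : R[i]) = 1. Proof. by []. Qed.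
Lemma re_i : re ('i : R[i]) = 0. Proof. by []. Qed.

Lemma herm_Vdir k : herm (Vdir k).
Proof.
apply/hermP => a b; rewrite /Vdir; case: ifP => _; rewrite !mxE.
  by rewrite rmorphD !rmorph_nat addrC (andbC (b == k.1.1)) (andbC (b == k.1.2)).
rewrite rmorphM rmorphB !rmorph_nat (andbC (b == k.1.1)) (andbC (b == k.1.2)).
set u := (_ && _); set v := (_ && _).
by apply: eqc; rewrite !(reM, imM, reB, imB, reJ, imJ) /=; case: u; case: v; rewrite /=; ring.
Qed.

Lemma herm_Wof xi : herm (Wof xi).
Proof.
rewrite /Wof; elim/big_ind: _ => [|x y hx hy|k _].
- by apply/hermP => a b; rewrite !mxE rmorph0.
- exact: hermD.
- apply: hermZ; exact: herm_Vdir.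
Qed.

Lemma Wof_upd xi k x : Wof (upd xi k x) = Wof (upd xi k 0) + x%:C *: Vdir k.
Proof.
rewrite /Wof (bigD1 k)//= [in RHS](bigD1 k)//= /upd eqxx scale0r add0r addrC.
by congr (_ + _); apply: eq_bigr => i /negbTE ->.
Qed.

Lemma cabs_Vdir k a b : cabs (Vdir k a b) <= 2.
Proof.
have cb (u : bool) : cabs (u%:R : R[i]) <= 1 by case: u; rewrite ?cabs1 ?cabs0.
have ci : cabs ('i : R[i]) = 1 by rewrite cabs_def /= expr0n expr1n add0r sqrtr1.
rewrite /Vdir; case: ifP => _; rewrite !mxE ?cabsM ?ci ?mul1r.
  by rewrite (le_trans (cabsD _ _))// (_ : 2 = 1 + 1)// lerD.
by rewrite (le_trans (cabsB _ _))// (_ : 2 = 1 + 1)// lerD.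
Qed.

Lemma hs2_Wof_bound : exists C, 0 <= C /\
  forall xi, 1 + hs2 (Wof xi) <= C * (1 + \sum_k xi k ^+ 2) ^+ 2.
Proof.
pose N : R := \sum_(k : I) 1.
have N0 : 0 <= N by apply: sumr_ge0.
pose K : R := \sum_(a < n) \sum_(b < n) (N + 1) ^+ 2.
have K0 : 0 <= K by apply: sumr_ge0 => a _; apply: sumr_ge0 => b _; rewrite sqr_ge0.
exists (1 + K); split; first by rewrite addr_ge0.
move=> xi; have S0 : 0 <= \sum_k xi k ^+ 2 by apply: sumr_ge0 => k _; rewrite sqr_ge0.
set S := \sum_k xi k ^+ 2 in S0 *.
have ent a b : cabs (Wof xi a b) <= (N + 1) * (1 + S).
  rewrite /Wof summxE (le_trans (cabs_sum _ _ _))//.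
  apply: le_trans (_ : \sum_k (1 + xi k ^+ 2) <= _).
    apply: ler_sum => k _; rewrite mxE cabsM cabs_real.
    apply: le_trans (_ : `|xi k| * 2 <= _); first by rewrite ler_wpM2l// cabs_Vdir.
    have : 0 <= (`|xi k| - 1) ^+ 2 by rewrite sqr_ge0.
    by rewrite -[xi k ^+ 2]real_normK ?num_real//; nra.
  by rewrite big_split /= -/N -/S; nra.
have -> : (1 + K) * (1 + S) ^+ 2 = (1 + S) ^+ 2 + \sum_(a < n) \sum_(b < n) ((N + 1) * (1 + S)) ^+ 2.
  rewrite mulrDl mul1r; congr (_ + _); rewrite /K mulr_suml; apply: eq_bigr => a _.
  by rewrite mulr_suml; apply: eq_bigr => b _; rewrite exprMn.
apply: lerD; first nra.
apply: ler_sum => a _; apply: ler_sum => b _.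
by rewrite lerXn2r// ?nnegrE ?cabs_ge0// mulr_ge0// addr_ge0.
Qed.

Lemma coord_measurable_good (F : M_ -> R[i]) : good F ->
  coord_measurable (fun xi => re (F (Wof xi))) /\ coord_measurable (fun xi => im (F (Wof xi))).
Proof.
move=> [gF _ _].
have h d' (T' : measurableType d') (Y : T' -> I -> R) : (forall i, measurable_fun setT (Y ^~ i)) ->
    cmeas (fun w => F (Wof (Y w))).
  move=> mY; apply: gF; first by move=> w; exact: herm_Wof.
  move=> i j; split.
    under eq_fun do rewrite summxE re_sum.
    apply: measurable_sum => k; under eq_fun do rewrite mxE reZ.
    by apply: measurable_funM => //; exact: mY.
  under eq_fun do rewrite summxE im_sum.
  apply: measurable_sum => k; under eq_fun do rewrite mxE imZ.
  by apply: measurable_funM => //; exact: mY.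
by split=> d' T' Y mY; have [] := h d' T' Y mY.
Qed.

Lemma coord_poly_good (F : M_ -> R[i]) : good F ->
  coord_poly (fun xi => re (F (Wof xi))) /\ coord_poly (fun xi => im (F (Wof xi))).
Proof.
move=> [_ _ /good_growthP[C [m [C0 FC]]]].
have [K [K0 hK]] := hs2_Wof_bound.
have h xi : cabs (F (Wof xi)) <= C * K ^+ m * (1 + \sum_i xi i ^+ 2) ^+ (2 * m).
  rewrite (le_trans (FC _ (herm_Wof xi)))// -mulrA ler_wpM2l// exprM -exprMn.
  rewrite lerXn2r// nnegrE ?addr_ge0 ?hs2_ge0// mulr_ge0// exprn_ge0// addr_ge0// sumr_ge0// => k _.
  by rewrite sqr_ge0.
by split; exists (C * K ^+ m), (2 * m)%N => xi; rewrite (le_trans _ (h xi))// ?re_le_cabs ?im_le_cabs.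
Qed.

Let s : R := Num.sqrt ((2 * n%:R)^-1 / 2).

Lemma s_gt0 : 0 < s.
Proof. by rewrite sqrtr_gt0 divr_gt0// invr_gt0 mulr_gt0// ltr0n. Qed.

Lemma s_sqr : s ^+ 2 = (4 * n%:R)^-1.
Proof.
rewrite sqr_sqrtr ?divr_ge0 ?invr_ge0 ?mulr_ge0//.
by field; rewrite pnatr_eq0 -lt0n.
Qed.

(** The 2 n^2 real coordinates are jointly independent because the entries are independent and each
    has independent real and imaginary parts: a product event is an intersection of rectangles, one
    for each entry. *)
Lemma gue_coord : exists X : T -> I -> R,
  [/\ forall k, measurable_fun setT (X ^~ k),
      forall B : I -> set R, (forall i, measurable (B i)) ->
        P (\bigcap_(i in [set: I]) ((X ^~ i) @^-1` B i)) =
        (\prod_i fine (normal_prob 0 s (B i)))%:E &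
      forall w, [/\ W w = Wof (X w),
        forall a b, re (W w a b) = X w (a, b, true) + X w (b, a, true) &
        forall a b, im (W w a b) = X w (a, b, false) - X w (b, a, false)]].
Proof.
have [G [hG indG WG]] := gueW.
exists (fun w k => if k.2 then re (G w k.1.1 k.1.2) else im (G w k.1.1 k.1.2)); split.
- move=> [[a b] []] /=; have [mG _] := hG a b.
    exact: measurableT_comp measurable_fst mG.
  exact: measurableT_comp measurable_snd mG.
- move=> B mB.
  pose B' (ij : 'I_n * 'I_n) := B (ij, true) `*` B (ij, false).
  have := indG [set: 'I_n * 'I_n]%SET B' (fun ij => measurableX (mB _) (mB _)).
  set Q1 := \bigcap_(_ in _) _; set Q2 := \bigcap_(_ in _) _.
  have -> : Q1 = Q2.
    apply/seteqP; split=> w /=.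
      move=> h [[a b] []] _ /=; have := h (a, b); rewrite /B' /= inE => /(_ isT)[] //.
    by move=> h [a b] _; split; [exact: (h (a, b, true))|exact: (h (a, b, false))].
  move=> ->; congr (_%:E).
  rewrite (eq_bigl predT); last by move=> i; rewrite inE.
  have -> : \prod_i fine (normal_prob 0 s (B i)) = \prod_ij \prod_b fine (normal_prob 0 s (B (ij, b))).
    by rewrite pair_bigA /=; apply: eq_bigr => -[[a b] c].
  apply: eq_bigr => ij _; rewrite big_bool /=.
  have [_ ->//] := hG ij.1 ij.2.
  by rewrite fineM//; apply: fin_num_measure; exact: mB.
- move=> w; split; last 2 first.
  + by move=> a b; rewrite WG !mxE reD reJ.
  + by move=> a b; rewrite WG !mxE imD imJ.
  rewrite WG /Wof.
  have -> : G w + (G w)^t* = \sum_(ij : 'I_n * 'I_n) (G w ij.1 ij.2 *: delta_mx ij.1 ij.2 + (G w ij.1 ij.2)^*%R *: delta_mx ij.2 ij.1).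
    rewrite big_split /= -(pair_bigA _ (fun i j => G w i j *: delta_mx i j)) -(pair_bigA _ (fun i j => (G w i j)^*%R *: delta_mx j i)) /=.
    rewrite -matrix_sum_delta; congr (_ + _).
    rewrite exchange_big /= [LHS]matrix_sum_delta; apply: eq_bigr => i _; apply: eq_bigr => j _.
    by rewrite !mxE.
  transitivity (\sum_ij \sum_b (if b then re (G w ij.1 ij.2) else im (G w ij.1 ij.2))%:C *: Vdir (ij, b)); last first.
    by rewrite pair_bigA /=; apply: eq_bigr => -[[a b] c].
  apply: eq_bigr => ij _; rewrite big_bool /= /Vdir /=.
  move: (G w _ _) (delta_mx _ _) (delta_mx _ _) => g X Y.
  apply/matrixP => a b; rewrite !(mxDE, mxZE, mxNE).
  by apply: eqc; rewrite !(reD, imD, reM, imM, reB, imB, reJ, imJ) /=; ring.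
Qed.

(** Only the real part of the expectation is kept, so that all integrals are real. An imaginary part
    is reached by multiplying the observable by a multiple of 'i, as with [iN] below. *)
Definition EW (F : M_ -> R[i]) : R := (\int[P]_w re (F (W w)))%R.

Lemma herm_W w : herm (W w).
Proof. by have [X [_ _ /(_ w)[-> _ _]]] := gue_coord; exact: herm_Wof. Qed.

Lemma EW_integrable F : good F -> P.-integrable setT (fun w => (re (F (W w)))%:E).
Proof.
move=> gF; have [X [mX jX WX]] := gue_coord.
have := coord_poly_integrable s_gt0 mX jX (coord_measurable_good gF).1 (coord_poly_good gF).1.
by apply: eq_integrable => // w _; have [-> _ _] := WX w.
Qed.

Lemma EW_D F G : good F -> good G -> EW (fun M => F M + G M) = EW F + EW G.
Proof.
move=> gF gG; rewrite /EW -RintegralD//; try exact: EW_integrable.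
by apply: eq_Rintegral => w _; rewrite reD.
Qed.

Lemma EW_ext F G : (forall M, herm M -> re (F M) = re (G M)) -> EW F = EW G.
Proof. by move=> FG; apply: eq_Rintegral => w _; rewrite FG//; exact: herm_W. Qed.

Lemma EW_Z (a : R) F : good F -> EW (fun M => a%:C * F M) = a * EW F.
Proof.
move=> gF; rewrite /EW -RintegralZl//; last exact: EW_integrable.
by apply: eq_Rintegral => w _; rewrite reZ.
Qed.

Lemma EW_le F G : good F -> good G -> (forall M, herm M -> re (F M) <= re (G M)) -> EW F <= EW G.
Proof.
move=> gF gG FG; apply: le_Rintegral => //; try exact: EW_integrable.
by move=> w _; apply: FG; exact: herm_W.
Qed.

Lemma good_scale (a : R) (F : M_ -> R[i]) : good F -> good (fun M => a%:C * F M).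
Proof. by move=> gF; apply: goodM => //; exact: good_cst. Qed.

Lemma EW_lin2 (a b : R) F G : good F -> good G ->
  EW (fun M => a%:C * F M + b%:C * G M) = a * EW F + b * EW G.
Proof. by move=> gF gG; rewrite EW_D ?EW_Z//; exact: good_scale. Qed.

Lemma EW_lin3 (a b c : R) F G H : good F -> good G -> good H ->
  EW (fun M => a%:C * F M + b%:C * G M + c%:C * H M) = a * EW F + b * EW G + c * EW H.
Proof.
move=> gF gG gH; rewrite EW_D ?EW_lin2 ?EW_Z//; last exact: good_scale.
by apply: goodD; exact: good_scale.
Qed.

Lemma EW_cst c : EW (fun=> c) = re c.
Proof.
rewrite /EW Rintegral_cst// (_ : fine _ = 1) ?mulr1//.
exact: (congr1 fine (probability_setT P)).
Qed.

Lemma EW_sum (J : Type) (r : seq J) (F : J -> M_ -> R[i]) : (forall i, good (F i)) ->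
  EW (fun M => \sum_(i <- r) F i M) = \sum_(i <- r) EW (F i).
Proof.
move=> gF; elim: r => [|i r IH].
  rewrite big_nil; transitivity (EW (fun=> 0)); last exact: EW_cst.
  by apply: EW_ext => M _; rewrite big_nil.
rewrite big_cons -IH -EW_D//; last exact: good_sum.
by apply: EW_ext => M _; rewrite big_cons.
Qed.

Lemma coord_ibpR (X : T -> I -> R) k (F F' : (I -> R) -> R) :
  (forall k, measurable_fun setT (X ^~ k)) ->
  (forall B : I -> set R, (forall i, measurable (B i)) ->
        P (\bigcap_(i in [set: I]) ((X ^~ i) @^-1` B i)) =
        (\prod_i fine (normal_prob 0 s (B i)))%:E) ->
  coord_measurable F -> coord_measurable F' -> coord_poly F -> coord_poly F' ->
  (forall xi (x : R), is_derive x 1 (fun x => F (upd xi k x)) (F' (upd xi k x))) ->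
  (forall xi, continuous (fun x => F' (upd xi k x))) ->
  (\int[P]_w (X w k * F (X w)) = (4 * n%:R)^-1 * \int[P]_w (F' (X w)))%R.
Proof.
move=> mX jX mF mF' pF pF' dF cF'.
rewrite /Rintegral (coord_ibp s_gt0 mX jX mF mF' pF pF' dF cF') s_sqr fineM//.
have iF' := coord_poly_integrable s_gt0 mX jX mF' pF'.
exact: (integrable_fin_num measurableT iF').
Qed.

(** Four real coordinates enter [M b c], each of variance 1/(4n) and each producing a derivative
    along its [Vdir]. By complex linearity of [DF] the parts along [delta_mx b c] cancel and those
    along [delta_mx c b] add up to 4, whence the factor 1/n. *)
Lemma EW_entry F DF b c : diff F DF ->
  EW (fun M => M b c * F M) = (n%:R)^-1 * EW (fun M => DF M (delta_mx c b)).
Proof.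
move=> [gF gDF lF dF]; have [X [mX jX WX]] := gue_coord.
have [mr mi] := coord_measurable_good gF; have [pr pi] := coord_poly_good gF.
have ibp k : (\int[P]_w (X w k * re (F (W w))) = (4 * n%:R)^-1 * \int[P]_w re (DF (W w) (Vdir k)))%R /\
   (\int[P]_w (X w k * im (F (W w))) = (4 * n%:R)^-1 * \int[P]_w im (DF (W w) (Vdir k)))%R.
  have [mr' mi'] := coord_measurable_good (gDF (Vdir k)); have [pr' pi'] := coord_poly_good (gDF (Vdir k)).
  have Du xi x : isD (fun x => F (Wof (upd xi k x))) x (DF (Wof (upd xi k x)) (Vdir k)).
    rewrite Wof_upd; apply: isD_ext (dF _ _ (herm_Wof _) (herm_Vdir k) x) => y.
    by rewrite -Wof_upd.
  have Cu xi : ccont (fun x => DF (Wof (upd xi k x)) (Vdir k)).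
    have [_ /(_ (Wof (upd xi k 0)) (Vdir k) (herm_Wof _) (herm_Vdir _)) h _] := gDF (Vdir k).
    by rewrite (_ : (fun x => _) = (fun x => DF (Wof (upd xi k 0) + x%:C *: Vdir k) (Vdir k)))//; apply/funext => y; rewrite Wof_upd.
  have H1 := coord_ibpR mX jX mr mr' pr pr' (fun xi x => (Du xi x).1) (fun xi => (Cu xi).1).
  have H2 := coord_ibpR mX jX mi mi' pi pi' (fun xi x => (Du xi x).2) (fun xi => (Cu xi).2).
  split.
    transitivity (\int[P]_w (X w k * re (F (Wof (X w)))))%R.
      by apply: eq_Rintegral => w _; have [-> _ _] := WX w.
    by rewrite H1; congr (_ * _); apply: eq_Rintegral => w _; have [-> _ _] := WX w.
  transitivity (\int[P]_w (X w k * im (F (Wof (X w)))))%R.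
    by apply: eq_Rintegral => w _; have [-> _ _] := WX w.
  by rewrite H2; congr (_ * _); apply: eq_Rintegral => w _; have [-> _ _] := WX w.
have intc k : P.-integrable setT (fun w => (X w k * re (F (W w)))%:E) /\
    P.-integrable setT (fun w => (X w k * im (F (W w)))%:E).
  split.
    have := coord_poly_integrable s_gt0 mX jX (coord_measurableM k mr) (coord_polyM k pr).
    by apply: eq_integrable => // w _; have [-> _ _] := WX w.
  have := coord_poly_integrable s_gt0 mX jX (coord_measurableM k mi) (coord_polyM k pi).
  by apply: eq_integrable => // w _; have [-> _ _] := WX w.
have intV k : P.-integrable setT (fun w => (re (DF (W w) (Vdir k)))%:E) /\
    P.-integrable setT (fun w => (im (DF (W w) (Vdir k)))%:E).
  have gV := gDF (Vdir k); have [mr' mi'] := coord_measurable_good gV; have [pr' pi'] := coord_poly_good gV.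
  split.
    have := coord_poly_integrable s_gt0 mX jX mr' pr'.
    by apply: eq_integrable => // w _; have [-> _ _] := WX w.
  have := coord_poly_integrable s_gt0 mX jX mi' pi'.
  by apply: eq_integrable => // w _; have [-> _ _] := WX w.
have comb (f1 f2 f3 f4 : T -> R) : P.-integrable setT (EFin \o f1) -> P.-integrable setT (EFin \o f2) ->
   P.-integrable setT (EFin \o f3) -> P.-integrable setT (EFin \o f4) ->
   (\int[P]_w (f1 w - f2 w + (f3 w + f4 w)) = \int[P]_w f1 w - \int[P]_w f2 w + (\int[P]_w f3 w + \int[P]_w f4 w))%R.
  move=> i1 i2 i3 i4; rewrite RintegralD//; last 2 first.
  - exact: (integrableB measurableT i1 i2).
  - exact: (integrableD measurableT i3 i4).
  by rewrite RintegralB// RintegralD.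
have -> : EW (fun M => M b c * F M) = (\int[P]_w (X w (b, c, true) * re (F (W w)) - X w (b, c, false) * im (F (W w))
    + (X w (c, b, true) * re (F (W w)) + X w (c, b, false) * im (F (W w)))))%R.
  apply: eq_Rintegral => w _; rewrite reM; have [_ -> ->] := WX w; ring.
rewrite (comb _ _ _ _ (intc _).1 (intc _).2 (intc _).1 (intc _).2).
rewrite (ibp (b, c, true)).1 (ibp (b, c, false)).2 (ibp (c, b, true)).1 (ibp (c, b, false)).2.
rewrite -mulrBr -!mulrDr -(comb _ _ _ _ (intV _).1 (intV _).2 (intV _).1 (intV _).2).
have -> : (n%:R)^-1 = (4 * n%:R)^-1 * 4 :> R.
  by field; rewrite pnatr_eq0 -lt0n.
rewrite -mulrA -EW_Z//; congr (_ * _).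
apply: eq_Rintegral => w _; rewrite reZ.
have hD := lF (W w) (herm_W w).
have D0 : DF (W w) 0 = 0.
  by have := hD 1 0 0; rewrite scaler0 addr0 mul1r => /eqP; rewrite -subr_eq0 opprD addrA subrr sub0r oppr_eq0 => /eqP.
have hT k l : DF (W w) (Vdir (k, l, true)) = DF (W w) (delta_mx k l) + DF (W w) (delta_mx l k).
  by rewrite /Vdir/= -[X in DF _ (X + _)]scale1r hD mul1r.
have hF k l : DF (W w) (Vdir (k, l, false)) = 'i * (DF (W w) (delta_mx k l) - DF (W w) (delta_mx l k)).
  rewrite /Vdir/= -[X in DF _ X]addr0 hD D0 addr0 addrC -scaleN1r hD; ring.
by rewrite !hT !hF !(reD, imM, reB, imB) re_i im_i /=; ring.
Qed.

Lemma EW_ibp Q DQ : mdiff Q DQ ->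
  EW (fun M => \tr (M *m Q M)) = (n%:R)^-1 * EW (fun M => \sum_b \sum_c DQ M (delta_mx c b) c b).
Proof.
move=> dQ.
have gQ b c : good (fun M => Q M b c) by have [] := dQ b c.
have gDQ V b c : good (fun M => DQ M V b c) by have [_ /(_ V)] := dQ b c.
rewrite [in RHS]EW_sum; last by move=> b; apply: good_sum => c _; exact: gDQ.
rewrite mulr_sumr.
transitivity (EW (fun M => \sum_b \sum_c M b c * Q M c b)).
  by apply: EW_ext => M _; congr re; apply: eq_bigr => b _; rewrite mxE.
rewrite EW_sum; last by move=> b; apply: good_sum => c _; apply: goodM; [exact: good_entry|exact: gQ].
apply: eq_bigr => b _.
rewrite [in LHS]EW_sum; last by move=> c; apply: goodM; [exact: good_entry|exact: gQ].
rewrite [in RHS]EW_sum; last by move=> c; exact: gDQ.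
by rewrite mulr_sumr; apply: eq_bigr => c _; rewrite (EW_entry b c (dQ c b)).
Qed.

End gueE.

(** * Resolvents *)

Section resolvents.
Variable R : realType.
Local Notation C := R[i].

(** Lagrange's identity: the difference of the two sides is half the double sum of (a_i b_j - a_j
    b_i)^2. *)
Lemma cauchy_schwarz_sum (I : finType) (a b : I -> R) :
  (\sum_i a i * b i) ^+ 2 <= (\sum_i a i ^+ 2) * (\sum_i b i ^+ 2).
Proof.
have : 0 <= \sum_i \sum_j (a i * b j - a j * b i) ^+ 2.
  by apply: sumr_ge0 => i _; apply: sumr_ge0 => j _; exact: sqr_ge0.
have -> : \sum_i \sum_j (a i * b j - a j * b i) ^+ 2 =
  (\sum_i a i ^+ 2) * (\sum_j b j ^+ 2) + (\sum_i b i ^+ 2) * (\sum_j a j ^+ 2)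
  - 2 * ((\sum_i a i * b i) * (\sum_j a j * b j)).
  rewrite !mulr_suml mulr_sumr -sumrN -!big_split /=; apply: eq_bigr => i _.
  rewrite !mulr_sumr -sumrN -!big_split /=; apply: eq_bigr => j _; ring.
rewrite -expr2; lra.
Qed.

Lemma trC_conj p (A : 'M[C]_p) : \tr (A^t*) = (\tr A)^*%R.
Proof. by rewrite /mxtrace rmorph_sum; apply: eq_bigr => i _; rewrite !mxE. Qed.

Lemma mulmx_trC p q r (A : 'M[C]_(p, q)) (B : 'M[C]_(q, r)) : (A *m B)^t* = B^t* *m A^t*.
Proof. by rewrite trmx_mul map_mxM. Qed.

Lemma hs2_trC p q (A : 'M[C]_(p, q)) : hs2 (A^t*) = hs2 A.
Proof.
rewrite /hs2 exchange_big; apply: eq_bigr => i _; apply: eq_bigr => j _.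
by rewrite !mxE cabsJ.
Qed.

Lemma tr_hs2 p q (A : 'M[C]_(p, q)) : \tr (A^t* *m A) = (hs2 A)%:C.
Proof.
have realCsum (I : Type) (r : seq I) (F : I -> R) : (\sum_(i <- r) F i)%:C = \sum_(i <- r) (F i)%:C.
  by apply: (big_morph _ (@realCD R)).
rewrite /hs2 exchange_big realCsum; apply: eq_bigr => j _.
rewrite mxE realCsum; apply: eq_bigr => i _.
by rewrite !mxE -mul_conj mulrC.
Qed.

Lemma hs2_eq0 p q (A : 'M[C]_(p, q)) : hs2 A = 0 -> A = 0.
Proof.
move=> h; apply/matrixP => i j; rewrite mxE; apply/eqP; rewrite -cabs_eq0.
have := cabs_entry A i j; rewrite h => h2.
by rewrite -sqrf_eq0 eq_le h2 sqr_ge0.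
Qed.

Lemma tr_CS p q (A : 'M[C]_(p, q)) (B : 'M[C]_(q, p)) :
  cabs (\tr (A *m B)) ^+ 2 <= hs2 A * hs2 B.
Proof.
have h : cabs (\tr (A *m B)) <= \sum_(ij : 'I_p * 'I_q) cabs (A ij.1 ij.2) * cabs (B ij.2 ij.1).
  rewrite -(pair_bigA _ (fun i j => cabs (A i j) * cabs (B j i))) /=.
  apply: le_trans (cabs_sum _ _ _) _; apply: ler_sum => i _; rewrite mxE.
  apply: le_trans (cabs_sum _ _ _) _; apply: ler_sum => j _.
  by rewrite cabsM.
have S0 : 0 <= \sum_(ij : 'I_p * 'I_q) cabs (A ij.1 ij.2) * cabs (B ij.2 ij.1).
  by apply: sumr_ge0 => ij _; rewrite mulr_ge0 ?cabs_ge0.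
apply: le_trans (_ : (\sum_(ij : 'I_p * 'I_q) cabs (A ij.1 ij.2) * cabs (B ij.2 ij.1)) ^+ 2 <= _).
  by rewrite lerXn2r ?nnegrE ?cabs_ge0.
apply: le_trans (cauchy_schwarz_sum _ _) _.
rewrite -(pair_bigA _ (fun i j => cabs (A i j) ^+ 2)) -(pair_bigA _ (fun i j => cabs (B j i) ^+ 2)) /=.
by rewrite [X in _ * X]exchange_big.
Qed.

Lemma tr_CS_bound p q (A : 'M[C]_(p, q)) (B : 'M[C]_(q, p)) (c h : R) : 0 <= c -> 0 <= h ->
  hs2 A <= c ^+ 2 * h -> hs2 B <= h -> cabs (\tr (A *m B)) <= c * h.
Proof.
move=> c0 h0 hA hB; rewrite -ler_sqr ?nnegrE ?cabs_ge0 ?mulr_ge0//.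
apply: le_trans (tr_CS A B) _.
have -> : (c * h) ^+ 2 = (c ^+ 2 * h) * h by ring.
by apply: ler_pM; rewrite ?hs2_ge0.
Qed.

Variable n : nat.
Implicit Types M : 'M[C]_n.

(** Operator norm at most [c], tested on blocks with any number of columns so that it bounds [hs2]
    of a product directly. *)
Definition opb (Q : 'M[C]_n) (c : R) := 0 <= c /\
  forall p (X : 'M[C]_(n, p)), hs2 (Q *m X) <= c ^+ 2 * hs2 X.

Lemma opbM Q Q' c c' : opb Q c -> opb Q' c' -> opb (Q *m Q') (c * c').
Proof.
move=> [c0 h] [c0' h']; split; first exact: mulr_ge0.
move=> p X; rewrite -mulmxA; apply: le_trans (h _ _) _; rewrite exprMn -[leRHS]mulrA.
by apply: ler_wpM2l; [exact: sqr_ge0|exact: h'].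
Qed.

Lemma opb_entry Q c i j : opb Q c -> cabs (Q i j) <= c.
Proof.
move=> [c0 h]; rewrite -ler_sqr ?nnegrE ?cabs_ge0//.
have := h 1%N (delta_mx j 0).
have -> : hs2 (delta_mx j 0 : 'cV[C]_n) = 1.
  rewrite /hs2; under eq_bigr do rewrite big_ord1 mxE eqxx andbT.
  rewrite (bigD1 j)//= eqxx cabs1 expr1n big1 ?addr0// => k /negbTE kj.
  by rewrite kj cabs0 expr0n.
rewrite mulr1; apply: le_trans.
have := cabs_entry (Q *m delta_mx j (0 : 'I_1)) i 0.
by rewrite -colE mxE.
Qed.

Definition res M (w : C) := invmx (M - w%:M).

Lemma im_tr_form p M w (Y : 'M[C]_(n, p)) : herm M ->
  im (\tr (Y^t* *m ((M - w%:M) *m Y))) = - im w * hs2 Y.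
Proof.
move=> hM; rewrite mulmxBl mulmxBr raddfB /= imB.
have -> : im (\tr (Y^t* *m (M *m Y))) = 0.
  have : (\tr (Y^t* *m (M *m Y)))^*%R = \tr (Y^t* *m (M *m Y)).
    by rewrite -trC_conj !mulmx_trC trmxCK hM mulmxA.
  move/(congr1 (@complex.Im R)); rewrite imJ; lra.
by rewrite mul_scalar_mx -scalemxAr mxtraceZ tr_hs2 imM /= mulr0 !add0r mulNr.
Qed.

(** The form Y* (M - w) Y has a trace with imaginary part - im w hs2 Y, and Cauchy-Schwarz bounds
    that trace. Both the invertibility of M - w and the norm bound on the resolvent follow without
    diagonalizing M. *)
Lemma res_lower p M w (Y : 'M[C]_(n, p)) : herm M ->
  im w ^+ 2 * hs2 Y <= hs2 ((M - w%:M) *m Y).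
Proof.
move=> hM; set Z := (_ *m Y).
have h1 : (im w * hs2 Y) ^+ 2 <= hs2 Y * hs2 Z.
  have := im_tr_form w Y hM; rewrite -/Z => e.
  rewrite -[im w * _]opprK -mulNr -e sqrrN -[hs2 Y]hs2_trC.
  apply: le_trans (tr_CS _ _); rewrite -real_normK ?num_real//.
  by rewrite lerXn2r ?nnegrE ?cabs_ge0// im_le_cabs.
have := hs2_ge0 Y; rewrite le_eqVlt => /orP[/eqP <-|Y0]; first by rewrite mulr0 hs2_ge0.
by rewrite -(ler_pM2r Y0); apply: le_trans (_ : _ <= _) h1 || idtac; nra.
Qed.

Lemma res_unit M w : herm M -> im w != 0 -> M - w%:M \in unitmx.
Proof.
move=> hM w0; rewrite -row_full_unit -cokermx_eq0.
have h := res_lower w (cokermx (M - w%:M)) hM.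
rewrite mulmx_coker in h.
apply/eqP; apply: hs2_eq0; apply/eqP; rewrite eq_le hs2_ge0 andbT.
have h0 : hs2 (0 : 'M[C]_n) = 0.
  by rewrite /hs2 big1// => i _; rewrite big1// => j _; rewrite mxE cabs0 expr0n.
rewrite h0 in h.
have w2 : 0 < im w ^+ 2 by rewrite lt0r sqr_ge0 andbT sqrf_eq0.
by rewrite -(ler_pM2l w2) mulr0.
Qed.

Lemma res_opb M w (y : R) : herm M -> 0 < y -> y <= `|im w| -> opb (res M w) y^-1.
Proof.
move=> hM y0 yw; split; first by rewrite invr_ge0 ltW.
move=> p X; have w0 : im w != 0 by rewrite -normr_gt0 (lt_le_trans y0).
have := res_lower w (res M w *m X) hM.
rewrite mulmxA mulmxV ?res_unit// mul1mx => h.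
have y2 : 0 < y ^+ 2 by rewrite exprn_gt0.
rewrite exprVn mulrC ler_pdivlMr// mulrC; apply: le_trans h.
apply: ler_wpM2r; first exact: hs2_ge0.
by rewrite -[im w ^+ 2]real_normK ?num_real//; apply: lerXn2r; rewrite ?nnegrE// ltW.
Qed.

Lemma res_adj M w : herm M -> im w != 0 -> (res M w)^t* = res M (w^*)%R.
Proof.
move=> hM w0.
have u1 := res_unit hM w0.
have u2 : M - ((w^*)%R)%:M \in unitmx by apply: res_unit => //; rewrite imJ oppr_eq0.
have : (M - w%:M)^t* = M - ((w^*)%R)%:M.
  by rewrite raddfB /= map_mxB hM tr_scalar_mx map_scalar_mx.
move=> e; apply: (canRL (mulmxKV u2)) || idtac.
have h : (res M w)^t* *m (M - ((w^*)%R)%:M) = 1%:M.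
  by rewrite -e -mulmx_trC mulmxV// trmx1 map_mx1.
by rewrite -[LHS](mulmxK u2) h mul1mx.
Qed.

(** The Ward identity, which is [im_tr_form] at [Y = res M w]. It converts Hilbert-Schmidt norms of
    resolvents into Im m, a gain over bounding every factor in operator norm. *)
Lemma res_ward M w : herm M -> im w != 0 -> im w * hs2 (res M w) = im (\tr (res M w)).
Proof.
move=> hM w0; have := im_tr_form w (res M w) hM.
rewrite mulmxV ?res_unit// mulmx1 trC_conj imJ mulNr => /oppr_inj.
by [].
Qed.

Lemma invmx_sub (A B : 'M[C]_n) : A \in unitmx -> B \in unitmx ->
  invmx A - invmx B = invmx A *m (B - A) *m invmx B.
Proof.
by move=> uA uB; rewrite mulmxBr mulmxBl mulVmx// mul1mx -mulmxA mulmxV// mulmx1.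
Qed.

Lemma res_eigen M w (x : 'cV[C]_n) (l : C) : herm M -> im w != 0 -> M *m x = l *: x ->
  l != w -> res M w *m x = (l - w)^-1 *: x.
Proof.
move=> hM w0 e lw.
have : (M - w%:M) *m x = (l - w) *: x by rewrite mulmxBl e mul_scalar_mx scalerBl.
move/(congr1 (mulmx (res M w))); rewrite mulmxA mulVmx ?res_unit// mul1mx -scalemxAr => e2.
by rewrite [X in _ = _ *: X]e2 scalerA mulVf ?scale1r ?subr_eq0.
Qed.

End resolvents.

Lemma conj_realM (R : realType) (a : R) (x y : R[i]) :
  (a%:C * x * y)^*%R = a%:C * x^*%R * y^*%R.
Proof. by apply: eqc; rewrite !(reM, imM, reJ, imJ) /=; ring. Qed.

(** * The self-consistent equation and the local law *)

Section deltas.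
Variables (R : realType) (n : nat).
Implicit Types X Y : 'M[R[i]]_n.

Lemma delta_sandwich X Y (b c : 'I_n) : (X *m delta_mx c b *m Y) c b = X c c * Y b b.
Proof.
rewrite mxE (bigD1 b)//= big1 ?addr0.
  by rewrite mxE (bigD1 c)//= big1 ?addr0 ?mxE ?eqxx ?mulr1// => k /negbTE kc; rewrite mxE kc mulr0.
move=> k /negbTE kb; rewrite mxE big1 ?mul0r// => l _.
by rewrite mxE kb andbF mulr0.
Qed.

Lemma sum_delta_sandwich X Y :
  \sum_b \sum_c (X *m delta_mx c b *m Y) c b = \tr X * \tr Y.
Proof.
rewrite exchange_big /= mulr_suml; apply: eq_bigr => c _; rewrite mulr_sumr.
by apply: eq_bigr => b _; exact: delta_sandwich.
Qed.

Lemma tr_delta Y (b c : 'I_n) : \tr (Y *m delta_mx c b) = Y b c.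
Proof.
rewrite /mxtrace (bigD1 b)//= big1 ?addr0.
  by rewrite mxE (bigD1 c)//= big1 ?addr0 ?mxE ?eqxx ?mulr1// => k /negbTE kc; rewrite mxE kc mulr0.
by move=> k /negbTE kb; rewrite mxE big1// => l _; rewrite mxE kb andbF mulr0.
Qed.

Lemma sum_mul_tr X Y : \sum_b \sum_c X b c * Y c b = \tr (X *m Y).
Proof. by apply: eq_bigr => b _; rewrite mxE. Qed.

Lemma tr_cyc5 X Y L :
  \tr (X *m X *m (X *m L *m Y *m Y)) = \tr (L *m Y *m Y *m X *m X *m X).
Proof.
have -> : X *m X *m (X *m L *m Y *m Y) = (X *m X *m X) *m (L *m Y *m Y) by rewrite !mulmxA.
by rewrite mxtrace_mulC !mulmxA.
Qed.

Lemma tr_cyc_scale (a : R[i]) X Y L M :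
  \tr (L *m Y *m (a *: M) *m X) = a * \tr (M *m (X *m L *m Y)).
Proof.
rewrite -scalemxAr -scalemxAl mxtraceZ; congr (_ * _).
have -> : L *m Y *m M *m X = (L *m Y) *m (M *m X) by rewrite !mulmxA.
by rewrite mxtrace_mulC !mulmxA.
Qed.

Lemma tr_cyc_scalar (a : R[i]) X Y L :
  \tr (L *m Y *m a%:M *m X) = a * \tr (X *m L *m Y).
Proof. by rewrite mul_mx_scalar -scalemxAl mxtraceZ mxtrace_mulC !mulmxA. Qed.

End deltas.

Section selfcons.
Variables (R : realType) (d : measure_display) (T : measurableType d).
Variables (P : probability T R) (n : nat) (W : T -> 'M[R[i]]_n).
Hypothesis n0 : (0 < n)%N.
Hypothesis gueW : gue P W.
Variables (A : 'M[R[i]]_n) (t E : R).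
Hypothesis hA : herm A.
Hypothesis t0 : 0 < t.
Local Notation M_ := 'M[R[i]]_n.
Local Notation EW := (EW P W).

Let N : R := n%:R.
Let sg : R := Num.sqrt t.
Let s2 : R := N * t.
(* With z = E + i/n: [GG] is the resolvent at z of the perturbed matrix, [mm] its
   normalized trace, [ww] = z + t m the subordinate spectral parameter, [RR] the
   resolvent of [A] there, and [ep] = m - tr(RR)/n the error in the
   self-consistent equation. *)
Definition zz : R[i] := E +i* N^-1.
Definition GG (M : M_) : M_ := res (A + sg%:C *: M) zz.
Definition mm (M : M_) : R[i] := N^-1%:C * \tr (GG M).
Definition ww (M : M_) : R[i] := zz + t%:C * mm M.
Definition RR (M : M_) : M_ := res A (ww M).
Definition rr (M : M_) : R[i] := N^-1%:C * \tr (RR M).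
Definition ep (M : M_) : R[i] := mm M - rr M.

Lemma N_gt0 : 0 < N. Proof. by rewrite ltr0n. Qed.
Lemma Ninv_gt0 : 0 < N^-1. Proof. by rewrite invr_gt0 N_gt0. Qed.
Lemma sg_sqr : sg ^+ 2 = t. Proof. by rewrite sqr_sqrtr// ltW. Qed.
Let NV : N * N^-1 = 1. Proof. by rewrite divff// gt_eqF// N_gt0. Qed.
Lemma s2_gt0 : 0 < s2. Proof. by rewrite mulr_gt0// N_gt0. Qed.

Lemma herm_H M : herm M -> herm (A + sg%:C *: M).
Proof. by move=> hM; apply: hermD => //; exact: hermZ. Qed.

Lemma hs2_GG M : herm M -> hs2 (GG M) = N ^+ 2 * im (mm M).
Proof.
move=> hM; have := @res_ward _ _ _ zz (herm_H hM) (lt0r_neq0 Ninv_gt0).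
rewrite /= => h; rewrite /mm imZ -h -[LHS]mul1r -[1]mulr1 -NV expr2; ring.
Qed.

Lemma im_mm M : herm M -> 0 <= im (mm M).
Proof.
move=> hM; have := hs2_ge0 (GG M); rewrite hs2_GG//.
by rewrite pmulr_rge0// exprn_gt0// N_gt0.
Qed.

Lemma im_ww M : im (ww M) = N^-1 + t * im (mm M).
Proof. by rewrite /ww imD imZ. Qed.

Lemma im_ww_ge M : herm M -> N^-1 <= im (ww M).
Proof. by move=> hM; rewrite im_ww lerDl mulr_ge0 ?im_mm// ltW. Qed.

Lemma im_ww_gt0 M : herm M -> 0 < im (ww M).
Proof. by move=> hM; exact: lt_le_trans Ninv_gt0 (im_ww_ge hM). Qed.

Lemma im_ww_neq0 M : herm M -> im (ww M) != 0.
Proof. by move=> hM; rewrite gt_eqF// im_ww_gt0. Qed.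

Lemma im_zz_neq0 : im zz != 0. Proof. by rewrite gt_eqF// Ninv_gt0. Qed.

Lemma opb_GG M : herm M -> opb (GG M) N.
Proof.
move=> hM; rewrite -[N]invrK; apply: res_opb; [exact: herm_H|exact: Ninv_gt0|].
by rewrite /= ger0_norm// ltW// Ninv_gt0.
Qed.

Lemma opb_RR M : herm M -> opb (RR M) (im (ww M))^-1.
Proof.
by move=> hM; apply: res_opb; rewrite ?im_ww_gt0// ger0_norm// ltW// im_ww_gt0.
Qed.

Lemma opb_RRN M : herm M -> opb (RR M) N.
Proof.
move=> hM; rewrite -[N]invrK; apply: res_opb => //; first exact: Ninv_gt0.
by rewrite ger0_norm ?im_ww_ge// ltW// im_ww_gt0.
Qed.

Lemma opb_GGadj M : herm M -> opb ((GG M)^t*) N.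
Proof.
move=> hM; rewrite res_adj; [|exact: herm_H|exact: im_zz_neq0].
rewrite -[N]invrK; apply: res_opb; [exact: herm_H|exact: Ninv_gt0|].
by rewrite imJ normrN /= ger0_norm// ltW// Ninv_gt0.
Qed.

Definition DGG (M V : M_) : M_ := - (GG M *m (sg%:C *: V) *m GG M).
Definition Dmm (M V : M_) : R[i] := N^-1%:C * \tr (DGG M V).
(** [RR] depends on the matrix only through the scalar [ww], so its derivative is that of [ww] times
    the square of [RR]. *)
Definition DRR (M V : M_) : M_ := (t%:C * Dmm M V) *: (RR M *m RR M).
Definition Drr (M V : M_) : R[i] := N^-1%:C * \tr (DRR M V).

Lemma mdiff_GG : mdiff GG DGG.
Proof.
have dQ : mdiff (fun M => (A + sg%:C *: M) - zz%:M) (fun _ V => sg%:C *: V).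
  have := mdiffD (mdiffD (mdiff_cst A) (mdiffZ (diff_cst n sg%:C) (@mdiff_id R n))) (mdiff_cst (- zz%:M)).
  apply: mdiff_ext => // M V _.
  by rewrite add0r addr0 scale0r add0r.
apply: (@mdiff_inv _ _ _ _ N) dQ _ _ => [M hM|M i j hM].
  by apply: res_unit; [exact: herm_H|exact: im_zz_neq0].
exact: opb_entry (opb_GG hM).
Qed.

Lemma diff_mm : diff mm Dmm.
Proof. by apply: diffZ; apply: diff_trace; exact: mdiff_GG. Qed.

Lemma mdiff_RR : mdiff RR DRR.
Proof.
have dw : diff ww (fun M V => t%:C * Dmm M V).
  apply: diff_ext (diffD (diff_cst n zz) (diffZ t%:C diff_mm)) => // M V _.
  by rewrite add0r.
have dQ : mdiff (fun M => A - (ww M)%:M) (fun M V => - (t%:C * Dmm M V)%:M).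
  have := mdiffD (mdiff_cst A) (mdiffZ (diff_cst n (-1)) (mdiff_scalar dw)).
  apply: mdiff_ext => [M|M V] _; first by rewrite scaleN1r.
  by rewrite add0r scale0r add0r scaleN1r.
have := @mdiff_inv _ _ _ _ N dQ.
move=> /(_ (fun M hM => res_unit hA (im_ww_neq0 hM))) /(_ (fun M i j hM => opb_entry i j (opb_RRN hM))).
apply: mdiff_ext => // M V _.
by rewrite mulmxN mulNmx opprK mul_mx_scalar -scalemxAl.
Qed.

Lemma diff_rr : diff rr Drr.
Proof. by apply: diffZ; apply: diff_trace; exact: mdiff_RR. Qed.

Lemma diff_ep : diff ep (fun M V => Dmm M V - Drr M V).
Proof.
apply: diff_ext (diffD diff_mm (diffZ (-1) diff_rr)) => [M|M V] _; by rewrite mulN1r.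
Qed.

Lemma Dmm_delta M b c : Dmm M (delta_mx c b) = - (sg / N)%:C * (GG M *m GG M) b c.
Proof.
rewrite /Dmm /DGG -scalemxAr -scalemxAl raddfN /= mxtraceZ mxtrace_mulC mulmxA tr_delta.
by rewrite realCM; ring.
Qed.

Lemma G_sub_R M : herm M -> GG M - RR M = - (RR M *m (sg%:C *: M + (t%:C * mm M)%:M) *m GG M).
Proof.
move=> hM.
have e : (A + sg%:C *: M - zz%:M) - (A - (ww M)%:M) = sg%:C *: M + (t%:C * mm M)%:M.
  apply/matrixP => i j; rewrite !mxE /ww; case: (i == j); rewrite ?mulr1n ?mulr0n; ring.
have h := invmx_sub (res_unit hA (im_ww_neq0 hM)) (res_unit (herm_H hM) im_zz_neq0).
by rewrite -e -opprB; congr (- _).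
Qed.

Lemma sum_delta_Dmm (Y M : M_) :
  \sum_b \sum_c (Dmm M (delta_mx c b) * Y c b) = - (sg / N)%:C * \tr (GG M *m GG M *m Y).
Proof.
rewrite -sum_mul_tr mulr_sumr; apply: eq_bigr => b _; rewrite mulr_sumr; apply: eq_bigr => c _.
by rewrite Dmm_delta mulrA.
Qed.

(** G - R equals - R (sg M + t m) G. Integrating by parts in M, the derivative falling on G gives t
    m tr (G L R), which the shift of w by t m cancels exactly. The derivative falling on R gives the
    term in t^2 / n^2, and the one falling on F the last term. *)
Lemma resolvent_ibp (L : M_) F DF : diff F DF ->
  EW (fun M => F M * \tr (L *m (GG M - RR M))) =
  EW (fun M => ((t ^+ 2 / N ^+ 2)%:C * (F M * \tr (L *m RR M *m RR M *m GG M *m GG M *m GG M)))) -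
  EW (fun M => ((sg / N)%:C * \sum_b \sum_c DF M (delta_mx c b) * (GG M *m L *m RR M) c b)).
Proof.
move=> dF.
have gF : good F by have [] := dF.
have gG : mgood GG by move=> i j; have [] := mdiff_GG i j.
have gR : mgood RR by move=> i j; have [] := mdiff_RR i j.
have gm : good mm by have [] := diff_mm.
have gL : mgood (fun _ : M_ => L) by move=> i j; exact: good_cst.
have gtr (Q : M_ -> M_) : mgood Q -> good (fun M => \tr (Q M)).
  by move=> gQ; apply: good_sum => i _; exact: gQ.
have dGLR := mdiffM (mdiffM mdiff_GG (mdiff_cst L)) mdiff_RR.
have dQ := mdiffZ dF dGLR.
have ibp := EW_ibp n0 gueW dQ.
pose F1 (M : M_) : R[i] := \tr (M *m (F M *: (GG M *m L *m RR M))).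
pose F3 (M : M_) : R[i] := F M * mm M * \tr (GG M *m L *m RR M).
pose F4 (M : M_) : R[i] := F M * \tr (L *m RR M *m RR M *m GG M *m GG M *m GG M).
pose S1 (M : M_) : R[i] := \sum_b \sum_c DF M (delta_mx c b) * (GG M *m L *m RR M) c b.
have gGLR : mgood (fun M => GG M *m L *m RR M) by apply: mgoodM => //; apply: mgoodM.
have gF1 : good F1.
  apply: gtr; apply: mgoodM; first by move=> i j; exact: good_entry.
  move=> i j; apply: good_ext (goodM gF (gGLR i j)) => M _; by rewrite [RHS]mxZE.
have gF3 : good F3 by apply: goodM; [exact: goodM|exact: gtr].
have gF4 : good F4.
  apply: goodM gF _; apply: gtr.
  exact: mgoodM (mgoodM (mgoodM (mgoodM (mgoodM gL gR) gR) gG) gG) gG.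
have gS1 : good S1.
  apply: good_sum => b _; apply: good_sum => c _; apply: goodM => //.
  by have [_ h _ _] := dF; exact: h.
have e0 : EW (fun M => F M * \tr (L *m (GG M - RR M))) = - sg * EW F1 + (- t) * EW F3.
  rewrite -(EW_lin2 n0 gueW _ _ gF1 gF3).
  apply: (EW_ext gueW) => M hM; congr re.
  rewrite G_sub_R// mulmxN raddfN /= !mulmxA mulmxDr mulmxDl raddfD /= /F1 /F3.
  rewrite tr_cyc_scale tr_cyc_scalar.
  rewrite -scalemxAr mxtraceZ !realCN; ring.
have e1 : EW F1 = N^-1 * (1 * EW S1 + (- (sg * N)) * EW F3 + (- (t * sg / N)) * EW F4).
  rewrite /F1 ibp; congr (_ * _).
  rewrite -(EW_lin3 n0 gueW _ _ _ gS1 gF3 gF4); apply: (EW_ext gueW) => M hM; congr re.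
  rewrite /S1 /F3 /F4.
  transitivity (\sum_b \sum_c (DF M (delta_mx c b) * (GG M *m L *m RR M) c b
     + F M * ((- sg%:C) * (GG M *m delta_mx c b *m (GG M *m L *m RR M)) c b
     + t%:C * (Dmm M (delta_mx c b) * (GG M *m L *m RR M *m RR M) c b)))).
    apply: eq_bigr => b _; apply: eq_bigr => c _.
    rewrite mxDE mxZE mxZE mxDE mulmx0 addr0 /DGG /DRR !mulNmx mxNE -!scalemxAr -!scalemxAl.
    by rewrite !mxZE !mulmxA; ring.
  under eq_bigr do rewrite big_split /= -mulr_sumr big_split /= -!mulr_sumr.
  rewrite big_split /= -mulr_sumr big_split /= -!mulr_sumr sum_delta_sandwich sum_delta_Dmm//.
  rewrite tr_cyc5.
  have -> : \tr (GG M) = N%:C * mm M.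
    by rewrite /mm mulrA -realCM NV mul1r.
  rewrite !realCN !realCM; ring.
rewrite (EW_Z n0 gueW _ gF4) (EW_Z n0 gueW _ gS1) e0 e1.
have := sg_sqr; rewrite expr2 => e.
have N0 : N != 0 by rewrite gt_eqF// N_gt0.
move: (EW S1) (EW F3) (EW F4) => x y w.
by rewrite -[t]e; field.
Qed.

(** By the Ward identity hs2 R = n im r / im w, where r = m - ep and im w = 1/n + t im m. The part t
    im m of the denominator absorbs im m, and the part 1/n absorbs ep. *)
Lemma hs2_RR M : herm M -> t / N * hs2 (RR M) <= 1 + s2 * cabs (ep M).
Proof.
move=> hM; have wM := res_ward hA (im_ww_neq0 hM).
have w0 := im_ww_gt0 hM.
have y0 := im_mm hM.
have h2 : im (ww M) * hs2 (RR M) = N * im (rr M).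
  by rewrite /rr imZ mulrA NV mul1r.
have h3 : im (rr M) <= im (mm M) + cabs (ep M).
  have -> : rr M = mm M - ep M by rewrite /ep; ring.
  rewrite imB lerD2l; have := im_le_cabs (ep M); rewrite ler_norml => /andP[]; lra.
have N0 := N_gt0.
have e0 := cabs_ge0 (ep M).
rewrite -(ler_pM2r w0).
have -> : t / N * hs2 (RR M) * im (ww M) = t / N * (im (ww M) * hs2 (RR M)) by ring.
rewrite h2 mulrA divfK ?gt_eqF//.
apply: le_trans (_ : t * (im (mm M) + cabs (ep M)) <= _); first by rewrite ler_pM2l.
rewrite im_ww /s2.
have -> : (1 + N * t * cabs (ep M)) * (N^-1 + t * im (mm M)) =
  N^-1 + t * im (mm M) + (N * N^-1) * t * cabs (ep M) + N * t * cabs (ep M) * t * im (mm M) by ring.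
rewrite NV mul1r; have := Ninv_gt0.
have : 0 <= N * t * cabs (ep M) * t * im (mm M).
  by rewrite !mulr_ge0// ltW.
rewrite mulrDr; lra.
Qed.

Lemma cabs_trRR M : cabs (\tr (RR M *m RR M)) <= hs2 (RR M).
Proof. by rewrite -[leRHS]mul1r; apply: tr_CS_bound; rewrite ?hs2_ge0// expr1n mul1r. Qed.

Lemma im_ww_inv M : herm M -> (im (ww M))^-1 = N / (1 + s2 * im (mm M)).
Proof.
move=> hM; have := im_ww_gt0 hM; rewrite im_ww => h.
have N0 := N_gt0; have y0 := im_mm hM.
have : 0 < 1 + s2 * im (mm M).
  by rewrite ltr_pwDl// mulr_ge0// ltW// s2_gt0.
rewrite /s2 => h2; field; rewrite !gt_eqF//= addrC mulrC mulrA //.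
Qed.

(** Write y = im m and q = 1 + s2 y. Two factors G contribute hs2 G = n^2 y, the third at most n,
    and each R at most n / q. The product is s2 times s2 y / q^2, so a large y is compensated by the
    denominators. *)
Lemma first_term M : herm M ->
  (t / N) ^+ 2 * N^-1 * cabs (\tr (RR M *m RR M *m GG M *m GG M *m GG M)) <= s2.
Proof.
move=> hM; have N0 := N_gt0; have y0 := im_mm hM.
have oR := opb_RR hM; rewrite im_ww_inv// in oR.
have hG := hs2_GG hM.
set y := im (mm M) in y0 oR hG *.
have q0 : 0 < 1 + s2 * y by rewrite ltr_pwDl// mulr_ge0// ltW// s2_gt0.
set q := 1 + s2 * y in q0 oR *.
have q1 : 1 <= q by rewrite lerDl mulr_ge0// ltW// s2_gt0.
have oRRG := opbM (opbM oR oR) (opb_GG hM).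
have h := tr_CS_bound oRRG.1 (hs2_ge0 (GG M)) (oRRG.2 _ (GG M)) (lexx _).
apply: le_trans (_ : (t / N) ^+ 2 * N^-1 * (N / q * (N / q) * N * hs2 (GG M)) <= _).
  by rewrite ler_wpM2l// mulr_ge0 ?sqr_ge0// invr_ge0 ltW.
rewrite hG.
have -> : (t / N) ^+ 2 / N * (N / q * (N / q) * N * (N ^+ 2 * y)) = s2 * (s2 * y / q ^+ 2).
  by rewrite /s2; field; rewrite !gt_eqF.
rewrite ler_piMr ?(ltW s2_gt0)// ler_pdivrMr ?exprn_gt0// mul1r.
by apply: le_trans (_ : q <= _); [rewrite /q; lra|rewrite ler_eXnr].
Qed.

(** The same count as in [first_term] with a single factor R, which leaves s2 y / q <= 1. *)
Lemma second_term M : herm M ->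
  t / N ^+ 3 * cabs (\tr ((GG M *m GG M)^t* *m (GG M *m RR M))) <= 1.
Proof.
move=> hM; have N0 := N_gt0; have y0 := im_mm hM.
have oR := opb_RR hM; rewrite im_ww_inv// in oR.
have hG := hs2_GG hM.
set y := im (mm M) in y0 oR hG *.
have q0 : 0 < 1 + s2 * y by rewrite ltr_pwDl// mulr_ge0// ltW// s2_gt0.
set q := 1 + s2 * y in q0 oR *.
have oRG := opbM oR (opb_GGadj hM).
have := oRG.2 _ ((GG M)^t*); rewrite hs2_trC => h1.
have h := tr_CS_bound oRG.1 (hs2_ge0 (GG M)) h1 (lexx _).
have -> : \tr ((GG M *m GG M)^t* *m (GG M *m RR M)) = \tr (RR M *m (GG M)^t* *m (GG M)^t* *m GG M).
  rewrite mulmx_trC; move: (GG M) (RR M) => X Y.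
  by rewrite mulmxA mxtrace_mulC !mulmxA.
apply: le_trans (_ : t / N ^+ 3 * (N / q * N * hs2 (GG M)) <= _).
  by rewrite ler_wpM2l// divr_ge0 ?exprn_ge0// ltW.
rewrite hG.
have -> : t / N ^+ 3 * (N / q * N * (N ^+ 2 * y)) = s2 * y / q.
  by rewrite /s2; field; rewrite !gt_eqF.
by rewrite ler_pdivrMr// mul1r /q; lra.
Qed.

Definition epJ M : R[i] := (ep M)^*%R.
Definition DepJ M V : R[i] := (Dmm M (V^t*) - Drr M (V^t*))^*%R.
Lemma diff_epJ : diff epJ DepJ. Proof. exact: diffJ diff_ep. Qed.

(** The factor 1 - (t/n) tr R^2 is the derivative of [ep] with respect to m, since [rr] sees the
    matrix through m alone. *)
Lemma DepJ_delta M b c : DepJ M (delta_mx c b) =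
  - (sg / N)%:C * (1 - (t / N)%:C * \tr (RR M *m RR M))^*%R * ((GG M *m GG M)^t*) b c.
Proof.
have -> : (GG M *m GG M)^t* b c = ((GG M *m GG M) c b)^*%R by rewrite mxE [_^T b c]mxE.
have -> : DepJ M (delta_mx c b) = (Dmm M (delta_mx b c) - Drr M (delta_mx b c))^*%R.
  rewrite /DepJ; have -> // : (delta_mx c b)^t* = delta_mx b c :> M_.
  by rewrite trmx_delta map_delta_mx.
rewrite /Drr /DRR mxtraceZ Dmm_delta.
move: ((GG M *m GG M) c b) (\tr (RR M *m RR M)) => x r.
have -> : - (sg / N)%:C * x - N^-1%:C * (t%:C * (- (sg / N)%:C * x) * r) =
    (- (sg / N))%:C * (1 - (t / N)%:C * r) * x.
  by rewrite realCN !realCM; ring.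
by rewrite conj_realM realCN.
Qed.

Lemma S1_eq M : \sum_b \sum_c DepJ M (delta_mx c b) * (GG M *m N^-1%:C%:M *m RR M) c b =
  - (sg / N ^+ 2)%:C * (1 - (t / N)%:C * \tr (RR M *m RR M))^*%R * \tr ((GG M *m GG M)^t* *m (GG M *m RR M)).
Proof.
under eq_bigr do under eq_bigr do rewrite DepJ_delta.
rewrite -(sum_mul_tr ((GG M *m GG M)^t*)); set k := (1 - _)^*%R.
rewrite mulr_sumr; apply: eq_bigr => b _; rewrite mulr_sumr; apply: eq_bigr => c _.
rewrite mul_mx_scalar -scalemxAl mxZE expr2 invfM !realCM; ring.
Qed.

(** With F the conjugate of [ep] and L = 1/n, the left side of [resolvent_ibp] is X = E |ep|^2
    itself. The right side is at most E (2 + 2 s2 |ep|), and 2 |ep| <= 1 + |ep|^2 turns this into X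
    <= s2 X + 2 + s2. *)
Lemma EW_ep : s2 <= 64^-1 -> EW (fun M => epJ M * ep M) <= 3.
Proof.
move=> hs2.
have gep : good ep by have [] := diff_ep.
have gepJ : good epJ by have [] := diff_epJ.
have gg : good (fun M => epJ M * ep M) by apply: goodM.
have reg M : re (epJ M * ep M) = cabs (ep M) ^+ 2 by rewrite mulrC mul_conj.
set X := EW _.
have := resolvent_ibp (N^-1%:C%:M) diff_epJ.
set T1 := (X in _ = X - _); set T2 := (X in _ = _ - X) => ibp.
have {}ibp : X = T1 - T2.
  rewrite -ibp; apply: (EW_ext gueW) => M hM; congr (re (_ * _)).
  by rewrite mul_scalar_mx mxtraceZ raddfB /= mulrBr.
have N0 := N_gt0; have s20 := s2_gt0.
have gB (a b : R) : good (fun M => a%:C * (epJ M * ep M) + b%:C * 1).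
  by apply: goodD; apply: good_scale => //; exact: good_cst.
have EB (a b : R) : EW (fun M => a%:C * (epJ M * ep M) + b%:C * 1) = a * X + b.
  by rewrite (EW_lin2 n0 gueW _ _ gg (good_cst n 1)) EW_cst /= mulr1.
have gG : mgood GG by move=> i j; have [] := mdiff_GG i j.
have gR : mgood RR by move=> i j; have [] := mdiff_RR i j.
have gL : mgood (fun _ : M_ => N^-1%:C%:M) by move=> i j; exact: good_cst.
have gtr (Q : M_ -> M_) : mgood Q -> good (fun M => \tr (Q M)).
  by move=> gQ; apply: good_sum => i _; exact: gQ.
have b1 : T1 <= s2 / 2 * X + s2 / 2.
  rewrite -EB; apply: EW_le => //.
    apply: good_scale; apply: goodM => //; apply: gtr.
    exact: mgoodM (mgoodM (mgoodM (mgoodM (mgoodM gL gR) gR) gG) gG) gG.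
  move=> M hM; rewrite reD !reZ reg /= mulr1.
  have -> : \tr (N^-1%:C%:M *m RR M *m RR M *m GG M *m GG M *m GG M) = N^-1%:C * \tr (RR M *m RR M *m GG M *m GG M *m GG M).
    by move: (GG M) (RR M) => Y Z; rewrite -!mulmxA mul_scalar_mx mxtraceZ.
  have := first_term hM; set Tr := \tr _ => h.
  apply: le_trans (_ : t ^+ 2 / N ^+ 2 * (N^-1 * (cabs (ep M) * cabs Tr)) <= _).
    apply: ler_wpM2l; first by rewrite divr_ge0 ?exprn_ge0// ltW.
    apply: le_trans (ler_norm _) _; apply: le_trans (re_le_cabs _) _.
    rewrite /epJ !cabsM cabsJ cabs_real ger0_norm; last by rewrite invr_ge0 ltW.
    by rewrite [leLHS]mulrCA.
  have -> : t ^+ 2 / N ^+ 2 * (N^-1 * (cabs (ep M) * cabs Tr)) = cabs (ep M) * ((t / N) ^+ 2 / N * cabs Tr).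
    by rewrite expr_div_n; ring.
  apply: le_trans (_ : cabs (ep M) * s2 <= _); first by rewrite ler_wpM2l// cabs_ge0.
  have : 0 <= s2 * (cabs (ep M) - 1) ^+ 2 by rewrite mulr_ge0 ?sqr_ge0// ltW.
  by rewrite sqrrB; nra.
have b2 : - T2 <= s2 / 2 * X + (2 + s2 / 2).
  rewrite -EB -mulN1r -EW_Z//; last first.
    apply: good_scale; apply: good_sum => b _; apply: good_sum => c _; apply: goodM.
      by have [_ h _ _] := diff_epJ; exact: h.
    by apply: mgoodM => //; apply: mgoodM.
  apply: EW_le => //.
    do 2 apply: good_scale; apply: good_sum => b _; apply: good_sum => c _; apply: goodM.
      by have [_ h _ _] := diff_epJ; exact: h.
    by apply: mgoodM => //; apply: mgoodM.
  move=> M hM; rewrite reD !reZ reg /= mulr1 S1_eq.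
  have h2 := second_term hM; set Tr := \tr (_ *m (GG M *m RR M)) in h2 *.
  set k := (1 - _)^*%R.
  have hk : cabs k <= 2 + s2 * cabs (ep M).
    rewrite cabsJ; apply: le_trans (cabsB _ _) _; rewrite cabs1 cabsM cabs_real.
    have -> : 2 + s2 * cabs (ep M) = 1 + (1 + s2 * cabs (ep M)) by ring.
    have tN : 0 <= t / N by rewrite divr_ge0// ltW.
    rewrite lerD2l ger0_norm//; apply: le_trans (hs2_RR hM).
    by rewrite ler_wpM2l// cabs_trRR.
  have -> : -1 * (sg / N * re (- (sg / N ^+ 2)%:C * k * Tr)) = re ((t / N ^+ 3)%:C * (k * Tr)).
    have -> : - (sg / N ^+ 2)%:C * k * Tr = (- (sg / N ^+ 2))%:C * (k * Tr) by rewrite realCN; ring.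
    rewrite !reZ -[t]sg_sqr; move: (re (k * Tr)) => x; field.
    by rewrite gt_eqF.
  apply: le_trans (ler_norm _) _; apply: le_trans (re_le_cabs _) _.
  rewrite !cabsM cabs_real ger0_norm; last by rewrite divr_ge0 ?exprn_ge0// ltW.
  apply: le_trans (_ : cabs k * 1 <= _).
    by rewrite mulrCA ler_wpM2l// cabs_ge0.
  rewrite mulr1; apply: le_trans hk _.
  have : 0 <= s2 * (cabs (ep M) - 1) ^+ 2 by rewrite mulr_ge0 ?sqr_ge0// ltW.
  by rewrite sqrrB; nra.
have X0 : 0 <= X.
  have -> : 0 = EW (fun=> 0) by rewrite EW_cst.
  by apply: EW_le => // [|M hM]; [exact: good_cst|rewrite reg sqr_ge0].
nra.
Qed.

Variable u : 'cV[R[i]]_n.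
Hypothesis u1 : hs2 u = 1.
Hypothesis uA : A *m u = E%:C *: u.

(** The number u* Q u, written as a trace so that [resolvent_ibp] applies with L a multiple of u
    u*. *)
Definition qf (Q : M_) : R[i] := \tr (u *m u^t* *m Q).

Lemma qf_opb Q c : opb Q c -> cabs (qf Q) <= c.
Proof.
move=> [c0 h]; rewrite /qf -mulmxA mxtrace_mulC -[c]mulr1.
have -> : u^t* *m Q *m u = u^t* *m (Q *m u) by rewrite mulmxA.
rewrite mxtrace_mulC.
apply: tr_CS_bound => //; last by rewrite hs2_trC u1.
by have := h _ u; rewrite u1.
Qed.

Let iN : R[i] := N^-1%:C * 'i.

Lemma re_iN x : re (iN * x) = - (N^-1 * im x).
Proof. by rewrite /iN -mulrA reZ reM re_i im_i mul0r sub0r mul1r mulrN. Qed.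

Lemma cabs_iN : cabs iN = N^-1.
Proof.
rewrite /iN cabsM cabs_real ger0_norm ?ltW ?Ninv_gt0//.
by rewrite [cabs 'i]cabs_def re_i im_i expr0n expr1n add0r sqrtr1 mulr1.
Qed.

(** With F = 1 only the term in t^2 / n^2 survives. Its five resolvents have norm at most n, and
    with the factor 1/n of [iN] the total is t^2 n^2. *)
Lemma diag_ibp : EW (fun M => iN * qf (GG M - RR M)) <= s2 ^+ 2.
Proof.
have gG : mgood GG by move=> i j; have [] := mdiff_GG i j.
have gR : mgood RR by move=> i j; have [] := mdiff_RR i j.
have gtr (Q : M_ -> M_) : mgood Q -> good (fun M => \tr (Q M)).
  by move=> gQ; apply: good_sum => i _; exact: gQ.
pose L := iN *: (u *m u^t*).
have gL : mgood (fun _ : M_ => L) by move=> i j; exact: good_cst.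
have trL X : \tr (L *m X) = iN * qf X by rewrite /L -scalemxAl mxtraceZ.
have := resolvent_ibp L (diff_cst n 1).
set T1 := (X in _ = X - _); set T2 := (X in _ = _ - X) => ibp.
have T20 : T2 = 0.
  have -> : T2 = EW (fun=> 0); last by rewrite EW_cst.
  apply: (EW_ext gueW) => M hM; congr re; rewrite big1 ?mulr0// => b _.
  by rewrite big1// => c _; rewrite mul0r.
have -> : EW (fun M => iN * qf (GG M - RR M)) = T1.
  rewrite -[T1]subr0 -{1}T20 -ibp; apply: (EW_ext gueW) => M hM.
  by rewrite mul1r trL.
have N0 := N_gt0.
have -> : s2 ^+ 2 = EW (fun=> (s2 ^+ 2)%:C) by rewrite EW_cst.
apply: EW_le => //.
- apply: good_scale; apply: goodM; first exact: good_cst.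
  apply: gtr; exact: mgoodM (mgoodM (mgoodM (mgoodM (mgoodM gL gR) gR) gG) gG) gG.
- exact: good_cst.
move=> M hM; rewrite reZ mul1r /=.
have o := opbM (opbM (opbM (opbM (opb_RRN hM) (opb_RRN hM)) (opb_GG hM)) (opb_GG hM)) (opb_GG hM).
have := qf_opb o; have -> : \tr (L *m RR M *m RR M *m GG M *m GG M *m GG M) = iN * qf (RR M *m RR M *m GG M *m GG M *m GG M).
  by rewrite -trL; move: (GG M) (RR M) => X Y; rewrite !mulmxA.
set q := qf _ => hq.
apply: le_trans (_ : t ^+ 2 / N ^+ 2 * (N^-1 * (N * N * N * N * N)) <= _); last first.
  by rewrite /s2 le_eqVlt; apply/orP; left; apply/eqP; field; rewrite gt_eqF.
apply: ler_wpM2l; first by rewrite divr_ge0 ?exprn_ge0// ltW.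
apply: le_trans (ler_norm _) _; apply: le_trans (re_le_cabs _) _.
by rewrite cabsM cabs_iN ler_wpM2l// invr_ge0 ltW.
Qed.

Lemma qf_RR M : herm M -> qf (RR M) = (E%:C - ww M)^-1.
Proof.
move=> hM; have w0 := im_ww_gt0 hM.
have lw : E%:C != ww M by apply/eqP => h; move: w0; rewrite -h /= ltxx.
have h := res_eigen hA (im_ww_neq0 hM) uA lw.
rewrite /qf -mulmxA mxtrace_mulC -mulmxA [RR M *m u]h -scalemxAr mxtraceZ tr_hs2 u1.
by rewrite mulr1.
Qed.

(** With zeta = - i s2 m, whose real part is nonnegative, [qf (RR M)] / n is i / (1 + zeta). The
    quantity is thus Re (zeta / (1 + zeta)) <= |zeta|. The proof uses zeta = b - i a and D = |1 +
    zeta|^2. *)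
Lemma local_RR M : herm M -> 1 - N^-1 * im (qf (RR M)) <= 1 /\
   1 - N^-1 * im (qf (RR M)) <= s2 * cabs (mm M).
Proof.
move=> hM; rewrite qf_RR// imV.
have N0 := N_gt0; have y0 := im_mm hM; have s20 := s2_gt0.
have -> : re (E%:C - ww M) = - (t * re (mm M)) by rewrite /ww /zz reB reD reZ /=; ring.
have -> : im (E%:C - ww M) = - (N^-1 * (1 + s2 * im (mm M))).
  by rewrite imB im_ww /= /s2; field; rewrite gt_eqF.
pose a := s2 * re (mm M); pose b := s2 * im (mm M).
have b0 : 0 <= b by rewrite mulr_ge0// ltW.
pose D := (1 + b) ^+ 2 + a ^+ 2.
have D1 : 1 <= D by rewrite /D; have := sqr_ge0 a; nra.
have D0 : 0 < D by rewrite (lt_le_trans ltr01).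
have -> : N^-1 * - (- (N^-1 * (1 + s2 * im (mm M))) / ((- (t * re (mm M))) ^+ 2 + (- (N^-1 * (1 + s2 * im (mm M)))) ^+ 2)) = (1 + b) / D.
  have e : (- (t * re (mm M))) ^+ 2 + (- (N^-1 * (1 + s2 * im (mm M)))) ^+ 2 = N^-1 ^+ 2 * D.
    by rewrite /D /a /b /s2; field; rewrite gt_eqF.
  by rewrite e /b; field; rewrite !gt_eqF.
have h1 : 1 - (1 + b) / D = (b * (1 + b) + a ^+ 2) / D.
  by rewrite /D; field; rewrite gt_eqF.
have q0 : 0 <= (1 + b) / D.
  by apply: divr_ge0; [rewrite addr_ge0|exact: ltW].
split; first lra.
rewrite h1 ler_pdivrMr//.
have c2 : (s2 * cabs (mm M)) ^+ 2 = a ^+ 2 + b ^+ 2.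
  by rewrite exprMn cabs_sqr /a /b; ring.
have c0 : 0 <= s2 * cabs (mm M) by rewrite mulr_ge0 ?cabs_ge0// ltW.
move: c2 c0; move: (s2 * cabs (mm M)) => x c2 c0.
have p1 : b * (1 + b) + a ^+ 2 \is Num.nneg.
  by rewrite nnegrE; have := sqr_ge0 a; nra.
have p2 : x * D \is Num.nneg by rewrite nnegrE mulr_ge0// ltW.
rewrite -(ler_sqr p1 p2).
apply: le_trans (_ : x ^+ 2 * D <= _).
  rewrite c2 /D; have := sqr_ge0 (b * a - (1 + b) * a).
  have -> : (b * (1 + b) + a ^+ 2) ^+ 2 = (a ^+ 2 + b ^+ 2) * ((1 + b) ^+ 2 + a ^+ 2) - (b * a - (1 + b) * a) ^+ 2 by ring.
  lra.
rewrite exprMn; apply: ler_wpM2l; first exact: sqr_ge0.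
by rewrite expr2 ler_peMl// ltW.
Qed.

(** The resolvent identity gives rr - m0 = (t m / n) tr (R R0), with R0 and m0 taken at [zz]. By
    Cauchy-Schwarz |rr - m0|^2 is at most |m|^2 times (t/n) hs2 R <= 2 times (t/n) hs2 R0 <= s. As s
    <= 1/8 this is at most |m|^2 / 4, so half of |m| can be moved to the left in |m| <= |m0| + |rr -
    m0| + |ep|. *)
Lemma local_stability (s : R) M : herm M -> 0 < s -> s <= 8^-1 -> s ^+ 2 = s2 ->
  cabs (N^-1%:C * \tr (res A zz)) <= s^-1 ->
  s2 * cabs (ep M) <= 1 -> s2 * cabs (mm M) <= 2 * s + 2 * s2 * cabs (ep M).
Proof.
move=> hM s0 s8 ss hm0 he.
have N0 := N_gt0; have s20 := s2_gt0.
set m0 := N^-1%:C * _ in hm0.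
have hR := hs2_RR hM.
have W0 := res_ward hA im_zz_neq0.
have h0 : t / N * hs2 (res A zz) <= s.
  have e : hs2 (res A zz) = N ^+ 2 * im m0.
    rewrite /m0 imZ -W0 /=; field; by rewrite gt_eqF.
  have -> : t / N * hs2 (res A zz) = s2 * im m0 by rewrite e /s2; field; rewrite gt_eqF.
  apply: le_trans (_ : s2 * s^-1 <= _); last by rewrite -ss expr2 mulfK ?gt_eqF.
  apply: ler_wpM2l; first exact: ltW.
  apply: le_trans hm0; apply: le_trans (im_le_cabs _); exact: ler_norm.
have idr : rr M - m0 = N^-1%:C * (t%:C * mm M) * \tr (RR M *m res A zz).
  have uw := res_unit hA (im_ww_neq0 hM); have uz := res_unit hA im_zz_neq0.
  have h := invmx_sub uw uz.
  have e : (A - zz%:M) - (A - (ww M)%:M) = (t%:C * mm M)%:M.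
    by apply/matrixP => i j; rewrite !mxE /ww; case: (i == j); rewrite ?mulr1n ?mulr0n; ring.
  rewrite /rr /m0 -mulrBr -raddfB /= [RR M - _]h e mul_mx_scalar -scalemxAl mxtraceZ.
  by rewrite mulrA.
have d2 : cabs (rr M - m0) ^+ 2 <= (cabs (mm M) / 2) ^+ 2.
  rewrite idr; have hcs := tr_CS (RR M) (res A zz).
  move: (mm M) (\tr _) hcs => y q hcs.
  rewrite !cabsM !cabs_real !ger0_norm ?invr_ge0 ?(ltW N0) ?(ltW t0)//.
  set r := cabs q in hcs *; set x := cabs y.
  have -> : (N^-1 * (t * x) * r) ^+ 2 = x ^+ 2 * ((t / N) ^+ 2 * r ^+ 2) by ring.
  have -> : (x / 2) ^+ 2 = x ^+ 2 * 4^-1 by field.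
  apply: ler_wpM2l; first exact: sqr_ge0.
  apply: le_trans (_ : (t / N) ^+ 2 * (hs2 (RR M) * hs2 (res A zz)) <= _).
    by apply: ler_wpM2l => //; exact: sqr_ge0.
  have -> : (t / N) ^+ 2 * (hs2 (RR M) * hs2 (res A zz)) = (t / N * hs2 (RR M)) * (t / N * hs2 (res A zz)) by ring.
  apply: le_trans (_ : 2 * s <= _); last lra.
  apply: ler_pM => //; try by rewrite mulr_ge0 ?hs2_ge0// divr_ge0// ltW.
  by apply: le_trans hR _; lra.
have d1 : cabs (rr M - m0) <= cabs (mm M) / 2.
  by rewrite -ler_sqr ?nnegrE ?cabs_ge0 ?divr_ge0 ?cabs_ge0.
have tri : cabs (mm M) <= s^-1 + cabs (mm M) / 2 + cabs (ep M).
  have -> : mm M = m0 + (rr M - m0) + ep M by rewrite /ep; ring.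
  apply: le_trans (cabsD _ _) _; rewrite lerD2r.
  apply: le_trans (cabsD _ _) _.
  have -> : m0 + (rr M - m0) + ep M = mm M by rewrite /ep; ring.
  exact: lerD.
have : s2 * cabs (mm M) <= s2 * (2 * s^-1 + 2 * cabs (ep M)).
  by apply: ler_wpM2l; [exact: ltW|lra].
move=> /le_trans; apply.
have -> : s2 * (2 * s^-1 + 2 * cabs (ep M)) = 2 * (s ^+ 2 * s^-1) + 2 * s2 * cabs (ep M).
  by rewrite ss; ring.
by rewrite expr2 mulfK ?gt_eqF//; lra.
Qed.

Lemma EW_local (s : R) : 0 < s -> s <= 8^-1 -> s ^+ 2 = s2 ->
  cabs (N^-1%:C * \tr (res A zz)) <= s^-1 ->
  EW (fun M => 1 + iN * qf (GG M)) <= 3 * s.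
Proof.
move=> s0 s8 ss hm0.
have N0 := N_gt0; have s20 := s2_gt0.
have gG : mgood GG by move=> i j; have [] := mdiff_GG i j.
have gR : mgood RR by move=> i j; have [] := mdiff_RR i j.
have gep : good ep by have [] := diff_ep.
have gepJ : good epJ by have [] := diff_epJ.
have gg : good (fun M => epJ M * ep M) by apply: goodM.
have gqf (Q : M_ -> M_) : mgood Q -> good (fun M => qf (Q M)).
  move=> gQ; apply: good_sum => i _; apply: (mgoodM _ gQ) => a b; exact: good_cst.
have gsub : mgood (fun M => GG M - RR M).
  move=> i j; apply: good_ext (goodD (gG i j) (goodM (good_cst n (-1)) (gR i j))) => M _.
  by rewrite mxDE mxNE mulN1r.
have g1 : good (fun M => iN * qf (GG M - RR M)) by apply: goodM; [exact: good_cst|exact: gqf].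
have g2 : good (fun M => 1 + iN * qf (RR M)).
  by apply: goodD; [exact: good_cst|apply: goodM; [exact: good_cst|exact: gqf]].
have -> : EW (fun M => 1 + iN * qf (GG M)) = EW (fun M => iN * qf (GG M - RR M)) + EW (fun M => 1 + iN * qf (RR M)).
  rewrite -EW_D//; apply: (EW_ext gueW) => M hM; congr re.
  rewrite /qf mulmxBr raddfB /=; ring.
have s64 : s2 <= 64^-1 by rewrite -ss; nra.
have hE := EW_ep s64.
have b2 : EW (fun M => 1 + iN * qf (RR M)) <= s2 * EW (fun M => epJ M * ep M) + (2 * s + s2).
  have -> : s2 * EW (fun M => epJ M * ep M) + (2 * s + s2) = EW (fun M => s2%:C * (epJ M * ep M) + (2 * s + s2)%:C * 1).
    by rewrite (EW_lin2 n0 gueW _ _ gg (good_cst n 1)) EW_cst /= mulr1.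
  apply: (EW_le n0 gueW g2) => [|M hM].
    by apply: goodD; apply: good_scale => //; exact: good_cst.
  rewrite reD re_iN reD !reZ /= mulr1.
  have -> : re (epJ M * ep M) = cabs (ep M) ^+ 2 by rewrite mulrC mul_conj.
  have [l1 l2] := local_RR hM.
  have : 0 <= s2 * (cabs (ep M) - 1) ^+ 2 by rewrite mulr_ge0 ?sqr_ge0// ltW.
  have e0 := cabs_ge0 (ep M).
  have [h|h] := leP (s2 * cabs (ep M)) 1.
    have := local_stability hM s0 s8 ss hm0 h.
    by rewrite sqrrB; nra.
  by rewrite sqrrB; nra.
have := diag_ibp.
move: b2 hE; move: (EW _) (EW _) (EW _) => x y w b2 hE b1.
rewrite -ss in b1 b2; nra.
Qed.

End selfcons.

(** * Trace moments and the norm of the GUE *)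

Section powers.
Variables (R : realType) (n : nat).
Local Notation M_ := 'M[R[i]]_n.
Implicit Types M : M_.

Definition mxpow k M : M_ := iter k (mulmx M) 1%:M.

Lemma mxpowD a b M : mxpow (a + b) M = mxpow a M *m mxpow b M.
Proof. by elim: a => [|a IH]; rewrite ?mul1mx//= -mulmxA -IH. Qed.

Lemma mxpow1 M : mxpow 1 M = M. Proof. by rewrite /mxpow /= mulmx1. Qed.

Lemma herm_mxpow k M : herm M -> herm (mxpow k M).
Proof.
move=> hM; elim: k => [|k IH]; first by rewrite /herm trmx1 map_mx1.
rewrite /herm -[in LHS](add1n k) mxpowD mulmx_trC IH mxpow1 hM.
by rewrite -[X in _ *m X]mxpow1 -mxpowD addn1.
Qed.

Lemma hs2_mulmx p q r (Q : 'M[R[i]]_(p, q)) (X : 'M[R[i]]_(q, r)) :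
  hs2 (Q *m X) <= hs2 Q * hs2 X.
Proof.
rewrite [hs2 X]/hs2 exchange_big mulr_suml; apply: ler_sum => i _.
rewrite mulr_sumr; apply: ler_sum => j _.
have := tr_CS (row i Q) (col j X).
have -> : \tr (row i Q *m col j X) = (Q *m X) i j.
  by rewrite /mxtrace big_ord1 !mxE; apply: eq_bigr => k _; rewrite !mxE.
have -> : hs2 (row i Q) = \sum_k cabs (Q i k) ^+ 2.
  by rewrite /hs2 big_ord1; apply: eq_bigr => k _; rewrite mxE.
have -> // : hs2 (col j X) = \sum_k cabs (X k j) ^+ 2.
by apply: eq_bigr => k _; rewrite big_ord1 mxE.
Qed.

Lemma hs2_mxpow k M : herm M -> (hs2 (mxpow k M))%:C = \tr (mxpow (k + k) M).
Proof. by move=> hM; rewrite -tr_hs2 herm_mxpow// mxpowD. Qed.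

(** By Cauchy-Schwarz c_j = hs2 (M^j x) is log-convex, so its successive ratios, at least r at the
    start, remain so. Then r^k hs2 x <= hs2 (M^k x) <= hs2 (M^k) hs2 x, and hs2 (M^k) = tr
    M^(2k). *)
Lemma norm_or_trace M k (x : 'cV[R[i]]_n) (r : R) : herm M -> 0 < r ->
  r * hs2 x < hs2 (M *m x) -> r ^+ k <= re (\tr (mxpow (k + k) M)).
Proof.
move=> hM r0 hx; pose c j := hs2 (mxpow j M *m x).
have cconv j : c j.+1 ^+ 2 <= c j * c j.+2.
  have := tr_CS ((mxpow j M *m x)^t*) (mxpow j.+2 M *m x).
  rewrite hs2_trC; suff -> : \tr ((mxpow j M *m x)^t* *m (mxpow j.+2 M *m x)) = (c j.+1)%:C.
    by rewrite cabs_real ger0_norm ?hs2_ge0.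
  have hmp l : (mxpow l M *m x)^t* = x^t* *m mxpow l M by rewrite mulmx_trC herm_mxpow.
  rewrite /c -tr_hs2 !hmp; congr (\tr _).
  have e : mxpow j M *m mxpow j.+2 M = mxpow j.+1 M *m mxpow j.+1 M by rewrite -!mxpowD addSnnS.
  move: e; move: (mxpow j M) (mxpow j.+1 M) (mxpow j.+2 M) => X Y Z e.
  by rewrite -2!mulmxA (mulmxA X) e !mulmxA.
have c0 : c 0%N = hs2 x by rewrite /c mul1mx.
have c1 : c 1%N = hs2 (M *m x) by rewrite /c mxpow1.
have x0 : 0 < hs2 x.
  rewrite lt_def hs2_ge0 andbT; apply/eqP => h; move: hx.
  have hz p : hs2 (0 : 'M[R[i]]_(p, 1)) = 0.
    by rewrite /hs2 big1// => i _; rewrite big1// => l _; rewrite mxE cabs0 expr0n.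
  by rewrite (hs2_eq0 h) mulmx0 !hz mulr0 ltxx.
have step j : 0 < c j /\ r * c j <= c j.+1.
  elim: j => [|j [cj hj]]; first by rewrite c0 c1; split => //; exact: ltW.
  have cj1 : 0 < c j.+1 by apply: lt_le_trans hj; rewrite mulr_gt0.
  split; first exact: cj1.
  rewrite -(ler_pM2l cj) mulrCA; apply: le_trans (cconv j).
  by rewrite expr2 mulrA ler_pM2r.
have ck : r ^+ k * hs2 x <= c k.
  elim: k => [|k IH]; first by rewrite mul1r c0.
  by rewrite exprS -mulrA; apply: le_trans (step k).2; rewrite ler_pM2l.
have h : (re (\tr (mxpow (k + k) M))) = hs2 (mxpow k M) by rewrite -hs2_mxpow.
by rewrite h -(ler_pM2r x0); apply: le_trans ck _; exact: hs2_mulmx.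
Qed.

Lemma tr_mxpow_ge0 M k : herm M -> 0 <= re (\tr (mxpow (k + k) M)).
Proof. by move=> hM; rewrite -hs2_mxpow//= hs2_ge0. Qed.

Definition Dmxpow k M V : M_ := \sum_(j < k) mxpow j M *m V *m mxpow (k.-1 - j) M.

Lemma mdiff_mxpow k : mdiff (mxpow k) (Dmxpow k).
Proof.
elim: k => [|k IH].
  by apply: mdiff_ext (mdiff_cst 1%:M) => // M V _; rewrite /Dmxpow big_ord0.
apply: mdiff_ext (mdiffM (@mdiff_id R n) IH) => // M V _.
rewrite /Dmxpow big_ord_recl /= mul1mx subn0; congr (_ + _).
rewrite mulmx_sumr; apply: eq_bigr => j _; rewrite !mulmxA.
by congr (_ *m mxpow _ M); case: k {IH} j => [[]//|k] j; rewrite /bump leq0n add1n subSS.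
Qed.

Lemma mgood_mxpow k : mgood (mxpow k).
Proof. by move=> i j; have [] := mdiff_mxpow k i j. Qed.

Let N : R := n%:R.

Definition moment k M : R[i] := N^-1%:C * \tr (mxpow k M).
Definition Dmoment k M V : R[i] := N^-1%:C * \tr (Dmxpow k M V).

Lemma diff_moment k : diff (moment k) (Dmoment k).
Proof. by apply: diffZ; apply: diff_trace; exact: mdiff_mxpow. Qed.

Lemma good_moment k : good (moment k). Proof. by have [] := diff_moment k. Qed.

Lemma Dmoment_delta k M b c : Dmoment k M (delta_mx c b) = N^-1%:C * (k%:R * mxpow k.-1 M b c).
Proof.
rewrite /Dmoment; congr (_ * _); rewrite /Dmxpow raddf_sum /=.
under eq_bigr => j _.
  rewrite -mulmxA mxtrace_mulC -mulmxA.
  have -> : mxpow (k.-1 - j) M *m mxpow j M = mxpow k.-1 M.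
    by rewrite -mxpowD subnK//; case: k j => [[]//|k] j; rewrite -ltnS.
  rewrite mxtrace_mulC tr_delta.
  over.
by rewrite sumr_const card_ord mulr_natl.
Qed.

Lemma sum_Dmoment_mxpow x k M :
  \sum_b \sum_c Dmoment x M (delta_mx c b) * mxpow k M c b = x%:R * moment (x.-1 + k) M.
Proof.
rewrite /moment mxpowD -sum_mul_tr !mulr_sumr; apply: eq_bigr => b _.
by rewrite !mulr_sumr; apply: eq_bigr => c _; rewrite Dmoment_delta; ring.
Qed.

Definition moments (s : seq nat) M : R[i] := \prod_(k <- s) moment k M.

Lemma good_moments s : good (moments s).
Proof. by apply: good_prod => k; exact: good_moment. Qed.

(* The terms (k_j, [:: k_1; ...; k_j - 1 + k; ...; k_r]) produced when a derivative
   hits the factor tr M^(k_j) of a product of traces and is paired with M^k. *)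
Fixpoint contractions (s : seq nat) (k : nat) : seq (nat * seq nat) :=
  if s is x :: s' then
    (x, (x.-1 + k)%N :: s') :: [seq (cq.1, x :: cq.2) | cq <- contractions s' k]
  else [::].

Lemma diff_moments s : exists2 D, diff (moments s) D & forall k M,
  \sum_b \sum_c D M (delta_mx c b) * mxpow k M c b =
  \sum_(cq <- contractions s k) cq.1%:R * moments cq.2 M.
Proof.
elim: s => [|x s [D dD hD]].
  exists (fun _ _ => 0) => [|k M].
    by apply: diff_ext (diff_cst n 1) => // M _; rewrite /moments big_nil.
  by rewrite big_nil big1// => b _; rewrite big1// => c _; rewrite mul0r.
exists (fun M V => Dmoment x M V * moments s M + moment x M * D M V) => [|k M].
  by apply: diff_ext (diffM (diff_moment x) dD) => // M _; rewrite /moments big_cons.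
rewrite /= big_cons big_map /=.
under [X in _ = _ + X]eq_bigr do rewrite /moments big_cons mulrCA -/(moments _ _).
rewrite -mulr_sumr -hD {2}/moments big_cons -/(moments _ _) mulrA -sum_Dmoment_mxpow.
rewrite mulr_suml mulr_sumr -big_split; apply: eq_bigr => b _.
rewrite mulr_suml mulr_sumr -big_split; apply: eq_bigr => c _ /=; ring.
Qed.

Lemma sum_Dmxpow k M : (0 < n)%N ->
  \sum_b \sum_c Dmxpow k M (delta_mx c b) c b =
  (N ^+ 2)%:C * \sum_(j < k) moment j M * moment (k.-1 - j) M.
Proof.
move=> n0; rewrite mulr_sumr.
have N0 : N != 0 by rewrite pnatr_eq0 -lt0n.
transitivity (\sum_b \sum_c \sum_(j < k) (mxpow j M *m delta_mx c b *m mxpow (k.-1 - j) M) c b).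
  by apply: eq_bigr => b _; apply: eq_bigr => c _; rewrite summxE.
under eq_bigr do rewrite exchange_big.
rewrite exchange_big; apply: eq_bigr => j _.
rewrite sum_delta_sandwich /moment.
have -> : (N ^+ 2)%:C * (N^-1%:C * \tr (mxpow j M) * (N^-1%:C * \tr (mxpow (k.-1 - j) M))) =
  (N * N^-1 * (N * N^-1))%:C * (\tr (mxpow j M) * \tr (mxpow (k.-1 - j) M)).
  by rewrite expr2 !realCM; ring.
by rewrite divff// mul1r mul1r.
Qed.

End powers.

Section moment_recursion.
Variables (R : realType) (d : measure_display) (T : measurableType d).
Variables (P : probability T R) (n : nat) (W : T -> 'M[R[i]]_n).
Hypothesis n0 : (0 < n)%N.
Hypothesis gueW : gue P W.
Local Notation EW := (EW P W).
Let N : R := n%:R.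

(** The Schwinger-Dyson equation. One factor M of tr M^(k+1) is integrated by parts: a derivative
    hitting the same trace splits it in two, at order 1, and one hitting another trace merges the
    two, at order 1/n^2. *)
Lemma EW_moments k s : EW (moments (k.+1 :: s)) =
  \sum_(j < k) EW (moments [:: val j, (k.-1 - j)%N & s]) +
  N^-1 ^+ 2 * \sum_(cq <- contractions s k) cq.1%:R * EW (moments cq.2).
Proof.
have N0 : N != 0 by rewrite pnatr_eq0 -lt0n.
have [D dD hD] := @diff_moments R n s.
have ibp := EW_ibp n0 gueW (mdiffZ dD (@mdiff_mxpow R n k)).
have e1 : EW (moments (k.+1 :: s)) = N^-1 * EW (fun M => \tr (M *m (moments s M *: mxpow k M))).
  rewrite -EW_Z//.
    apply: (EW_ext gueW) => M _; congr re.
    by rewrite /moments big_cons -scalemxAr mxtraceZ /moment; ring.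
  apply: good_sum => i _; apply: mgoodM => [a b|a b]; first exact: good_entry.
  have h := goodM (@good_moments R n s) (@mgood_mxpow R n k a b).
  by apply: good_ext h => M _; rewrite mxZE.
have e2 : EW (fun M => \sum_(j < k) moments [:: val j, (k.-1 - j)%N & s] M +
    (N^-1 ^+ 2)%:C * \sum_(cq <- contractions s k) cq.1%:R%:C * moments cq.2 M) =
  \sum_(j < k) EW (moments [:: val j, (k.-1 - j)%N & s]) +
  N^-1 ^+ 2 * \sum_(cq <- contractions s k) cq.1%:R * EW (moments cq.2).
  have gc : good (fun M => \sum_(cq <- contractions s k) cq.1%:R%:C * @moments R n cq.2 M).
    by apply: good_sum => cq _; apply: good_scale; exact: good_moments.
  rewrite EW_D//; last exact: good_scale.
    rewrite EW_sum//; last by move=> j; exact: good_moments.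
    rewrite EW_Z// EW_sum//; last by move=> cq; apply: good_scale; exact: good_moments.
    congr (_ + _ * _); apply: eq_bigr => cq _; rewrite EW_Z//; exact: good_moments.
  by apply: good_sum => j _; exact: good_moments.
rewrite -e2 e1 ibp -EW_Z//; last first.
  apply: good_sum => b _; apply: good_sum => c _.
  by have [_ h _ _] := mdiffZ dD (@mdiff_mxpow R n k) c b; exact: h.
rewrite -EW_Z//; last first.
  apply: good_scale.
  apply: good_sum => b _; apply: good_sum => c _.
  by have [_ h _ _] := mdiffZ dD (@mdiff_mxpow R n k) c b; exact: h.
apply: (EW_ext gueW) => M _; congr re.
under eq_bigr do under eq_bigr do rewrite mxDE !mxZE.
under eq_bigr do rewrite big_split /= -mulr_sumr.
rewrite big_split /= -mulr_sumr hD sum_Dmxpow//.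
rewrite mulrA -realCM -expr2 mulrDr addrC; congr (_ + _); last first.
  by congr (_ * _); apply: eq_bigr => cq _; rewrite realC_nat.
have ab : (N^-1 ^+ 2)%:C * (N ^+ 2)%:C = 1 by rewrite -realCM -exprMn mulVf// expr1n.
transitivity (moments s M * (((N^-1 ^+ 2)%:C * (N ^+ 2)%:C) * \sum_(j < k) moment j M * moment (k.-1 - j) M)).
  by rewrite -/N; move: (moments s M) (\sum_j _) => x y; ring.
rewrite ab mul1r mulr_sumr.
by apply: eq_bigr => j _; rewrite /moments !big_cons mulrC mulrA.
Qed.

End moment_recursion.

(** * A Catalan-type majorant for mixed trace moments *)

Section majorant.
Variables (R : realType) (rho delta : R).

(* The recursion b_{k+1} = sum_{i+j = k-1} b_i b_j + delta rho^{k+1} of the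
   Catalan numbers, with an extra source term absorbing the 1/n^2 corrections. *)
Fixpoint betas (k : nat) : seq R :=
  if k is k'.+1 then
    rcons (betas k') (\sum_(j < k') (betas k')`_j * (betas k')`_(k'.-1 - j) + delta * rho ^+ k)
  else [:: 1].
Definition beta k := (betas k)`_k.

Lemma size_betas k : size (betas k) = k.+1.
Proof. by elim: k => //= k IH; rewrite size_rcons IH. Qed.

Lemma nth_betas k j : (j <= k)%N -> (betas k)`_j = beta j.
Proof.
elim: k => [|k IH]; first by rewrite leqn0 => /eqP->.
rewrite leq_eqVlt => /orP[/eqP->//|jk].
by rewrite /= nth_rcons size_betas jk IH.
Qed.

Lemma beta0 : beta 0 = 1. Proof. by []. Qed.

Lemma betaS k : beta k.+1 = \sum_(j < k) beta j * beta (k.-1 - j) + delta * rho ^+ k.+1.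
Proof.
rewrite /beta /= nth_rcons size_betas ltnn eqxx; congr (_ + _).
apply: eq_bigr => j _; rewrite !nth_betas// ?(ltnW (ltn_ord j))//.
by rewrite (leq_trans (leq_subr _ _))// leq_pred.
Qed.

Hypotheses (rho0 : 0 < rho) (delta0 : 0 < delta).

(** The source term alone. It allows a power of rho to be traded for a value of [beta] in
    [sum_contractions_le]. *)
Lemma beta_ge k : (0 < k)%N -> delta * rho ^+ k <= beta k.
Proof.
move=> k0; suff h j : 0 <= beta j /\ ((0 < j)%N -> delta * rho ^+ j <= beta j) by have [_] := h k; apply.
elim/ltn_ind: j => -[|j] IH; first by rewrite beta0 ler01.
rewrite betaS.
have s0 : 0 <= \sum_(i < j) beta i * beta (j.-1 - i).
  apply: sumr_ge0 => i _; apply: mulr_ge0.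
    by have [] := IH i (ltnW (ltn_ord i)).
  by have [|] := IH (j.-1 - i)%N => //; rewrite ltnS (leq_trans (leq_subr _ _))// leq_pred.
by split => [|_]; [rewrite addr_ge0// mulr_ge0 ?exprn_ge0// ltW|rewrite lerDr].
Qed.

Lemma beta_gt0 k : 0 < beta k.
Proof.
case: k => [|k]; first by rewrite beta0.
by apply: lt_le_trans (beta_ge _) => //; rewrite mulr_gt0// exprn_gt0.
Qed.

Lemma sum_triangle (f : nat -> nat -> R) m :
  \sum_(k < m) \sum_(j < k) f j (k.-1 - j)%N = \sum_(j < m) \sum_(l < m.-1 - j) f j l.
Proof.
elim: m => [|m IH]; first by rewrite !big_ord0.
rewrite big_ord_recr IH /= [in RHS]big_ord_recr /= subnn big_ord0 addr0 -big_split /=.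
apply: eq_bigr => j _; case: m {IH} j => [[]//|m] j /=.
by rewrite subSn -1?ltnS// big_ord_recr.
Qed.

Lemma sum_widen (g : nat -> R) a b : (forall k, 0 <= g k) -> (a <= b)%N ->
  \sum_(k < a) g k <= \sum_(k < b) g k.
Proof.
by move=> g0 ab; rewrite -(subnKC ab) big_split_ord /= lerDl sumr_ge0.
Qed.

(** The pairs (j, l) with j + l + 1 < m form part of the square of indices below m. *)
Lemma conv_le (g : nat -> R) m : (forall k, 0 <= g k) ->
  \sum_(k < m) \sum_(j < k) g j * g (k.-1 - j)%N <= (\sum_(k < m) g k) ^+ 2.
Proof.
move=> g0; rewrite (sum_triangle (fun i j => g i * g j)) expr2 mulr_suml.
apply: ler_sum => j _; rewrite -mulr_sumr ler_wpM2l// sum_widen//.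
by rewrite (leq_trans (leq_subr _ _))// leq_pred.
Qed.

(* The bound 2 reproduces itself because 1 + 2^2 / rho^2 + 1/4 <= 2 for rho = 5/2. *)
Lemma sum_beta_le K : rho = 5 / 2 -> delta * K%:R <= 4^-1 ->
  forall m, (m <= K)%N -> \sum_(k < m.+1) beta k / rho ^+ k <= 2.
Proof.
move=> rhoE dK; have rn0 k : rho ^+ k != 0 by rewrite expf_neq0// gt_eqF.
elim=> [|m IH] mK; first by rewrite big_ord1 beta0 expr0 divr1 ler1n.
rewrite big_ord_recl beta0 expr0 divr1 /=.
have -> : \sum_(i < m.+1) beta (bump 0 i) / rho ^+ bump 0 i =
   rho ^- 2 * (\sum_(k < m.+1) \sum_(j < k) (beta j / rho ^+ j) * (beta (k.-1 - j) / rho ^+ (k.-1 - j)))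
   + \sum_(i < m.+1) delta.
  rewrite mulr_sumr -big_split; apply: eq_bigr => k _ /=.
  rewrite /bump leq0n add1n betaS mulrDl mulfK//; congr (_ + _).
  rewrite mulr_suml mulr_sumr; apply: eq_bigr => j _.
  have jk := ltn_ord j; have -> : k.+1 = (2 + (j + (k.-1 - j)))%N by lia.
  by rewrite !exprD; field; rewrite !rn0 (rn0 1%N).
have g0 k : 0 <= beta k / rho ^+ k by rewrite divr_ge0 ?exprn_ge0// ltW// beta_gt0.
have h := conv_le m.+1 g0; have h2 := IH (ltnW mK).
have h3 : 0 <= \sum_(k < m.+1) beta k / rho ^+ k by rewrite sumr_ge0.
have h4 : \sum_(i < m.+1) delta <= 4^-1.
  rewrite sumr_const card_ord -[leLHS]mulr_natr; apply: le_trans dK.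
  by rewrite ler_pM2l// ler_nat.
move: h h2 h3 h4; set S := \sum_(k < m.+1) beta k / _; set S2 := \sum_(k < m.+1) \sum_(j < k) _.
set S3 := \sum_(i < _) delta => h h2 h3 h4.
have -> : rho ^- 2 = 4 / 25 by rewrite rhoE; field.
nra.
Qed.

Lemma beta_le K : rho = 5 / 2 -> delta * K%:R <= 4^-1 ->
  forall k, (k <= K)%N -> beta k <= 2 * rho ^+ k.
Proof.
move=> rhoE dK k kK; rewrite -ler_pdivrMr ?exprn_gt0//.
apply: le_trans (sum_beta_le rhoE dK kK); rewrite big_ord_recr /= lerDr.
by apply: sumr_ge0 => j _; rewrite divr_ge0 ?exprn_ge0// ltW// beta_gt0.
Qed.

(** A contraction replaces beta x by beta (x - 1 + k) <= 2 rho^(x-1+k). Multiplied by delta rho this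
    is 2 rho^k times delta rho^x, and delta rho^x <= beta x restores the missing factor. The weights
    x add up to [sumn s]. *)
Lemma sum_contractions_le K k s : rho = 5 / 2 -> delta * K%:R <= 4^-1 ->
  (sumn s + k <= K)%N ->
  delta * rho * \sum_(cq <- contractions s k) cq.1%:R * (\prod_(l <- cq.2) beta l) <=
  2 * rho ^+ k * (sumn s)%:R * \prod_(l <- s) beta l.
Proof.
move=> rhoE dK; elim: s => [|x s IH] /= sK; first by rewrite !big_nil mulr0 mulr0 mul0r.
have p0 : 0 <= \prod_(l <- s) beta l by apply: prodr_ge0 => l _; rewrite ltW// beta_gt0.
rewrite !big_cons big_map /=.
under [X in _ + X]eq_bigr do rewrite big_cons mulrCA.
rewrite -mulr_sumr natrD mulrDr mulrDr mulrDl; apply: lerD; last first.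
  rewrite mulrCA; have -> : forall a b c d : R, a * b * (c * d) = c * (a * b * d) by move=> *; ring.
  rewrite ler_pM2l ?beta_gt0//; apply: IH; apply: leq_trans sK.
  by rewrite leq_add2r leq_addl.
case: x sK => [|x] sK; first by rewrite !mul0r !mulr0 !mul0r.
rewrite /=.
set p := \prod_(l <- s) _ in p0 *.
have h1 := beta_ge (ltn0Sn x).
have h2 : beta (x + k) <= 2 * rho ^+ (x + k) by apply: (beta_le rhoE dK); lia.
have -> : delta * rho * (x.+1%:R * (beta (x + k) * p)) = x.+1%:R * p * (delta * rho * beta (x + k)) by ring.
have -> : 2 * rho ^+ k * x.+1%:R * (beta x.+1 * p) = x.+1%:R * p * (2 * rho ^+ k * beta x.+1) by ring.
apply: ler_wpM2l; first by rewrite mulr_ge0.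
apply: le_trans (_ : delta * rho * (2 * rho ^+ (x + k)) <= _).
  by apply: ler_wpM2l => //; rewrite mulr_ge0// ltW.
have -> : delta * rho * (2 * rho ^+ (x + k)) = 2 * rho ^+ k * (delta * rho ^+ x.+1) by rewrite exprD exprS; ring.
by apply: ler_wpM2l => //; rewrite mulr_ge0// exprn_ge0// ltW.
Qed.

End majorant.

Section moment_bound.
Variables (R : realType) (d : measure_display) (T : measurableType d).
Variables (P : probability T R) (n : nat) (W : T -> 'M[R[i]]_n).
Hypothesis n0 : (0 < n)%N.
Hypothesis gueW : gue P W.
Local Notation EW := (EW P W).
Let N : R := n%:R.

Lemma sumn_contractions k s cq : cq \in contractions s k -> (0 < cq.1)%N ->
  sumn cq.2 = ((sumn s).-1 + k)%N /\ (0 < sumn s)%N.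
Proof.
elim: s cq => //= x s IH cq; rewrite inE => /orP[/eqP->/= x0|/mapP[[c q] /IH/= h ->/= c0]].
  by split; lia.
by have [-> s0] := h c0; split; lia.
Qed.

(** The splitting term of the Schwinger-Dyson equation matches the Catalan part of [betaS], and the
    merging term must fit into the source delta rho^(k+1). That requires 2 K / n^2 <= delta^2 rho^2;
    with delta = 1/(4K), the largest value allowed by delta K <= 1/4, it reads n^2 >= (128/25)
    K^3. *)
Lemma EW_moments_le K s : (0 < K)%N -> 6 * K%:R ^+ 3 <= N ^+ 2 -> (sumn s <= K)%N ->
  EW (moments s) <= \prod_(l <- s) beta (5 / 2) (4 * K%:R)^-1 l.
Proof.
move=> K0 KN; set rho : R := 5 / 2; set delta := (4 * _)^-1.
have N0 : 0 < N by rewrite ltr0n.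
have K0' : 0 < K%:R :> R by rewrite ltr0n.
have rho0 : 0 < rho by rewrite divr_gt0.
have delta0 : 0 < delta by rewrite invr_gt0 mulr_gt0.
have dK : delta * K%:R <= 4^-1 by rewrite /delta invfM mulfVK// gt_eqF.
(* Induction on the sum of the indices, then on their number: both terms of the recursion lower the
   sum, while removing an index 0 only shortens the list. *)
have [m] := ubnP (sumn s); elim: m s => // m IHm s.
have [r] := ubnP (size s); elim: r s => // r IHr s.
case: s => [|[|k] s] /= ss sm sK.
- have -> : EW (moments [::]) = EW (fun=> 1) by apply: (EW_ext gueW) => M _; rewrite /moments big_nil.
  by rewrite EW_cst big_nil.
- have -> : EW (moments (0%N :: s)) = EW (moments s).
    apply: (EW_ext gueW) => M _; rewrite /moments big_cons /moment /mxpow /= mxtrace1.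
    by rewrite -realC_nat -realCM mulVf ?gt_eqF// mul1r.
  by rewrite big_cons beta0 mul1r IHr.
rewrite EW_moments// big_cons betaS mulrDl; apply: lerD.
  rewrite mulr_suml; apply: ler_sum => j _.
  have -> : beta rho delta j * beta rho delta (k.-1 - j) * \prod_(l <- s) beta rho delta l =
      \prod_(l <- [:: val j, (k.-1 - j)%N & s]) beta rho delta l by rewrite !big_cons mulrA.
  have jk := ltn_ord j; by apply: IHm => /=; lia.
have h : \sum_(cq <- contractions s k) cq.1%:R * EW (moments cq.2) <=
    \sum_(cq <- contractions s k) cq.1%:R * \prod_(l <- cq.2) beta rho delta l.
  rewrite big_seq [leRHS]big_seq; apply: ler_sum => cq cqs.
  (* An index 0 is contracted with weight 0, so the truncated predecessor in [contractions] does no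
     harm. *)
  have [c0|c0] := posnP cq.1; first by rewrite c0 !mul0r.
  have [e s0] := sumn_contractions cqs c0.
  by apply: ler_wpM2l => //; apply: IHm; rewrite e; lia.
apply: le_trans (_ : N^-1 ^+ 2 * \sum_(cq <- contractions s k) cq.1%:R * \prod_(l <- cq.2) beta rho delta l <= _).
  by apply: ler_wpM2l => //; exact: sqr_ge0.
have skK : (sumn s + k <= K)%N by lia.
have := @sum_contractions_le _ rho delta rho0 delta0 K k s erefl dK skK.
set S := \sum_(cq <- _) _; set p := \prod_(l <- s) _ => hS.
have p0 : 0 <= p by apply: prodr_ge0 => l _; rewrite ltW// beta_gt0.
have dr : 0 < delta * rho by rewrite mulr_gt0.
rewrite -(ler_pM2l dr) mulrCA.
apply: le_trans (_ : N^-1 ^+ 2 * (2 * rho ^+ k * K%:R * p) <= _).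
  apply: ler_wpM2l; first exact: sqr_ge0.
  apply: le_trans hS _; apply: ler_wpM2r => //; apply: ler_wpM2l.
    by rewrite mulr_ge0// exprn_ge0// ltW.
  by rewrite ler_nat; lia.
have -> : N^-1 ^+ 2 * (2 * rho ^+ k * K%:R * p) = (rho ^+ k * p) * (2 * K%:R * N ^- 2) by rewrite exprVn; ring.
have -> : delta * rho * (delta * rho ^+ k.+1 * p) = (rho ^+ k * p) * (delta ^+ 2 * rho ^+ 2) by rewrite exprS; ring.
apply: ler_wpM2l; first by rewrite mulr_ge0// exprn_ge0// ltW.
rewrite ler_pdivrMr ?exprn_gt0//.
have -> : delta ^+ 2 * rho ^+ 2 * N ^+ 2 = 25 / 64 * K%:R ^- 2 * N ^+ 2.
  by rewrite /delta /rho; field; rewrite gt_eqF.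
apply: le_trans (_ : 25 / 64 * K%:R ^- 2 * (6 * K%:R ^+ 3) <= _).
  have -> : 25 / 64 * K%:R ^- 2 * (6 * K%:R ^+ 3) = 150 / 64 * K%:R :> R by field; rewrite gt_eqF.
  lra.
by apply: ler_wpM2l => //; rewrite mulr_ge0// invr_ge0 exprn_ge0// ltW.
Qed.

Lemma EW_trace_power K : (0 < K)%N -> 6 * K%:R ^+ 3 <= N ^+ 2 ->
  EW (fun M => \tr (mxpow K M)) <= N * (2 * (5 / 2) ^+ K).
Proof.
move=> K0 KN; have N0 : 0 < N by rewrite ltr0n.
have -> : EW (fun M => \tr (mxpow K M)) = N * EW (moments [:: K]).
  rewrite -EW_Z//; last exact: good_moments.
  apply: (EW_ext gueW) => M _; congr re.
  by rewrite /moments big_seq1 /moment mulrA -realCM divff ?gt_eqF// mul1r.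
rewrite ler_pM2l//; apply: le_trans (EW_moments_le K0 KN _) _; first by rewrite /= addn0.
rewrite big_seq1; apply: (@beta_le _ _ _ _ _ K) => //.
- by rewrite invr_gt0 mulr_gt0// ltr0n.
- by rewrite invfM mulfVK// gt_eqF// ltr0n.
Qed.

End moment_bound.

(** * Eigenvector overlaps *)

Section spectral.
Variables (R : realType) (n : nat).
Local Notation M_ := 'M[R[i]]_n.
Implicit Types (x y : 'cV[R[i]]_n) (M A : M_).

Lemma herm_hermsym A : A \is hermsymmx -> herm A.
Proof. by rewrite is_hermitianmxE expr0 scale1r => /eqP h; rewrite /herm -h. Qed.

Lemma trCK p q (X : 'M[R[i]]_(p, q)) : (X^t*)^t* = X.
Proof. by apply/matrixP => i j; rewrite !mxE conjCK. Qed.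

Lemma innerJ x y : inner x y = (inner y x)^*%R.
Proof.
rewrite /inner; have -> : y^t* *m x = (x^t* *m y)^t* .
  by rewrite mulmx_trC trCK.
by rewrite mxE [_^T 0 0]mxE.
Qed.

Lemma inner_sum (I : finType) (p : pred I) (F : I -> 'cV[R[i]]_n) y :
  inner (\sum_(i | p i) F i) y = \sum_(i | p i) inner (F i) y.
Proof. by rewrite /inner mulmx_sumr summxE. Qed.

Lemma innerZ a x y : inner (a *: x) y = a * inner x y.
Proof. by rewrite /inner -scalemxAr mxZE. Qed.

Lemma hs2_inner x : (hs2 x)%:C = inner x x.
Proof. by rewrite -tr_hs2 /mxtrace big_ord1. Qed.

Variables (M : M_) (lam : 'I_n -> R) (u : 'I_n -> 'cV[R[i]]_n).
Hypothesis hM : herm M.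
Hypothesis eig : eigensystem M lam u.

Lemma eig_unit k : hs2 (u k) = 1.
Proof.
have [_ /(_ k k) + _] := eig; rewrite -hs2_inner eqxx.
by move=> /(congr1 (@complex.Re R)).
Qed.

Lemma inner_resolvent z x k :
  inner ((M - z%:M) *m x) (u k) = ((lam k)%:C - z) * inner x (u k).
Proof.
have [_ _ /(_ k) e] := eig.
have e2 : (u k)^t* *m M = (lam k)%:C *: (u k)^t*.
  rewrite -[M in LHS]hM -mulmx_trC e; apply/matrixP => i j.
  by rewrite !mxE rmorphM /= realCJ.
rewrite /inner mulmxA mulmxBr e2 mul_mx_scalar -scalerBl -scalemxAl.
by rewrite mxZE.
Qed.

(** Completeness of the family comes from its cardinality: the square matrix [U] of the eigenvectors
    has U* U = 1, hence also U U* = 1. *)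
Lemma parseval x : hs2 x = \sum_k cabs (inner x (u k)) ^+ 2.
Proof.
have [_ ort _] := eig.
pose U : M_ := \matrix_(i, k) u k i 0.
have ux k : (U^t* *m x) k 0 = inner x (u k).
  by rewrite /inner !mxE; apply: eq_bigr => i _; rewrite !mxE.
have UU : U^t* *m U = 1%:M.
  apply/matrixP => a b; rewrite [RHS]mxE eq_sym -ort.
  by rewrite /inner !mxE; apply: eq_bigr => i _; rewrite !mxE.
have {}UU := mulmx1C UU.
have <- : hs2 (U^t* *m x) = hs2 x.
  suff : (hs2 (U^t* *m x))%:C = (hs2 x)%:C by move=> /(congr1 (@complex.Re R)).
  rewrite -!tr_hs2 mulmx_trC.
  by rewrite trCK mulmxA -(mulmxA _ U) UU mulmx1.
by rewrite /hs2; apply: eq_bigr => k _; rewrite big_ord1 ux.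
Qed.

Lemma hs2_eig (c : R) x : hs2 ((M - (c%:C)%:M) *m x) =
  \sum_k (lam k - c) ^+ 2 * cabs (inner x (u k)) ^+ 2.
Proof.
rewrite parseval; apply: eq_bigr => k _.
rewrite inner_resolvent cabsM exprMn; congr (_ * _).
by rewrite cabs_sqr reB imB /= subr0 expr0n addr0.
Qed.

(** For y = (M - z)^-1 x the imaginary part is im z hs2 y, and Parseval's identity is applied to y,
    whose coordinates are those of x divided by lam k - z. *)
Lemma im_qf_res x (z : R[i]) : im z != 0 ->
  im (qf x (res M z)) = im z * \sum_k cabs (inner x (u k)) ^+ 2 / ((lam k - re z) ^+ 2 + im z ^+ 2).
Proof.
move=> z0; pose y := res M z *m x.
have xy : (M - z%:M) *m y = x by rewrite /y mulmxA mulmxV ?mul1mx// res_unit.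
have e1 : im (qf x (res M z)) = im z * hs2 y.
  have := im_tr_form z y hM; rewrite xy.
  have -> : \tr (y^t* *m x) = (qf x (res M z))^*%R.
    rewrite -trC_conj /qf /y !mulmx_trC trCK.
    by rewrite [LHS]mxtrace_mulC [RHS]mxtrace_mulC mulmxA.
  by rewrite imJ mulNr => /oppr_inj.
rewrite e1 parseval; congr (_ * _); apply: eq_bigr => k _.
have d0 : (lam k - re z) ^+ 2 + im z ^+ 2 != 0.
  have i0 : 0 < im z ^+ 2 by rewrite lt_def sqr_ge0 sqrf_eq0 z0.
  by have := sqr_ge0 (lam k - re z); lra.
have -> : inner x (u k) = ((lam k)%:C - z) * inner y (u k) by rewrite -inner_resolvent xy.
rewrite cabsM exprMn (cabs_sqr (_ - _)) reB imB /= sub0r sqrrN.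
by rewrite mulrC mulKf.
Qed.

(* A Lorentzian of width [eta] is at most 1, and at most 1/2 off the window. *)
Lemma window_mass x (e eta : R) : 0 < eta -> hs2 x = 1 ->
  2 * (eta * im (qf x (res M (e +i* eta)))) - 1 <=
  \sum_(k | `|lam k - e| < eta) cabs (inner x (u k)) ^+ 2.
Proof.
move=> eta0 x1; rewrite im_qf_res ?gt_eqF//=.
have := parseval x; rewrite x1 => p1.
have -> : forall a : R, a - 1 = a - \sum_k cabs (inner x (u k)) ^+ 2 by move=> a; rewrite -p1.
rewrite !mulr_sumr -sumrB.
rewrite [leRHS]big_mkcond; apply: ler_sum => k _ /=.
have q0 := sqr_ge0 (cabs (inner x (u k))); move: (cabs _ ^+ 2) q0 => q q0.
set D := (lam k - e) ^+ 2; have D0 : 0 <= D by exact: sqr_ge0.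
have e20 : 0 < eta ^+ 2 by rewrite exprn_gt0.
have De : 0 < D + eta ^+ 2 by lra.
have -> : 2 * (eta * (eta * (q / (D + eta ^+ 2)))) - q = q * (eta ^+ 2 - D) / (D + eta ^+ 2).
  by field; rewrite gt_eqF.
case: ifP => [_|/negbT]; first by rewrite ler_pdivrMr// ler_wpM2l//; lra.
rewrite -leNgt => h; rewrite ler_pdivrMr// mul0r.
rewrite mulr_ge0_le0// subr_le0 /D -[leRHS]real_normK ?num_real//.
by rewrite ler_sqr ?nnegrE// ltW.
Qed.

Lemma window_mass_le1 x (e eta : R) : 0 < eta -> hs2 x = 1 ->
  eta * im (qf x (res M (e +i* eta))) <= 1.
Proof.
move=> eta0 x1; rewrite im_qf_res ?gt_eqF//=.
rewrite -x1 parseval !mulr_sumr; apply: ler_sum => k _ /=.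
have q0 := sqr_ge0 (cabs (inner x (u k))); move: (cabs _ ^+ 2) q0 => q q0.
set D := (lam k - e) ^+ 2; have D0 : 0 <= D by exact: sqr_ge0.
have e20 : 0 < eta ^+ 2 by rewrite exprn_gt0.
have De : 0 < D + eta ^+ 2 by lra.
have -> : eta * (eta * (q / (D + eta ^+ 2))) = q * eta ^+ 2 / (D + eta ^+ 2).
  by field; rewrite gt_eqF.
by rewrite ler_pdivrMr// ler_wpM2l//; lra.
Qed.

End spectral.

(** * Counting eigenvalues and the pointwise lower bound *)

Lemma dist_midpoint (R : realType) (a b w l : R) : a < b -> 0 < w -> (l < a - w) || (b + w < l) ->
  ((b - a) / 2 + w) ^+ 2 < (l - (a + b) / 2) ^+ 2.
Proof.
move=> ab w0 h; rewrite -subr_gt0.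
have -> : (l - (a + b) / 2) ^+ 2 - ((b - a) / 2 + w) ^+ 2 = (a - w - l) * (b + w - l) by field.
case/orP: h => h.
  by apply: mulr_gt0; [rewrite subr_gt0|lra].
by rewrite nmulr_rgt0; lra.
Qed.

Section counting.
Variables (R : realType) (n : nat).

(** The triangle inequality for the Hilbert-Schmidt norm, in a form free of square roots. *)
Lemma hs2D_le p q (X Y : 'M[R[i]]_(p, q)) (a b h : R) : 0 <= a -> 0 <= b -> 0 <= h ->
  hs2 X <= a ^+ 2 * h -> hs2 Y <= b ^+ 2 * h -> hs2 (X + Y) <= (a + b) ^+ 2 * h.
Proof.
move=> a0 b0 h0 hX hY.
have e : hs2 (X + Y) = hs2 X + hs2 Y + 2 * re (\tr (X^t* *m Y)).
  suff : re (hs2 (X + Y))%:C = hs2 X + hs2 Y + 2 * re (\tr (X^t* *m Y)) by [].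
  have -> : (hs2 (X + Y))%:C = \tr (X^t* *m X) + \tr (Y^t* *m Y) + (\tr (X^t* *m Y) + (\tr (X^t* *m Y))^*%R).
    rewrite -trC_conj -tr_hs2 mulmx_trC trCK.
    have -> : (X + Y)^t* = X^t* + Y^t* by apply/matrixP => i j; rewrite !mxE rmorphD.
    move: (X^t*) (Y^t*) => X' Y'; rewrite mulmxDl !mulmxDr !mxtraceD.
    by rewrite [\tr (Y' *m X) + _]addrC addrACA.
  by rewrite !reD reJ !tr_hs2 /=; ring.
have c : re (\tr (X^t* *m Y)) <= a * b * h.
  apply: le_trans (ler_norm _) _; apply: le_trans (re_le_cabs _) _.
  rewrite -ler_sqr ?nnegrE ?cabs_ge0 ?mulr_ge0//.
  apply: le_trans (tr_CS _ _) _; rewrite hs2_trC.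
  have -> : (a * b * h) ^+ 2 = (a ^+ 2 * h) * (b ^+ 2 * h) by ring.
  by apply: ler_pM => //; exact: hs2_ge0.
have -> : (a + b) ^+ 2 * h = a ^+ 2 * h + b ^+ 2 * h + 2 * (a * b * h) by ring.
by rewrite e; lra.
Qed.

Variables (A M : 'M[R[i]]_n) (sg : R) (lam0 lamt : 'I_n -> R) (u0 ut : 'I_n -> 'cV[R[i]]_n).
Hypotheses (hA : herm A) (hM : herm M) (sg0 : 0 < sg).
Hypotheses (eig0 : eigensystem A lam0 u0) (eigt : eigensystem (A + sg%:C *: M) lamt ut).

(* Otherwise some nonzero combination of the [ut k], k in the window, is
   orthogonal to all [u0 j] counted on the right. *)
Lemma eigenvalue_count (El Eu : R) : El < Eu ->
  (forall x : 'cV_n, hs2 (M *m x) <= 3 ^+ 2 * hs2 x) ->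
  (#|[set k | (El <= lamt k <= Eu)%R]%SET| <=
   #|[set k | (El - 3 * sg <= lam0 k <= Eu + 3 * sg)%R]%SET|)%N.
Proof.
move=> ElEu normM.
set K2 := [set k | El <= lamt k <= Eu]%SET.
set B := [set k | El - 3 * sg <= lam0 k <= Eu + 3 * sg]%SET.
rewrite leqNgt; apply/negP => BK.
have hH : herm (A + sg%:C *: M) by apply: hermD => //; exact: hermZ.
pose G : 'M[R[i]]_(#|K2|, #|B|) := \matrix_(i, j) inner (ut (enum_val i)) (u0 (enum_val j)).
have kG : kermx G != 0.
  by rewrite -mxrank_eq0 mxrank_ker subn_eq0 -ltnNge (leq_ltn_trans (rank_leq_col _)).
have [r r0] : exists r, row r (kermx G) != 0.
  apply/existsP; rewrite -negb_forall; apply: contra kG => /forallP h.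
  by apply/eqP/row_matrixP => i; rewrite row0; exact/eqP.
set y := row r (kermx G) in r0.
have yG : y *m G = 0 by rewrite /y -row_mul mulmx_ker row0.
pose x : 'cV[R[i]]_n := \sum_i y 0 i *: ut (enum_val i).
have [_ ortt _] := eigt.
have xt k : inner x (ut k) = \sum_i y 0 i * (enum_val i == k)%:R.
  by rewrite inner_sum; apply: eq_bigr => i _; rewrite innerZ ortt.
have xt0 k : k \notin K2 -> inner x (ut k) = 0.
  move=> kK; rewrite xt big1// => i _; case: eqVneq => [e|]; last by rewrite mulr0.
  by move: kK; rewrite -e enum_valP.
have xB j : j \in B -> inner x (u0 j) = 0.
  move=> jB; have := congr1 (fun Q : 'rV_ _ => Q 0 (enum_rank_in jB j)) yG.
  rewrite mxE mxE => h; rewrite inner_sum -[RHS]h; apply: eq_bigr => i _.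
  by rewrite innerZ !mxE enum_rankK_in.
have x0 : 0 < hs2 x.
  have [i yi] : exists i, y 0 i != 0.
    apply/existsP; rewrite -negb_forall; apply: contra r0 => /forallP h.
    by apply/eqP/rowP => i; rewrite [RHS]mxE; exact/eqP.
  rewrite (parseval eigt) (bigD1 (enum_val i))//=.
  have -> : inner x (ut (enum_val i)) = y 0 i.
    rewrite xt (bigD1 i)//= eqxx mulr1 big1 ?addr0// => j ji.
    by rewrite (inj_eq enum_val_inj) (negbTE ji) mulr0.
  rewrite ltr_pwDl//; last by apply: sumr_ge0 => j _; exact: sqr_ge0.
  by rewrite exprn_gt0// lt_def cabs_ge0 cabs_eq0 yi.
(* Distances are measured from the midpoint [c]. The vector [x] lies in the span of the [ut k] with
   [lamt k] within [L] of [c], so A - c stretches it by at most L + 3 sg; but [x] only involves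
   [u0 j] with [lam0 j] farther than L + 3 sg from [c], which is contradictory. *)
pose c := (El + Eu) / 2; pose L := (Eu - El) / 2.
have L0 : 0 < L by rewrite /L; lra.
have up1 : hs2 ((A + sg%:C *: M - (c%:C)%:M) *m x) <= L ^+ 2 * hs2 x.
  rewrite (hs2_eig hH eigt) (parseval eigt) mulr_sumr; apply: ler_sum => k _.
  have [kK|kK] := boolP (k \in K2); last by rewrite xt0// cabs0 expr0n !mulr0.
  apply: ler_wpM2r; first exact: sqr_ge0.
  move: kK; rewrite inE => /andP[h1 h2].
  rewrite -subr_ge0; have -> : L ^+ 2 - (lamt k - c) ^+ 2 = (lamt k - El) * (Eu - lamt k).
    by rewrite /L /c; field.
  by rewrite mulr_ge0// subr_ge0.
have up2 : hs2 (- (sg%:C *: M *m x)) <= (3 * sg) ^+ 2 * hs2 x.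
  have -> : hs2 (- (sg%:C *: M *m x)) = sg ^+ 2 * hs2 (M *m x).
    rewrite /hs2 mulr_sumr; apply: eq_bigr => i _; rewrite mulr_sumr; apply: eq_bigr => k _.
    rewrite mxNE cabsN -scalemxAl mxZE cabsM cabs_real exprMn.
    by rewrite real_normK ?num_real.
  have -> : (3 * sg) ^+ 2 * hs2 x = sg ^+ 2 * (3 ^+ 2 * hs2 x) by rewrite exprMn; ring.
  by rewrite ler_pM2l ?exprn_gt0.
have up : hs2 ((A - (c%:C)%:M) *m x) <= (L + 3 * sg) ^+ 2 * hs2 x.
  have -> : (A - (c%:C)%:M) *m x = (A + sg%:C *: M - (c%:C)%:M) *m x + - (sg%:C *: M *m x).
    by rewrite !mulmxBl mulmxDl -scalemxAl addrAC addrK.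
  by apply: hs2D_le => //; rewrite ?(ltW L0) ?(ltW x0)// mulr_ge0// ltW.
have low : (L + 3 * sg) ^+ 2 * hs2 x < hs2 ((A - (c%:C)%:M) *m x).
  rewrite (hs2_eig hA eig0) [in ltLHS](parseval eig0) mulr_sumr.
  have [j jx] : exists j, inner x (u0 j) != 0.
    apply/existsP; apply: contraTT x0; rewrite negb_exists => /forallP h.
    rewrite -leNgt (parseval eig0) big1// => j _.
    by have := h j; rewrite negbK => /eqP ->; rewrite cabs0 expr0n.
  have key k : k \notin B -> (L + 3 * sg) ^+ 2 < (lam0 k - c) ^+ 2.
    by rewrite inE negb_and -!ltNge; apply: dist_midpoint => //; rewrite mulr_gt0.
  have jB : j \notin B by apply: contra jx => jB; rewrite xB.
  rewrite (bigD1 j)//= [ltRHS](bigD1 j)//=; apply: ltr_leD.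
    by rewrite ltr_pM2r ?key// exprn_gt0// lt_def cabs_ge0 cabs_eq0 jx.
  apply: ler_sum => k _; have [kB|kB] := boolP (k \in B).
    by rewrite xB// cabs0 expr0n !mulr0.
  by apply: ler_wpM2r; [exact: sqr_ge0|rewrite ltW// key].
by have := lt_le_trans low up; rewrite ltxx.
Qed.

(** A bound valid for every matrix [M], whose left side no longer refers to the eigenvectors of the
    perturbed matrix. The subtracted trace makes the left side nonpositive when |M| > 3; otherwise
    [eigenvalue_count] allows the denominator |K_2| to be replaced by b. *)
Lemma overlap_lower (K : {set 'I_n}) (El Eu : R) p : (0 < n)%N -> El < Eu ->
  (forall j, j \in K -> El + n%:R^-1 <= lam0 j <= Eu - n%:R^-1) ->
  #|[set k | El - 3 * sg <= lam0 k <= Eu + 3 * sg]%SET|%:R^-1 *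
   (\sum_(j in K) (2 * (n%:R^-1 * im (qf (u0 j) (res (A + sg%:C *: M) (lam0 j +i* n%:R^-1)))) - 1 -
     re (\tr (mxpow (p + p) M)) / (3 ^+ 2) ^+ p)) <=
  #|[set k | El <= lamt k <= Eu]%SET|%:R^-1 *
   \sum_(k in [set k | El <= lamt k <= Eu]%SET)
     \sum_(j in K | `|lamt k - lam0 j| < n%:R^-1) cabs (inner (ut k) (u0 j)) ^+ 2.
Proof.
move=> n0 ElEu KE; set eta := n%:R^-1; have eta0 : 0 < eta by rewrite invr_gt0 ltr0n.
have hH : herm (A + sg%:C *: M) by apply: hermD => //; exact: hermZ.
set b := #|_|; set K2 := [set k | El <= lamt k <= Eu]%SET; set tau := re _ / _.
pose w j := \sum_(k | `|lamt k - lam0 j| < eta) cabs (inner (u0 j) (ut k)) ^+ 2.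
have w0 j : 0 <= w j by apply: sumr_ge0 => k _; exact: sqr_ge0.
have -> : \sum_(k in K2) \sum_(j in K | `|lamt k - lam0 j| < eta) cabs (inner (ut k) (u0 j)) ^+ 2 =
    \sum_(j in K) w j.
  rewrite (exchange_big_dep (mem K)) => [|k j _ /andP[]//]; apply: eq_bigr => j jK'.
  have jK : j \in K by [].
  apply: eq_big => [k|k _]; last by rewrite innerJ cabsJ.
  rewrite jK andTb inE; case: (ltP _ eta) => [|_]; last by rewrite andbF.
  (* The margin 1/n in the condition on [K] places the whole window around [lam0 j] inside [El, Eu],
     so restricting to [K2] loses no mass. *)
  have /andP[h1 h2] := KE j jK; rewrite ltr_distl => /andP[h3 h4].
  by rewrite andbT; apply/andP; split; rewrite -/eta in h1 h2; lra.
have S0 : 0 <= \sum_(j in K) w j by apply: sumr_ge0.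
have b0 : 0 <= b%:R^-1 :> R by rewrite invr_ge0.
have u01 j := eig_unit eig0 j.
have tau0 : 0 <= tau by rewrite divr_ge0 ?exprn_ge0// tr_mxpow_ge0.
(* If some vector is stretched by more than 3, then [tau] >= 1, while im qf / n <= 1: every summand
   on the left is at most 2 - 1 - 1. *)
have [[x hx]|normM] := pselect (exists x : 'cV_n, 3 ^+ 2 * hs2 x < hs2 (M *m x)).
  have tau1 : 1 <= tau.
    by rewrite ler_pdivlMr ?exprn_gt0// mul1r; apply: norm_or_trace hx; rewrite ?exprn_gt0.
  apply: (@le_trans _ _ 0); last by rewrite mulr_ge0// invr_ge0.
  apply: mulr_ge0_le0 => //; apply: sumr_le0 => j jK.
  by have := window_mass_le1 hH eigt (lam0 j) eta0 (u01 j); lra.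
have {}normM (x : 'cV_n) : hs2 (M *m x) <= 3 ^+ 2 * hs2 x.
  by rewrite leNgt; apply/negP => h; apply: normM; exists x.
apply: (@le_trans _ _ (b%:R^-1 * \sum_(j in K) w j)).
  apply: ler_wpM2l => //; apply: ler_sum => j jK.
  by have := window_mass hH eigt (lam0 j) eta0 (u01 j); rewrite -/(w j); lra.
have K2b := eigenvalue_count ElEu normM; rewrite -/b -/K2 in K2b.
have [K20|K20] := posnP #|K2|; last first.
  by apply: ler_wpM2r => //; rewrite lef_pV2 ?posrE ?ltr0n ?(leq_trans K20)// ler_nat.
(* With [K2] empty the right side is 0 by convention. Each mass [w j] then vanishes as well, its
   window being contained in [El, Eu]. *)
rewrite K20 invr0 mul0r big1 ?mulr0// => j jK; rewrite /w big1// => k.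
rewrite ltr_distl => /andP[h3 h4]; have /andP[h1 h2] := KE j jK.
suff : k \in K2 by rewrite (cards0_eq K20) inE.
by rewrite inE; apply/andP; split; rewrite -/eta in h1 h2; lra.
Qed.

End counting.

(** * Expectation of the overlap and choice of constants *)

(** [X] is not assumed measurable. The integral of a nonnegative function is a supremum over the
    simple functions below it, hence monotone in any case, and passing from [Y] to its positive part
    only increases the left side. *)
Lemma le_expectation (R : realType) (d : measure_display) (T : measurableType d)
    (P : probability T R) (X Y : T -> R) : (forall w, 0 <= X w) -> (forall w, Y w <= X w) ->
  P.-integrable setT (EFin \o Y) -> ((\int[P]_w Y w)%R%:E <= 'E_P[X])%E.
Proof.
move=> X0 YX iY; rewrite unlock fineK; last exact: integrable_fin_num.
apply: (@le_trans _ _ (\int[P]_w (EFin \o Y)^\+ w)%E).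
  rewrite integralE leeBlDr; first by rewrite leeDl// integral_ge0.
  exact: integrable_neg_fin_num.
have Z0 w : (0 <= (EFin \o Y)^\+ w)%E by exact: funepos_ge0.
rewrite (ge0_integralTE P Z0) ge0_integralTE; last by move=> w; rewrite lee_fin.
apply: ereal_sup_le => _ [h hZ <-]; exists h => // w.
by apply: le_trans (hZ w) _; rewrite funeposE ge_max /= !lee_fin YX X0.
Qed.

Lemma sqrt_nt_ge (R : realType) (n : nat) (t : R) : expR (- Num.sqrt n%:R) <= t ->
  Num.sqrt n%:R * expR (- (Num.sqrt n%:R / 2)) <= Num.sqrt (n%:R * t).
Proof.
set x := Num.sqrt n%:R => et; have x0 : 0 <= x by exact: sqrtr_ge0.
have -> : x * expR (- (x / 2)) = Num.sqrt ((x * expR (- (x / 2))) ^+ 2).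
  by rewrite sqrtr_sqr ger0_norm// mulr_ge0// expR_ge0.
rewrite ler_wsqrtr// exprMn sqr_sqrtr// ler_wpM2l//.
rewrite -expRM_natl; have -> // : 2 * - (x / 2) = - x by field.
Qed.

(** Each unit of m contributes (5/2)^8 / 9^4 <= 1/4 <= 1/e, so with x = sqrt n the left side is at
    most 2 x^2 e^(-x) = 2 (x e^(-x/2))^2. One factor x e^(-x/2) is at most sqrt (n t) by the lower
    bound on t, the other at most 2. *)
Lemma tail_le (R : realType) (n m : nat) (t : R) :
  Num.sqrt (n%:R : R) <= m%:R -> expR (- Num.sqrt n%:R) <= t ->
  n%:R * (2 * (5 / 2) ^+ (4 * m + 4 * m)) / (3 ^+ 2) ^+ (4 * m) <= 4 * Num.sqrt (n%:R * t).
Proof.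
move=> xm et; have es := sqrt_nt_ge et; move: xm et es.
set s := Num.sqrt (n%:R * t).
have xx : n%:R = Num.sqrt (n%:R : R) ^+ 2 by rewrite sqr_sqrtr.
have x0 : 0 <= Num.sqrt (n%:R : R) by rewrite sqrtr_ge0.
move: xx x0; set x := Num.sqrt n%:R => xx x0 xm et es.
have q1 : expR 1 <= 4 :> R.
  have h : expR (1 / 2) <= 2 :> R.
    have h2 := expR_ge1Dx (- (1 / 2) : R).
    have h3 := expR_gt0 (1 / 2 : R).
    have : expR (1 / 2) * expR (- (1 / 2)) = 1 :> R by rewrite -expRD subrr expR0.
    nra.
  have -> : 1 = 1 / 2 + 1 / 2 :> R by field.
  by rewrite expRD; have := expR_gt0 (1 / 2 : R); nra.
have q2 : (5 / 2) ^+ (4 * m + 4 * m) / (3 ^+ 2) ^+ (4 * m) <= expR (- x) :> R.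
  have -> : (4 * m + 4 * m = 8 * m)%N by lia.
  rewrite !exprM -expr_div_n; apply: (@le_trans _ _ ((expR (- 1)) ^+ m)); last first.
    by rewrite -expRM_natl ler_expR mulrN1 lerN2.
  have h : (5 / 2) ^+ 8 / 3 ^+ 2 ^+ 4 <= expR (- 1) :> R.
    rewrite expRN; apply: (@le_trans _ _ 4^-1); last by rewrite lef_pV2 ?posrE ?expR_gt0.
    lra.
  by rewrite lerXn2r ?nnegrE ?expR_ge0// divr_ge0 ?exprn_ge0.
have h : x / 2 <= expR (x / 2).
  by have := expR_ge1Dx (x / 2); lra.
have e2 : expR (- x) = expR (- (x / 2)) * expR (- (x / 2)).
  by rewrite -expRD; congr expR; field.
have e3 : expR (x / 2) * expR (- (x / 2)) = 1 by rewrite -expRD subrr expR0.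
have e0 : 0 <= expR (- (x / 2)) by exact: expR_ge0.
have h2 : x * expR (- (x / 2)) <= 2.
  have := ler_wpM2r e0 h; rewrite e3; lra.
apply: (@le_trans _ _ (2 * x ^+ 2 * expR (- x))).
  move: q2; rewrite -xx; set a := _ ^+ _; set b := _ ^+ _ => q2.
  have -> : n%:R * (2 * a) / b = 2 * n%:R * (a / b) by ring.
  by apply: ler_wpM2l.
rewrite e2; move: h2 es e0; set e := expR _ => h2 es e0.
have -> : 2 * x ^+ 2 * (e * e) = 2 * ((x * e) * (x * e)) by ring.
have xe : 0 <= x * e by exact: mulr_ge0.
by nra.
Qed.

Lemma ceil_sqrt (R : realType) (n : nat) : (0 < n)%N ->
  exists m : nat, Num.sqrt (n%:R : R) <= m%:R <= 2 * Num.sqrt (n%:R : R).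
Proof.
move=> n0; have x1 : 1 <= Num.sqrt (n%:R : R).
  by rewrite -[leLHS]sqrtr1 ler_wsqrtr// ler1n.
exists (Num.truncn (Num.sqrt (n%:R : R))).+1.
have x0 := le_trans ler01 x1.
have /andP[h1 h2] := truncn_itv x0.
by rewrite ltW//= -natr1; lra.
Qed.

Section main_bound.
Variables (R : realType) (d : measure_display) (T : measurableType d).
Variables (P : probability T R) (n : nat) (W : T -> 'M[R[i]]_n).
Hypotheses (n0 : (0 < n)%N) (gueW : gue P W).
Variables (A : 'M[R[i]]_n) (t : R) (lam0 : 'I_n -> R) (u0 : 'I_n -> 'cV[R[i]]_n).
Hypotheses (hA : herm A) (t0 : 0 < t) (eig0 : eigensystem A lam0 u0).

Let G j M := 1 + (n%:R^-1)%:C * 'i * qf (u0 j) (GG A t (lam0 j) M).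

Lemma good_G j : good (G j).
Proof.
have gG : mgood (GG A t (lam0 j)) by move=> a b; have [] := mdiff_GG n0 t (lam0 j) hA a b.
apply: goodD; first exact: good_cst.
apply: goodM; first exact: good_cst.
apply: good_sum => a _; apply: mgoodM => // b c; exact: good_cst.
Qed.

Lemma re_G j M : re (G j M) = 1 - n%:R^-1 * im (qf (u0 j) (GG A t (lam0 j) M)).
Proof. by rewrite reD re_iN. Qed.

(** As 2 y - 1 = 1 - 2 (1 - y), the bound 3 s on the expectation of 1 - im G_jj / n enters twice;
    the trace term is bounded by [EW_trace_power]. *)
Lemma expected_overlap (s a : R) (K : {set 'I_n}) (p : nat) (X : T -> R) :
  0 <= a -> 0 < s -> s <= 8^-1 -> s ^+ 2 = n%:R * t -> (0 < p)%N ->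
  6 * (p + p)%:R ^+ 3 <= (n%:R : R) ^+ 2 ->
  (forall j, j \in K -> cabs (stieltjes A (lam0 j +i* n%:R^-1)) <= s^-1) ->
  (forall w, 0 <= X w) ->
  (forall w, a * (\sum_(j in K) (2 * (n%:R^-1 * im (qf (u0 j) (GG A t (lam0 j) (W w)))) - 1 -
     re (\tr (mxpow (p + p) (W w))) / (3 ^+ 2) ^+ p)) <= X w) ->
  ((a * #|K|%:R * (1 - 6 * s - n%:R * (2 * (5 / 2) ^+ (p + p)) / (3 ^+ 2) ^+ p))%:E <= 'E_P[X])%E.
Proof.
move=> a0 s0 s8 ss p0 pn Km X0 YX.
pose F M := \sum_(j in K) (a%:C * (1%:C * 1 + (- 2)%:C * G j M + (- (3 ^+ 2) ^- p)%:C * \tr (mxpow (p + p) M))).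
have gtr : good (fun M : 'M[R[i]]_n => \tr (mxpow (p + p) M)) by apply: good_sum => i _; exact: mgood_mxpow.
have gF j : good (fun M => 1%:C * 1 + (- 2)%:C * G j M + (- (3 ^+ 2) ^- p)%:C * \tr (mxpow (p + p) M)).
  by apply: goodD; [apply: goodD; apply: good_scale; [exact: good_cst|exact: good_G]|exact: good_scale].
have gaF j := good_scale a (gF j).
have gFF : good F by apply: good_sum => j _; exact: gaF.
have FX w : re (F (W w)) <= X w.
  apply: le_trans (YX w); rewrite /F re_sum [leRHS]mulr_sumr; apply: ler_sum => j _.
  rewrite reZ 2!reD !reZ re_G /= ler_wpM2l//; lra.
apply: le_trans (le_expectation X0 FX (EW_integrable n0 gueW gFF)).
rewrite lee_fin -/(EW P W F).
have -> : EW P W F = \sum_(j in K) a * (1 - 2 * EW P W (G j) - EW P W (fun M => \tr (mxpow (p + p) M)) / (3 ^+ 2) ^+ p).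
  transitivity (EW P W (fun M => \sum_(j <- enum K) a%:C * (1%:C * 1 + (- 2)%:C * G j M + (- (3 ^+ 2) ^- p)%:C * \tr (mxpow (p + p) M)))).
    by apply: (EW_ext gueW) => M _; congr re; rewrite /F -big_enum.
  rewrite (EW_sum n0 gueW _ gaF) -[RHS]big_enum /=; apply: eq_bigr => j _.
  rewrite EW_Z//; congr (_ * _).
  rewrite (EW_lin3 n0 gueW _ _ _ (good_cst n 1) (good_G j) gtr) EW_cst /=.
  by move: (EW P W _) (EW P W _) => y z; ring.
set q := 1 - 6 * s - _.
have -> : a * #|K|%:R * q = \sum_(j in K) a * q.
  by rewrite sumr_const -[RHS]mulr_natr mulrAC.
apply: ler_sum => j jK; apply: ler_wpM2l => //; rewrite /q.
have e1 := EW_local n0 gueW hA t0 (eig_unit eig0 j) (_ : A *m u0 j = (lam0 j)%:C *: u0 j) s0 s8 ss.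
have {}e1 : EW P W (G j) <= 3 * s.
  apply: e1; first by have [_ _] := eig0.
  apply: le_trans (Km j jK); rewrite /stieltjes /res /zz realCV realC_nat//.
have e2 := EW_trace_power n0 gueW (_ : (0 < p + p)%N) pn.
have {}e2 : EW P W (fun M => \tr (mxpow (p + p) M)) / (3 ^+ 2) ^+ p <= n%:R * (2 * (5 / 2) ^+ (p + p)) / (3 ^+ 2) ^+ p.
  by rewrite ler_pM2r ?invr_gt0 ?exprn_gt0// e2// addn_gt0 p0.
lra.
Qed.

End main_bound.

Theorem theorem13 (R : realType) :
  exists c : R,
  forall (n : nat) (d : measure_display) (T : measurableType d)
    (P : probability T R) (A : 'M[R[i]]_n) (W : T -> 'M[R[i]]_n)
    (t El Eu : R)
    (lam0 : 'I_n -> R) (u0 : 'I_n -> 'cV[R[i]]_n)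
    (lamt : T -> 'I_n -> R) (ut : T -> 'I_n -> 'cV[R[i]]_n)
    (K : {set 'I_n}),
  (0 < n)%N ->
  A \is hermsymmx ->
  gue P W ->
  eigensystem A lam0 u0 ->
  (forall w, eigensystem (A + (Num.sqrt t)%:C *: W w) (lamt w) (ut w)) ->
  El < Eu ->
  (forall j, j \in K ->
     El + n%:R^-1 <= lam0 j <= Eu - n%:R^-1 /\
     Normc.normc (stieltjes A (lam0 j +i* n%:R^-1))
       <= (Num.sqrt (n%:R * t))^-1) ->
  expR (- Num.sqrt n%:R) <= t ->
  let v w (k j : 'I_n) : R[i] := inner (ut w k) (u0 j) in
  let K2 w : {set 'I_n} := [set k | El <= lamt w k <= Eu]%SET in
  let b : nat :=
    #|[set k | El - 3 * Num.sqrt t <= lam0 k <= Eu + 3 * Num.sqrt t]%SET| in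
  let X w : R := #|K2 w|%:R^-1 *
    \sum_(k in K2 w) \sum_(j in K | `|lamt w k - lam0 j| < n%:R^-1)
      Normc.normc (v w k j) ^+ 2 in
  ((#|K|%:R / b%:R * (1 - c * Num.sqrt (n%:R * t)))%:E <= 'E_P[X])%E.
Proof.
(* With this constant the claim is trivial when [Num.sqrt n < B], so that the
   moment bound, which needs [6 * (8 * m) ^+ 3 <= n ^+ 2] with m of order
   [Num.sqrt n], is available in the remaining case. *)
pose B : R := 6 * 16 ^+ 3; exists (10 + expR (B / 2)).
move=> n d T P A W t El Eu lam0 u0 lamt ut K n0 /herm_hermsym hA gueW eig0 eigt ElEu KE et.
cbv zeta beta; set X := (X in 'E_P[X]%E); set b := (X in _ / X%:R).
have t0 : 0 < t by apply: lt_le_trans et; exact: expR_gt0.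
have N0 : 0 < n%:R :> R by rewrite ltr0n.
have sg0 : 0 < Num.sqrt t by rewrite sqrtr_gt0.
set s := Num.sqrt (n%:R * t).
have s0 : 0 < s by rewrite sqrtr_gt0 mulr_gt0.
have ss : s ^+ 2 = n%:R * t by rewrite sqr_sqrtr// ltW// mulr_gt0.
have X0 w : 0 <= X w.
  rewrite mulr_ge0 ?invr_ge0//; apply: sumr_ge0 => k _; apply: sumr_ge0 => j _.
  exact: sqr_ge0.
have eB := expR_gt0 (B / 2).
have [big|small] := leP 1 ((10 + expR (B / 2)) * s).
  apply: (@le_trans _ _ 0%E); last by rewrite unlock integral_ge0// => w _; rewrite lee_fin.
  by rewrite lee_fin mulr_ge0_le0 ?divr_ge0// subr_le0.
have s8 : s <= 8^-1 by nra.
have es := sqrt_nt_ge et; rewrite -/s in es.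
have x1 : 1 <= Num.sqrt (n%:R : R) by rewrite -[leLHS]sqrtr1 ler_wsqrtr// ler1n.
(* Otherwise s >= sqrt n e^(- sqrt n / 2) >= e^(- B / 2), against e^(B / 2) s < 1. *)
have xB : B <= Num.sqrt n%:R.
  rewrite leNgt; apply/negP => xB.
  have h : expR (- (B / 2)) <= s.
    apply: le_trans es; apply: (@le_trans _ _ (expR (- (Num.sqrt n%:R / 2)))).
      by rewrite ler_expR lerN2; lra.
    by rewrite ler_peMl// expR_ge0.
  have : expR (B / 2) * expR (- (B / 2)) = 1 by rewrite -expRD subrr expR0.
  nra.
have [m /andP[xm mx]] := ceil_sqrt R n0.
have m0 : (0 < m)%N by rewrite -(ltr0n R); lra.
(* From m <= 2 sqrt n one gets 8 m <= 16 sqrt n, the origin of 16^3 in [B]; the remaining factor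
   sqrt n of n^2 absorbs [B]. *)
have pn : 6 * (4 * m + 4 * m)%:R ^+ 3 <= (n%:R : R) ^+ 2.
  have -> : n%:R ^+ 2 = Num.sqrt (n%:R : R) * Num.sqrt (n%:R : R) ^+ 3.
    by rewrite -exprS (exprM _ 2 2) sqr_sqrtr.
  set x := Num.sqrt n%:R in xm mx xB x1 *.
  apply: (@le_trans _ _ (B * x ^+ 3)); last by rewrite ler_wpM2r// exprn_ge0//; lra.
  have -> : B * x ^+ 3 = 6 * (16 * x) ^+ 3 by rewrite /B; ring.
  rewrite ler_pM2l// lerXn2r ?nnegrE//; first lra.
  by rewrite natrD !natrM; lra.
have low w := overlap_lower hA (herm_W gueW w) sg0 eig0 (eigt w) (4 * m)%N n0 ElEu (fun j jK => (KE j jK).1).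
have bound := expected_overlap n0 gueW hA t0 eig0 (_ : 0 <= b%:R^-1) s0 s8 ss (_ : (0 < 4 * m)%N) pn (fun j jK => (KE j jK).2) X0 low.
apply: le_trans (bound _ _); rewrite ?muln_gt0 ?invr_ge0//.
rewrite lee_fin [_ / b%:R]mulrC; apply: ler_wpM2l; first by rewrite mulr_ge0// invr_ge0.
(* The losses are 6 s from the local law and at most 4 s from the trace tail, which accounts for the
   10 in the constant. *)
have := tail_le xm et; rewrite -/s; set tail := _ / _ => ht.
have : 0 <= expR (B / 2) * s by rewrite mulr_ge0// ltW.
by rewrite mulrDl; lra.
Qed.
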